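(* Let $d\ge1$, let $\varphi$ satisfy (i) and (ii) of the context, fix $\lambda>0$ and $\ell\in S^{d-1}$, and define $a(\cdot,\omega)=\mathrm{Id}$ and $b(\cdot,\omega)=\nabla\varphi(\cdot,\omega)+\lambda\ell$ for all $\omega$. Then condition $(T)|\ell$ holds.
   Context: $(\Omega,\mathcal A,\mathbb P)$ is a probability space with a group $\{t_x:x\in\mathbb R^d\}$ of transformations, jointly measurable in $(x,\omega)$, with $t_x\mathbb P=\mathbb P$. $\varphi$ is a real random variable, $\varphi(x,\omega)=\varphi(t_x\omega)$. Conditions: (i) $|\varphi(\cdot,\omega)|\le\eta$ for all $\omega$; (ii) $|\nabla\varphi(\cdot,\omega)|\le\tilde\beta$ and $|\nabla\varphi(y,\omega)-\nabla\varphi(z,\omega)|\le K|y-z|$ for all $y,z,\omega$. $P_{x,\omega}$ is the law on $C(\mathbb R_+,\mathbb R^d)$ (canonical process $X$) of the diffusion with generator $\frac12\Delta+b(x,\omega)\cdot\nabla$ started at $x$; the annealed law is $P_0[\cdot]=\mathbb E[P_{0,\omega}[\cdot]]$. Condition $(T)|\ell$: for all $\ell'\in S^{d-1}$ in a neighborhood of $\ell$ and all $b>0$, $\limsup_{L\to\infty}L^{-1}\log P_0[X_{T_{U_{\ell',b,L}}}\cdot\ell'<0]<0$, where $U_{\ell',b,L}=\{x:-bL<x\cdot\ell'<L\}$ and $T_U=\inf\{t\ge0:X_t\notin U\}$. *)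

(* Defs.v *)
From HB Require Import structures.
From mathcomp Require Import all_boot all_order all_algebra.
From mathcomp Require Import all_classical all_reals all_analysis.
From mathcomp Require Import measurable_realfun.
Set Implicit Arguments. Unset Strict Implicit. Unset Printing Implicit Defensive.
Import Order.TTheory GRing.Theory Num.Theory.
Import numFieldNormedType.Exports.
Local Open Scope classical_set_scope.
Local Open Scope ring_scope.

Section Defs.
Variables (R : realType) (d : nat).

Definition dotr (u v : 'rV[R]_d) : R := \sum_(i < d) u 0 i * v 0 i.
Definition enorm (u : 'rV[R]_d) : R := Num.sqrt (dotr u u).

Definition ebasis (i : 'I_d) : 'rV[R]_d := delta_mx 0 i.
Definition partial (i : 'I_d) (f : 'rV[R]_d -> R) (x : 'rV[R]_d) : R :=
  derive f x (ebasis i).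
Definition grad (f : 'rV[R]_d -> R) (x : 'rV[R]_d) : 'rV[R]_d :=
  \row_(i < d) partial i f x.
Definition laplacian (f : 'rV[R]_d -> R) (x : 'rV[R]_d) : R :=
  \sum_(i < d) partial i (partial i f) x.

Definition Cc2 (f : 'rV[R]_d -> R) : Prop :=
  [/\ (forall x, differentiable f x),
      (forall i x, differentiable (partial i f) x),
      (forall i j, continuous (partial i (partial j f)))
    & compact (closure [set x | f x != 0])].

Definition rV_gen : set (set 'rV[R]_d) :=
  [set A | exists (i : 'I_d) (B : set R), measurable B /\ A = [set x : 'rV[R]_d | B (x 0 i)]].
Definition rVM := g_sigma_algebraType rV_gen.

(** canonical path space C(R_+, R^d): continuous paths, extended to negative
    times by the constant value at time 0 (a bijective encoding). *)
Record cpath := CPath {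
  cpath_fun :> R -> 'rV[R]_d ;
  cpath_cont : continuous cpath_fun ;
  cpath_neg : forall t, t <= 0 -> cpath_fun t = cpath_fun 0 }.

Lemma cst0_cont : continuous (fun _ : R => (0 : 'rV[R]_d)).
Proof. by move=> x; exact: cst_continuous. Qed.

Definition cpath0 : cpath := @CPath (fun _ => 0) cst0_cont (fun _ _ => erefl).

HB.instance Definition _ := gen_eqMixin cpath.
HB.instance Definition _ := gen_choiceMixin cpath.
HB.instance Definition _ := isPointed.Build cpath cpath0.

Definition cyl_upto (s : \bar R) : set (set cpath) :=
  [set A | exists (t : R) (i : 'I_d) (B : set R),
     [/\ 0 <= t, (t%:E <= s)%E, measurable B & A = [set w : cpath | B (w t 0 i)]]].

Definition pathM := g_sigma_algebraType (cyl_upto +oo%E).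

Definition generator (b : 'rV[R]_d -> 'rV[R]_d) (f : 'rV[R]_d -> R) (y : 'rV[R]_d) : R :=
  2^-1 * laplacian f y + dotr (b y) (grad f y).

Definition solves_mp (b : 'rV[R]_d -> 'rV[R]_d) (x : 'rV[R]_d)
  (P : probability pathM R) : Prop :=
  P [set w : pathM | cpath_fun w 0 = x] = 1%E /\
  forall f, Cc2 f -> forall s t, 0 <= s -> s <= t ->
   forall A : set pathM, <<s cyl_upto s%:E >> A ->
     (\int[P]_(w in A)
        (f (cpath_fun w t) - f (cpath_fun w s)
         - Rintegral lebesgue_measure `[s, t]
             (fun u => generator b f (cpath_fun w u)))%:E = 0)%E.

(** exit time T_U = inf {t >= 0 : X_t \notin U} (+oo if empty) *)
Definition exit_time (U : set 'rV[R]_d) (w : pathM) : \bar R :=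
  ereal_inf [set t%:E | t in [set t : R | 0 <= t /\ ~ U (cpath_fun w t)]].

Definition slab (l : 'rV[R]_d) (b L : R) : set 'rV[R]_d :=
  [set x | - (b * L) < dotr x l < L].

Definition exit_neg (l : 'rV[R]_d) (b L : R) : set pathM :=
  [set w | exists T : R, exit_time (slab l b L) w = T%:E /\ dotr (cpath_fun w T) l < 0].

End Defs.

(* Main.v *)
Require Import Defs.
From HB Require Import structures.
From mathcomp Require Import all_boot all_order all_algebra.
From mathcomp Require Import all_classical all_reals all_analysis.
From mathcomp Require Import measurable_realfun.
From mathcomp Require Import ring lra zify.
Set Implicit Arguments. Unset Strict Implicit. Unset Printing Implicit Defensive.
Import Order.TTheory GRing.Theory Num.Theory.
Import numFieldNormedType.Exports.
Local Open Scope classical_set_scope.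
Local Open Scope ring_scope.

(* For a fixed environment put psi = e^phi, a = lambda l. The drift is grad(log psi) + a, so the
   diffusion is reversible for the measure e^{2 a.x} psi^2 dx. It is compared with a reversible random
   walk of step dl = 1/M: with (S F)(x) = E[e^{dl a.s} F(x + dl s)] for a uniform sign vector s, set
   Q f = S(psi f) / S psi. Here psi is first smoothed by iterated Steklov averages, which keep its
   bounds, its Lipschitz constant and the one of its gradient.  The martingale problem gives
   E f(X_t) <= Q^n f(0) + o(1) for n = t M^2 by telescoping over the n steps.
   The walk satisfies a weighted L^2 contraction Q^n = O(e^{-kappa t}) (Schur test: the exponential
   weight makes the reversible walk lose mass), so the walk is left of a hyperplane x.l' <= r at time
   t with probability at most C e^{-c t}; an exponential moment bounds the probability of x.l' <= -al
   by C e^{C t - al}.  Interpolating, P(X_t.l' <= -al) <= C e^{-c t - th al}.  A smooth cutoff u of the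
   half space with |generator u| <= 1/2 turns this into a bound for hitting the half space during
   [n, n+1], and summing over n bounds the probability of ever going below level -b L / 2, which
   every exit through the wrong side of the slab does. *)

(** * Derivatives from quadratic estimates *)

(** The iterates [Q^k f] replace it: they are explicit, keep compact support because one step moves
    by at most [dl], and reproduce the generator up to [O(dl^3)]. For this reason [Q] acts on
    functions on the whole space and not on a lattice. The obstacle is the order of the constants.
    The expansion of [Q] requires three derivatives of [Q^k f], whose size depends on the smoothing,
    while [exp phi] only has a Lipschitz gradient. But the drift error made by smoothing is
    multiplied by the Lipschitz constant of [Q^k f] alone, and that constant involves only bounds
    which smoothing preserves. So the smoothing is fixed first and the mesh is refined afterwards.
    The decay estimates of the walk use the same preserved bounds. Hence they are uniform in the
    environment, and the annealed estimate is an integral of quenched ones. The contraction leaves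
    some room in the exponential weight, which is spent on tilting [l] to a nearby [l']. *)

Lemma lipschitz_continuous {R : realType} {V : normedModType R} (f : V -> R) (L : R) :
  (forall x v, `|f (x + v) - f x| <= L * `|v|) -> continuous f.
Proof.
move=> H x; apply/cvgrPdist_le => _/posnumP[e].
have L1 : 0 < `|L| + 1 by rewrite ltr_wpDl.
near=> y; rewrite distrC -{1}(subrK x y) [_ - _ + _]addrC.
apply: le_trans (H _ _) _.
apply: (@le_trans _ _ ((`|L| + 1) * `|y - x|)).
  by rewrite ler_wpM2r// (le_trans (ler_norm _))// lerDl.
by rewrite mulrC -ler_pdivlMr// distrC.
Unshelve. all: by end_near. Qed.

Lemma quad_diff {R : realType} {V : normedModType R} (f : V -> R) (D : {linear V -> R}) x (C : R) :
  continuous D -> (forall v, `|f (x + v) - f x - D v| <= C * `|v| ^+ 2) ->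
  differentiable f x.
Proof.
move=> cD H.
have e : f \o shift x = cst (f x) + D +o_ 0 id.
  have C0 : 0 < `|C| + 1 by rewrite ltr_wpDl.
  apply/eqaddoP => _/posnumP[e]; near=> v => /=.
  rewrite !fctE /= [v + x]addrC opprD addrA.
  apply: le_trans (H v) _; rewrite expr2 mulrA ler_wpM2r//.
  apply: (@le_trans _ _ ((`|C| + 1) * `|v|)).
    by rewrite ler_wpM2r// (le_trans (ler_norm _))// lerDl.
  rewrite mulrC -ler_pdivlMr; last by [].
  near: v; apply/nbhs_norm0P; exists (e%:num / (`|C| + 1)); first exact: divr_gt0.
  by move=> v /= /ltW.
by apply/diff_locallyP; rewrite (diff_unique cD e); split.
Unshelve. all: by end_near. Qed.

Lemma quad_is_derive {R : realType} {V : normedModType R} (f : V -> R) (x v : V) (a C : R) :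
  (forall t : R, `|f (x + t *: v) - f x - t * a| <= C * t ^+ 2) -> is_derive x v f a.
Proof.
move=> H.
have C0 : 0 <= C by have := H 1; rewrite expr1n mulr1; apply: le_trans.
have cv : (fun h => h^-1 *: ((f \o shift x) (h *: v) - f x)) @ 0^' --> a.
  have Cp : 0 < C + 1 by rewrite ltr_wpDl.
  apply/cvgrPdist_le => _/posnumP[e]; near=> h.
  have h0 : h != 0 by near: h; exact: nbhs_dnbhs_neq.
  have -> : a - h^-1 *: ((f \o shift x) (h *: v) - f x)
      = - (h^-1 * (f (x + h *: v) - f x - h * a)).
    by rewrite /= [h *: v + x]addrC /GRing.scale /=; field.
  rewrite normrN normrM normfV ler_pdivrMl ?normr_gt0//.
  apply: le_trans (H h) _; rewrite -[h ^+ 2]real_normK ?num_real// expr2 mulrA mulrC.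
  rewrite ler_pM2l ?normr_gt0//.
  apply: (@le_trans _ _ ((C + 1) * `|h|)); first by rewrite ler_wpM2r// lerDl.
  rewrite mulrC -ler_pdivlMr//.
  by near: h; apply: dnbhs0_le; rewrite divr_gt0.
by apply: DeriveDef; [exact: cvgP cv | exact: cvg_lim cv].
Unshelve. all: by end_near. Qed.

Lemma MVT0 {R : realType} (W W' : R -> R) : (forall t : R, is_derive t 1 W (W' t)) ->
  forall t, exists s, `|s| <= `|t| /\ W t - W 0 = t * W' s.
Proof.
move=> dW t.
have cW : continuous W.
  by move=> s; apply: differentiable_continuous; apply/derivable1_diffP; case: (dW s).
have [t0|t0] := leP 0 t.
  have [s] := @MVT_segment _ W W' 0 t t0 (fun s _ => dW s) (continuous_subspaceT cW).
  rewrite in_itv /= => /andP[s0 st] ->.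
  by exists s; rewrite !ger0_norm// subr0 mulrC.
have [s] := @MVT_segment _ W W' t 0 (ltW t0) (fun s _ => dW s) (continuous_subspaceT cW).
rewrite in_itv /= => /andP[ts s0] E; exists s; split; first by rewrite !ler0_norm ?lerN2// ltW.
by rewrite -opprB E; ring.
Qed.

(** * Several variables reduced to lines, one coordinate at a time *)

Section Calculus.
Context {R : realType} {d : nat}.
Implicit Types (f g : 'rV[R]_d -> R) (x y u v : 'rV[R]_d) (i : 'I_d).
Local Notation eb := (@ebasis R d).

Lemma norm_coord_le v i : `|v 0 i| <= `|v|.
Proof.
have /mapP[j Hj ->] : `|v 0 i| \in [seq `|v x.1 x.2| | x : 'I_1 * 'I_d].
  by apply/mapP; exists (0, i) => //=; rewrite mem_enum.
by rewrite [leRHS]/Num.norm /= mx_normrE; apply/bigmax_geP; right => /=; exists j.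
Qed.

Lemma norm_le_coord v (M : R) : 0 <= M -> (forall i, `|v 0 i| <= M) -> `|v| <= M.
Proof.
move=> M0 vM; rewrite [leLHS]/Num.norm /= mx_normrE; apply: bigmax_le => //= -[i j] _ /=.
by rewrite (ord1 i).
Qed.

Lemma norm_ebasis_le i : `|eb i| <= 1.
Proof.
apply: norm_le_coord => // j; rewrite /ebasis mxE eqxx /=.
by case: (_ == _); rewrite ?normr1 ?normr0.
Qed.

Lemma is_derive_line f x v (t : R) : derivable f (x + t *: v) v ->
  is_derive t 1 (fun s : R => f (x + s *: v)) ('D_v f (x + t *: v)).
Proof.
move=> df.
have E : (fun h : R => h^-1 *: (((fun s : R => f (x + s *: v)) \o shift t) (h *: 1) - f (x + t *: v)))
   = (fun h => h^-1 *: ((f \o shift (x + t *: v)) (h *: v) - f (x + t *: v))).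
  apply/funext => h /=; congr (_ *: (f _ - _)).
  by rewrite [h *: 1]mulr1 scalerDl addrCA.
by apply: DeriveDef; rewrite /derivable /derive E.
Qed.

Lemma line_MVT f x v (t : R) : (forall y, derivable f y v) ->
  exists s : R, `|s| <= `|t| /\ f (x + t *: v) - f x = t * 'D_v f (x + s *: v).
Proof.
move=> df.
have dg (s : R) : is_derive s 1 (fun s : R => f (x + s *: v)) ('D_v f (x + s *: v)).
  exact: is_derive_line.
by have [s [st E]] := MVT0 dg t; exists s; rewrite scale0r addr0 in E.
Qed.

Lemma line_lipschitz f x v (t M : R) : (forall y, derivable f y v) ->
  (forall y, `|'D_v f y| <= M) -> `|f (x + t *: v) - f x| <= M * `|t|.
Proof.
move=> df HM; have [s [_ ->]] := line_MVT x t df.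
by rewrite normrM mulrC ler_wpM2r.
Qed.

Lemma line_quad f x v (t L : R) : (forall y, derivable f y v) ->
  (forall y s, `|'D_v f (y + s *: v) - 'D_v f y| <= L * `|s|) ->
  `|f (x + t *: v) - f x - t * 'D_v f x| <= L * t ^+ 2.
Proof.
move=> df HL; have [s [st ->]] := line_MVT x t df.
have L0 : 0 <= L by have := HL x 1; rewrite normr1 mulr1; apply: le_trans.
rewrite -mulrBr normrM -(real_normK (num_real t)) expr2 mulrA mulrC.
apply: ler_wpM2r => //; apply: le_trans (HL _ _) _.
exact: ler_wpM2l.
Qed.

(** Intermediate points between [x] and [x + v]: consecutive ones differ along a single basis
    vector, so an increment by [v] telescopes into increments along lines. *)
Definition trunc (k : nat) v : 'rV[R]_d := \row_(i < d) (if (i < k)%N then v 0 i else 0).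

Lemma norm_trunc_le k v : `|trunc k v| <= `|v|.
Proof.
by apply: norm_le_coord => // i; rewrite mxE; case: ifP; rewrite ?normr0 ?norm_coord_le.
Qed.

Lemma truncS i v : trunc i.+1 v = trunc i v + v 0 i *: eb i.
Proof.
apply/rowP => j; rewrite !mxE /= ltnS.
have [->|ij] := eqVneq j i; first by rewrite leqnn ltnn add0r mulr1.
by rewrite mulr0 addr0 leq_eqVlt -(inj_eq val_inj) in ij *; rewrite (negbTE ij).
Qed.

Lemma telescope_coord f x v : f (x + v) - f x =
  \sum_(i < d) (f (x + trunc i v + v 0 i *: eb i) - f (x + trunc i v)).
Proof.
have -> : f (x + v) - f x = f (x + trunc d v) - f (x + trunc 0 v).
  congr (f (x + _) - f _); first by apply/rowP => i; rewrite mxE ltn_ord.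
  by rewrite -[LHS]addr0; congr (_ + _); apply/rowP => i; rewrite !mxE.
rewrite -(telescope_sumr (fun k => f (x + trunc k v)) (leq0n d)) big_mkord.
by apply: eq_bigr => i _; rewrite truncS addrA.
Qed.

Lemma coord_lipschitz f (M : R) : 
  (forall i y t, `|f (y + t *: eb i) - f y| <= M * `|t|) ->
  forall x v, `|f (x + v) - f x| <= d%:R * M * `|v|.
Proof.
move=> H x v; rewrite telescope_coord; apply: le_trans (ler_norm_sum _ _ _) _.
apply: le_trans (ler_sum _ (fun i _ => H i _ _)) _.
(* For [d = 0] the hypothesis gives no sign for [M]; the sum is then empty. *)
rewrite -mulr_sumr mulrC [d%:R * M]mulrC -mulrA; case: (posnP d) => [d0|d0].
  rewrite big1 ?mul0r; last by move=> i _; have := ltn_ord i; rewrite [X in (_ < X)%N]d0.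
  by rewrite [X in X%:R]d0 mul0r mulr0.
have M0 : 0 <= M.
  by have := H (Ordinal d0) 0 1; rewrite normr1 mulr1; apply: le_trans.
rewrite mulrC ler_wpM2l// [leRHS]mulr_natl -[X in _ *+ X]card_ord -sumr_const.
by apply: ler_sum => i _; exact: norm_coord_le.
Qed.

(** Each telescoped increment is compared with the partial derivative at the intermediate point, and
    that derivative with the one at [x]; the two errors give the factor [2 * M]. *)
Lemma coord_frechet f (M : R) : (0 <= M) ->
  (forall i y t, `|f (y + t *: eb i) - f y - t * partial i f y| <= M * t ^+ 2) ->
  (forall i y v, `|partial i f (y + v) - partial i f y| <= M * `|v|) ->
  forall x v, `|f (x + v) - f x - \sum_(i < d) v 0 i * partial i f x| <= d%:R * (2 * M) * `|v| ^+ 2.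
Proof.
move=> M0 H1 H2 x v; rewrite telescope_coord -sumrB.
apply: le_trans (ler_norm_sum _ _ _) _.
rewrite -mulrA [leRHS]mulr_natl -[X in _ *+ X]card_ord -sumr_const.
apply: ler_sum => i _.
have -> : f (x + trunc i v + v 0 i *: eb i) - f (x + trunc i v) - v 0 i * partial i f x =
   (f (x + trunc i v + v 0 i *: eb i) - f (x + trunc i v) - v 0 i * partial i f (x + trunc i v))
   + v 0 i * (partial i f (x + trunc i v) - partial i f x) by ring.
apply: le_trans (ler_normD _ _) _; rewrite mulrDl mulrDl mul1r; apply: lerD.
  apply: le_trans (H1 _ _ _) _; apply: ler_wpM2l => //.
  by rewrite -[_ 0 i ^+ 2]real_normK ?num_real// lerXn2r ?nnegrE ?norm_coord_le.
rewrite normrM expr2 mulrCA; apply: ler_pM; rewrite ?norm_coord_le//.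
apply: le_trans (H2 _ _ _) _; apply: ler_wpM2l => //; exact: norm_trunc_le.
Qed.

Lemma quad_differentiable f x (p : 'I_d -> R) (C : R) :
  (forall v, `|f (x + v) - f x - \sum_(i < d) v 0 i * p i| <= C * `|v| ^+ 2) ->
  differentiable f x.
Proof.
move=> H.
pose D (v : 'rV[R]_d) : R := \sum_(i < d) v 0 i * p i.
have linD : linear D.
  move=> k u v; rewrite /D scaler_sumr -big_split /=; apply: eq_bigr => i _.
  by rewrite !mxE /GRing.scale /= mulrDl mulrA.
pose DM := GRing.isLinear.Build _ _ _ _ _ linD.
pose DL : {linear _ -> _} := HB.pack D DM.
have cD : continuous DL.
  apply: (@lipschitz_continuous _ _ _ (d%:R * \sum_i `|p i|)); apply: coord_lipschitz => i y t.
  have -> : DL (y + t *: eb i) - DL y = t * p i.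
    rewrite linearD linearZ /= addrAC subrr add0r; congr (_ * _).
    rewrite /D (bigD1 i)//= big1 ?addr0; last first.
      by move=> j ji; rewrite /ebasis mxE eqxx (negbTE ji) mul0r.
    by rewrite /ebasis mxE !eqxx mul1r.
  rewrite normrM mulrC ler_wpM2r// (bigD1 i)//= lerDl.
  by apply: sumr_ge0.
exact: (@quad_diff _ _ f DL x C cD).
Qed.

End Calculus.

(** * Functions with bounded partial derivatives *)

Section BoundedDerivatives.
Context {R : realType} {d : nat}.
Implicit Types (f g : 'rV[R]_d -> R) (x y u v z : 'rV[R]_d) (i : 'I_d).
Local Notation eb := (@ebasis R d).

(** One constant bounds all iterated partial derivatives up to order [k], which keeps the class
    stable under translations, sums and products with explicit factors. Only derivability along
    basis vectors is asked: bounds of the next order make the partial derivatives Lipschitz, which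
    yields continuity and differentiability. *)
Fixpoint BD (k : nat) (M : R) f : Prop :=
  (forall x, `|f x| <= M) /\
  match k with
  | 0 => True
  | k'.+1 => forall i, (forall x, derivable f x (eb i)) /\ BD k' M (partial i f)
  end.

Lemma BD_le k M f x : BD k M f -> `|f x| <= M.
Proof. by case: k => [|k] [H _]. Qed.

Lemma BD_ge0 k M f : BD k M f -> 0 <= M.
Proof. by move=> H; apply: le_trans (BD_le 0 H). Qed.

Lemma BD_weaken k M N f : M <= N -> BD k M f -> BD k N f.
Proof.
move=> MN; elim: k f => [|k IH] f [H1 H2]; split=> //.
- by move=> x; exact: le_trans (H1 x) MN.
- by move=> x; exact: le_trans (H1 x) MN.
- by move=> i; have [H3 H4] := H2 i; split=> //; exact: IH.
Qed.

Lemma BD_pred k M f : BD k.+1 M f -> BD k M f.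
Proof.
elim: k f => [|k IH] f [H1 H2]; split=> //.
by move=> i; have [H3 H4] := H2 i; split=> //; exact: IH.
Qed.

Lemma BD_leq j k M f : (j <= k)%N -> BD k M f -> BD j M f.
Proof.
by move=> /subnK <-; elim: (k - j)%N => [//|n IH] /BD_pred.
Qed.

Lemma BD_partial k M f i : BD k.+1 M f -> BD k M (partial i f).
Proof. by case=> _ /(_ i)[]. Qed.

Lemma BD_derivable k M f i x : BD k.+1 M f -> derivable f x (eb i).
Proof. by case=> _ /(_ i)[]. Qed.

Lemma partial_lip_line f i x (t M : R) : BD 1 M f -> `|f (x + t *: eb i) - f x| <= M * `|t|.
Proof.
move=> H; apply: line_lipschitz; first by move=> y; exact: BD_derivable H.
by move=> y; exact: (BD_le y (BD_partial i H)).
Qed.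

Lemma BD_lipschitz M f x v : BD 1 M f -> `|f (x + v) - f x| <= d%:R * M * `|v|.
Proof.
by move=> H; apply: coord_lipschitz => i y t; exact: partial_lip_line.
Qed.

Lemma BD_frechet M f x v : BD 2 M f ->
  `|f (x + v) - f x - \sum_(i < d) v 0 i * partial i f x| <= d%:R * (2 * (d%:R * M)) * `|v| ^+ 2.
Proof.
move=> H; have M0 := BD_ge0 H; apply: coord_frechet.
- by rewrite mulr_ge0.
- move=> i y t; apply: (@le_trans _ _ (M * t ^+ 2)).
    apply: line_quad => [z|z s]; first exact: BD_derivable H.
    exact: partial_lip_line (BD_partial i H).
  rewrite ler_wpM2r ?sqr_ge0// ler_peMl// ler1n.
  by case: d i => [[]|].
- by move=> i y w; exact: BD_lipschitz (BD_partial i H).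
Qed.

Lemma BD_differentiable M f x : BD 2 M f -> differentiable f x.
Proof. by move=> H; apply: quad_differentiable => v; exact: BD_frechet H. Qed.

Lemma BD_continuous M f : BD 1 M f -> continuous f.
Proof. by move=> H; apply: lipschitz_continuous => x v; exact: BD_lipschitz H. Qed.

(** Order three, because continuity of the second derivatives is read off from a bound on the third
    ones. *)
Lemma BD_Cc2 M f r : BD 3 M f -> (forall x, r < `|x| -> f x = 0) -> Cc2 f.
Proof.
move=> H f0; split.
- by move=> x; apply: BD_differentiable (BD_pred H).
- by move=> i x; exact: BD_differentiable (BD_partial i H).
- by move=> i j; exact: BD_continuous (BD_partial i (BD_partial j H)).
- have sub : closure [set x | f x != 0] `<=` [set x | `|x| <= r].
    rewrite closureE; apply: smallest_sub.
      apply: (@closed_comp _ _ (fun x : 'rV[R]_d => `|x|) [set y | y <= r]).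
        by move=> x _; exact: norm_continuous.
      exact: closed_le.
    by move=> x /= fx; rewrite leNgt; apply/negP => /f0 E; rewrite E eqxx in fx.
  apply: bounded_closed_compact; last exact: closed_closure.
  exists r; split; first exact: num_real.
  by move=> s rs x /sub /= xr; exact: le_trans xr (ltW rs).
Qed.

Lemma derive_shift_rV f x v z :
  'D_v (fun y => f (y + z)) x = 'D_v f (x + z).
Proof.
rewrite /derive (_ : (fun h => h^-1 *: (((fun y => f (y + z)) \o shift x) (h *: v) - f (x + z))) =
  (fun h => h^-1 *: ((f \o shift (x + z)) (h *: v) - f (x + z))))//.
by apply/funext => h /=; congr (_ *: (f _ - _)); rewrite addrA.
Qed.

Lemma derivable_shift_rV f x v z :
  derivable f (x + z) v -> derivable (fun y => f (y + z)) x v.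
Proof.
rewrite /derivable => H.
rewrite (_ : (fun h => _) = (fun h => h^-1 *: ((f \o shift (x + z)) (h *: v) - f (x + z))))//.
by apply/funext => h /=; congr (_ *: (f _ - _)); rewrite addrA.
Qed.

Lemma partial_shift f i z : partial i (fun y => f (y + z)) = (fun y => partial i f (y + z)).
Proof. by apply/funext => x; exact: derive_shift_rV. Qed.

Lemma BD_shift k M f z : BD k M f -> BD k M (fun y => f (y + z)).
Proof.
elim: k f => [|k IH] f [H1 H2]; split => //.
move=> i; have [H3 H4] := H2 i; split; last by rewrite partial_shift; exact: IH.
by move=> x; exact: derivable_shift_rV.
Qed.

Lemma BD_cst k (c : R) : BD k `|c| (fun _ => c).
Proof.
have H0 : forall k (N : R), 0 <= N -> BD k N (fun _ : 'rV[R]_d => 0).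
  elim=> [|n IH] N N0; split => //; try by move=> x; rewrite normr0.
  move=> i; split; first by move=> x; exact: derivable_cst.
  rewrite (_ : partial i _ = fun _ => 0); first exact: IH.
  by apply/funext => x; exact: derive_cst.
case: k => [|k]; split => //.
move=> i; split; first by move=> x; exact: derivable_cst.
rewrite (_ : partial i _ = fun _ => 0); first exact: H0.
by apply/funext => x; exact: derive_cst.
Qed.

Lemma partialD f g i : (forall x, derivable f x (eb i)) -> (forall x, derivable g x (eb i)) ->
  partial i (fun x => f x + g x) = (fun x => partial i f x + partial i g x).
Proof. by move=> df dg; apply/funext => x; exact: deriveD. Qed.

Lemma BD_add k M N f g : BD k M f -> BD k N g -> BD k (M + N) (fun x => f x + g x).
Proof.
elim: k f g => [|k IH] f g [H1 H2] [G1 G2]; split.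
- by move=> x; apply: le_trans (ler_normD _ _) _; exact: lerD.
- by [].
- by move=> x; apply: le_trans (ler_normD _ _) _; exact: lerD.
- move=> i; have [H3 H4] := H2 i; have [G3 G4] := G2 i; split.
    by move=> x; exact: derivableD.
  by rewrite partialD//; exact: IH.
Qed.

Lemma partialM f g i : (forall x, derivable f x (eb i)) -> (forall x, derivable g x (eb i)) ->
  partial i (fun x => f x * g x) = (fun x => f x * partial i g x + g x * partial i f x).
Proof. by move=> df dg; apply/funext => x; exact: deriveM. Qed.

Lemma BD_mul k M N f g : BD k M f -> BD k N g -> BD k (2 ^+ k * (M * N)) (fun x => f x * g x).
Proof.
elim: k f g => [|k IH] f g Hf Hg; split.
- by move=> x; rewrite expr0 mul1r normrM ler_pM// ?(BD_le x Hf) ?(BD_le x Hg).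
- by [].
- move=> x; rewrite normrM; apply: (@le_trans _ _ (M * N)).
    by apply: ler_pM => //; [exact: BD_le Hf | exact: BD_le Hg].
  by rewrite ler_peMl ?mulr_ge0 ?(BD_ge0 Hf) ?(BD_ge0 Hg)// exprn_ege1// ler1n.
- move=> i; have df x : derivable f x (eb i) by exact: BD_derivable Hf.
 have dg x : derivable g x (eb i) by exact: BD_derivable Hg.
  split; first by move=> x; exact: derivableM.
  rewrite partialM// exprS -mulrA mulrDl mul1r; apply: BD_add.
    by apply: IH; [exact: BD_pred | exact: BD_partial].
  rewrite (_ : (fun x => g x * _) = (fun x => partial i f x * g x)); last first.
    by apply/funext => x; rewrite mulrC.
  by apply: IH; [exact: BD_partial | exact: BD_pred].
Qed.

Lemma BD_scale k M f (c : R) : BD k M f -> BD k (`|c| * M) (fun x => c * f x).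
Proof.
elim: k f => [|k IH] f Hf; split => //; try by move=> x; rewrite normrM ler_wpM2l// (BD_le x Hf).
move=> i; have df x : derivable f x (eb i) by exact: BD_derivable Hf.
 split.
  by move=> x; apply: (@derivableZ _ _ _ f c).
rewrite (_ : partial i _ = fun x => c * partial i f x); first exact: IH (BD_partial i Hf).
by apply/funext => x; exact: (@deriveZ _ _ _ f c).
Qed.

Lemma BD_sum k (I : finType) (M : I -> R) (f : I -> 'rV[R]_d -> R) :
  (forall s, BD k (M s) (f s)) -> BD k (\sum_s M s) (fun x => \sum_s f s x).
Proof.
move=> H; have E : (fun x => \sum_s f s x) = (\sum_s f s : _ -> _).
  by apply/funext => x; rewrite fct_sumE.
rewrite E; apply: (@big_ind2 _ _ (fun m g => BD k m g)).
- by have := BD_cst k 0; rewrite normr0.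
- by move=> m1 g1 m2 g2; exact: BD_add.
- by move=> s _; exact: H.
Qed.

(** [C] is chosen before [g], so that it serves for [SS psi] at all step sizes at once. The
    induction goes through the derivative [- g' / g^2] of the inverse. *)
Lemma BD_inv k (M c : R) : 0 < c -> exists C, forall g, BD k M g -> (forall x, c <= g x) ->
  BD k C (fun x => (g x)^-1).
Proof.
move=> c0; elim: k => [|k [C IH]].
  exists c^-1 => g Hg gc; split => // x.
  by rewrite normfV lef_pV2 ?posrE ?normr_gt0 ?gt_eqF ?(lt_le_trans c0 (gc x))// ger0_norm
     ?gc// ltW// (lt_le_trans c0 (gc x)).
exists (c^-1 + 2 ^+ k * (M * (2 ^+ k * (C * C)))) => g Hg gc.
have g0 x : g x != 0 by rewrite gt_eqF// (lt_le_trans c0 (gc x)).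
have HI := IH _ (BD_pred Hg) gc.
have C0 := BD_ge0 HI; have M0 := BD_ge0 Hg.
split.
  move=> x; apply: (@le_trans _ _ c^-1); last by rewrite lerDl !mulr_ge0 ?exprn_ge0.
  by rewrite normfV lef_pV2 ?posrE ?normr_gt0 ?g0// ger0_norm
     ?gc// ltW// (lt_le_trans c0 (gc x)).
move=> i; have dg x : derivable g x (eb i) by exact: BD_derivable Hg.
 split; first by move=> x; exact: derivableV.
rewrite (_ : partial i _ = fun x => (- 1 * partial i g x) * ((g x)^-1 * (g x)^-1)); last first.
  apply/funext => x; rewrite /partial deriveV// /GRing.scale /=.
  by rewrite -exprVn; ring.
apply: (@BD_weaken _ (2 ^+ k * (M * (2 ^+ k * (C * C))))).
  by rewrite lerDr invr_ge0 ltW.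
apply: BD_mul; last exact: BD_mul.
by have := BD_scale (-1) (BD_partial i Hg); rewrite normrN1 mul1r.
Qed.

End BoundedDerivatives.

(** * Steklov averages *)

Section UnitAverage.
Context {R : realType}.
Implicit Types (h k : R -> R).
Local Notation mu := (@lebesgue_measure R).

Definition avg h : R := \int[mu]_(s in `[0, 1]) h s.

Lemma continuous_itv_integrable h (a b : R) : continuous h -> mu.-integrable `[a, b] (EFin \o h).
Proof.
move=> ch; apply: continuous_compact_integrable; first exact: segment_compact.
exact: continuous_subspaceT.
Qed.

Lemma avg_cst (c : R) : avg (fun _ => c) = c.
Proof.
rewrite /avg Rintegral_cst; last exact: measurable_itv.
rewrite -[RHS]mulr1; congr (_ * _); rewrite (_ : 1 = fine 1%E)//; congr fine.
by have := @lebesgue_measure_itv R `[0, 1]%R; rewrite /= lte_fin ltr01 oppr0 adde0.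
Qed.

Lemma avgB h k : continuous h -> continuous k -> avg (fun s => h s - k s) = avg h - avg k.
Proof. by move=> ch ck; apply: RintegralB => //; exact: continuous_itv_integrable. Qed.

Lemma avgZ h (c : R) : continuous h -> avg (fun s => c * h s) = c * avg h.
Proof. by move=> ch; apply: RintegralZl => //; exact: continuous_itv_integrable. Qed.

Lemma avg_le h k : continuous h -> continuous k ->
  (forall s, 0 <= s <= 1 -> h s <= k s) -> avg h <= avg k.
Proof.
move=> ch ck H; apply: le_Rintegral => //; exact: continuous_itv_integrable.
Qed.

Lemma avg_le_cst h (c : R) : continuous h -> (forall s, 0 <= s <= 1 -> h s <= c) -> avg h <= c.
Proof. by move=> ch H; rewrite -(avg_cst c); apply: avg_le => // x; exact: cst_continuous. Qed.

Lemma avg_ge_cst h (c : R) : continuous h -> (forall s, 0 <= s <= 1 -> c <= h s) -> c <= avg h.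
Proof. by move=> ch H; rewrite -(avg_cst c); apply: avg_le => // x; exact: cst_continuous. Qed.

Lemma avg_norm_le h (c : R) : continuous h -> (forall s, 0 <= s <= 1 -> `|h s| <= c) -> `|avg h| <= c.
Proof.
move=> ch H; rewrite ler_norml; apply/andP; split.
  by apply: avg_ge_cst => // s /H; rewrite ler_norml => /andP[].
by apply: avg_le_cst => // s /H; rewrite ler_norml => /andP[].
Qed.

(** An average over a segment is a difference quotient of a primitive. The primitive is asked on a
    slightly larger interval so that it is differentiable at both ends of the segment. *)
Lemma avg_affine h H (ep t : R) : 0 < ep -> continuous h ->
  (forall x, t - 1 < x < ep + t + 1 -> is_derive x 1 H (h x)) ->
  avg (fun s => h (s * ep + t)) = (H (ep + t) - H t) / ep.
Proof.
move=> ep0 ch dH; pose G (s : R) := ep^-1 * H (s * ep + t).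
have dG (s : R) : 0 <= s <= 1 -> is_derive s 1 G (h (s * ep + t)).
  move=> /andP[s0 s1].
  have dHs : is_derive (s * ep + t) 1 H (h (s * ep + t)).
    apply: dH; apply/andP; split; first by nra.
    by nra.
  have dA : is_derive s 1 (fun s : R => s * ep + t) ep.
    by apply: is_derive_eq; rewrite /GRing.scale /= !mulr0 add0r addr0 mulr1.
  have dC := @is_derive1_comp _ H (fun s : R => s * ep + t) s _ _ dHs dA.
  have dZ := @is_deriveZ _ _ _ (H \o (fun s : R => s * ep + t)) ep^-1 s 1 _ dC.
  apply: is_derive_eq (dZ) _; rewrite /GRing.scale /= [_ * ep]mulrC mulKf//.
  by rewrite gt_eqF.
have cG (s : R) : 0 <= s <= 1 -> {for s, continuous G}.
  by move=> /dG [dGs _]; apply: differentiable_continuous; apply/derivable1_diffP.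
rewrite /avg /Rintegral (@continuous_FTC2 _ (fun s => h (s * ep + t)) G 0 1) //.
- by rewrite /G mul1r mul0r add0r -EFinB /=; field; rewrite gt_eqF.
- apply: continuous_subspaceT => s; apply: continuous_comp; last exact: ch.
  apply: continuousD; last exact: cst_continuous.
  by apply: continuousM; [exact: cvg_id | exact: cst_continuous].
- split.
  + move=> s; rewrite in_itv /= => /andP[s0 s1]; have [] := dG s _ => //.
    by rewrite !ltW.
  + by apply: cvg_at_right_filter; apply: cG; rewrite lexx ler01.
  + by apply: cvg_at_left_filter; apply: cG; rewrite lexx ler01.
- move=> s; rewrite in_itv /= => /andP[s0 s1]; rewrite derive1E.
  by have [] := dG s _ => //; rewrite !ltW.
Qed.

(** The integral from [a] is a primitive only to the right of [a], hence the bounded intervals in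
    the estimates that follow. *)
Lemma local_primitive h (a u : R) : continuous h ->
  exists H, forall x, a < x < u -> is_derive x 1 H (h x).
Proof.
move=> ch; exists (fun x => \int[mu]_(t in `[a, x]) h t) => x /andP[ax xu].
have [dF] := @continuous_FTC1_closed _ h a x u xu (@continuous_itv_integrable h a u ch) ax (ch x).
by rewrite derive1E => vF; apply: DeriveDef.
Qed.

Lemma primitive_quad h H (c t L a u : R) : 
  (forall x, a < x < u -> is_derive x 1 H (h x)) ->
  (forall x y, `|h x - h y| <= L * `|x - y|) -> a < c - `|t| -> c + `|t| < u ->
  `|H (c + t) - H c - t * h c| <= L * t ^+ 2.
Proof.
move=> dH hL ac cu.
have L0 : 0 <= L by have := hL 1 0; rewrite subr0 normr1 mulr1; apply: le_trans.
have cH (x : R) : a < x < u -> {for x, continuous H}.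
  by move=> /dH [dHs _]; apply: differentiable_continuous; apply/derivable1_diffP.
suff [s [sc ->]] : exists s, `|s - c| <= `|t| /\ H (c + t) - H c = t * h s.
  rewrite -mulrBr normrM -(real_normK (num_real t)) expr2 mulrA mulrC.
  apply: ler_wpM2r => //; apply: le_trans (hL _ _) _.
  exact: ler_wpM2l.
have tl := ler_norm t; have tl' := ler_norm (- t); rewrite normrN in tl'.
have [t0|t0] := leP 0 t.
  have lct : c <= c + t by rewrite lerDl.
  have D (x : R) : x \in `]c, (c + t)[ -> is_derive x 1 H (h x).
    by rewrite in_itv /= => /andP[? ?]; apply: dH; apply/andP; split; lra.
  have Cn : {within `[c, c + t], continuous H}.
    apply: continuous_in_subspaceT => x; rewrite inE /= in_itv /= => /andP[? ?].
    by apply: cH; apply/andP; split; lra.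
  have [s] := @MVT_segment _ H h c (c + t) lct D Cn.
  rewrite in_itv /= => /andP[s1 s2] E; exists s; split.
    by rewrite !ger0_norm; lra.
  by rewrite E; ring.
have lct : c + t <= c by rewrite gerDl ltW.
have D (x : R) : x \in `](c + t), c[ -> is_derive x 1 H (h x).
  by rewrite in_itv /= => /andP[? ?]; apply: dH; apply/andP; split; lra.
have Cn : {within `[c + t, c], continuous H}.
  apply: continuous_in_subspaceT => x; rewrite inE /= in_itv /= => /andP[? ?].
  by apply: cH; apply/andP; split; lra.
have [s] := @MVT_segment _ H h (c + t) c lct D Cn.
rewrite in_itv /= => /andP[s1 s2] E; exists s; split.
  by rewrite !ler0_norm; lra.
by rewrite -opprB E; ring.
Qed.

Lemma lipschitz1_continuous h (L : R) : (forall x y, `|h x - h y| <= L * `|x - y|) -> continuous h.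
Proof.
move=> H; apply: (@lipschitz_continuous _ _ _ L) => x v.
by have := H (x + v) x; rewrite [x + v - x]addrAC subrr add0r.
Qed.

(** By [avg_affine], shifting the segment changes the average only through its two ends: the
    derivative is the difference quotient of [h], and [h] itself is never differentiated. *)
Lemma avg_shift_quad h (ep t L : R) : 0 < ep -> (forall x y, `|h x - h y| <= L * `|x - y|) ->
  `|avg (fun s => h (s * ep + t)) - avg (fun s => h (s * ep)) - t * ((h ep - h 0) / ep)|
    <= (2 * L / ep) * t ^+ 2.
Proof.
move=> ep0 hL; have ch := lipschitz1_continuous hL.
have [H dH] := @local_primitive h (- `|t| - 2) (ep + `|t| + 2) ch.
have tl := ler_norm t; have tl' := ler_norm (- t); rewrite normrN in tl'.
have D1 (x : R) : t - 1 < x < ep + t + 1 -> is_derive x 1 H (h x).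
  by move=> /andP[? ?]; apply: dH; apply/andP; split; lra.
have D0 (x : R) : 0 - 1 < x < ep + 0 + 1 -> is_derive x 1 H (h x).
  by move=> /andP[? ?]; apply: dH; apply/andP; split; lra.
rewrite (avg_affine ep0 ch D1).
have -> : avg (fun s => h (s * ep)) = avg (fun s => h (s * ep + 0)).
  by congr avg; apply/funext => s; rewrite addr0.
rewrite (avg_affine ep0 ch D0).
have Q1 : `|H (ep + t) - H ep - t * h ep| <= L * t ^+ 2.
  by apply: (primitive_quad dH hL); lra.
have Q2 : `|H (0 + t) - H 0 - t * h 0| <= L * t ^+ 2.
  by apply: (primitive_quad dH hL); lra.
rewrite add0r in Q2.
have -> : (H (ep + t) - H t) / ep - (H (ep + 0) - H 0) / ep - t * ((h ep - h 0) / ep) =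
  ((H (ep + t) - H ep - t * h ep) - (H t - H 0 - t * h 0)) / ep.
  by rewrite addr0; field; rewrite gt_eqF.
rewrite normrM normfV (gtr0_norm ep0) mulrAC ler_pM2r ?invr_gt0//.
by apply: le_trans (ler_normB _ _) _; lra.
Qed.

End UnitAverage.

(** * Iterated averages along the coordinate directions *)

Section Steklov.
Context {R : realType} {d : nat}.
Variable ep : R.
Hypothesis ep0 : 0 < ep.
Implicit Types (f g : 'rV[R]_d -> R) (x y u v z : 'rV[R]_d) (i j : 'I_d) (s : seq 'I_d).
Local Notation eb := (@ebasis R d).

Definition Lip (L : R) g := forall x v, `|g (x + v) - g x| <= L * `|v|.

(** A Lipschitz gradient expressed by second differences: in this form it passes through averages
    with the same constant, without differentiation under an integral. *)
Definition mixed2 (K : R) g := forall x u v,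
  `|g (x + u + v) - g (x + u) - (g (x + v) - g x)| <= K * `|u| * `|v|.

Definition stek i g x : R := avg (fun t => g (x + (t * ep) *: eb i)).

Definition fdiff i g x : R := (g (x + ep *: eb i) - g x) / ep.

(** Each occurrence of [i] in the list is one average along [e_i], that is, one order of
    differentiability in that direction. *)
Definition St s g := foldr stek g s.

Let cB (h k : R -> R) : continuous h -> continuous k -> continuous (fun t => h t - k t).
Proof. by move=> ch ck t; apply: continuousB; [exact: ch | exact: ck]. Qed.

Let cZ (h : R -> R) (c : R) : continuous h -> continuous (fun t => c * h t).
Proof. by move=> ch t; apply: continuousM; [exact: cst_continuous | exact: ch]. Qed.

Lemma Lip_ge0 (L : R) g : (0 < d)%N -> Lip L g -> 0 <= L.
Proof.
move=> d0 H; have := H 0 (eb (Ordinal d0)); rewrite add0r => /(le_trans (normr_ge0 _)).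
rewrite pmulr_lge0// normr_gt0; apply/eqP => /rowP /(_ (Ordinal d0)).
by rewrite !mxE !eqxx /= => /eqP; rewrite oner_eq0.
Qed.

Lemma Lip_continuous (L : R) g : Lip L g -> continuous g.
Proof. exact: lipschitz_continuous. Qed.

Lemma stek_line_continuous g x i : continuous g ->
  continuous (fun t : R => g (x + (t * ep) *: eb i)).
Proof.
move=> cg t; apply: continuous_comp; last exact: cg.
apply: (@continuousD _ _ _ (fun _ => x) (fun t : R => (t * ep) *: eb i)); first exact: cst_continuous.
apply: (@continuous_comp _ _ _ (fun t : R => t * ep) (fun r : R => r *: eb i)); last exact: scalel_continuous.
by apply: continuousM; [exact: cvg_id | exact: cst_continuous].
Qed.

Lemma stek_lip (L : R) g i : Lip L g -> Lip L (stek i g).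
Proof.
move=> H x v; have cg := Lip_continuous H.
have C y := @stek_line_continuous _ y i cg.
rewrite /stek -avgB; [|exact: C|exact: C].
apply: avg_norm_le => [|t _]; first exact: cB.
by rewrite addrAC; exact: H.
Qed.

Lemma St_lip (L : R) g s : Lip L g -> Lip L (St s g).
Proof. by move=> H; elim: s => [//|i s IH] /=; exact: stek_lip. Qed.

Lemma St_ge (L c : R) g s x : Lip L g -> (forall y, c <= g y) -> c <= St s g x.
Proof.
move=> H gc; elim: s x => [//|i s IH] x /=; apply: avg_ge_cst => [|t _]; last exact: IH.
by apply: stek_line_continuous; apply: Lip_continuous; exact: St_lip.
Qed.

Lemma St_le (L c : R) g s x : Lip L g -> (forall y, g y <= c) -> St s g x <= c.
Proof.
move=> H gc; elim: s x => [//|i s IH] x /=; apply: avg_le_cst => [|t _]; last exact: IH.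
by apply: stek_line_continuous; apply: Lip_continuous; exact: St_lip.
Qed.

Lemma St_norm_le (L c : R) g s x : Lip L g -> (forall y, `|g y| <= c) -> `|St s g x| <= c.
Proof.
move=> H gc; rewrite ler_norml; apply/andP; split.
  by apply: St_ge H _ => y; have := gc y; rewrite ler_norml => /andP[].
by apply: St_le H _ => y; have := gc y; rewrite ler_norml => /andP[].
Qed.

Lemma St_local (L c : R) g s x : Lip L g ->
  (forall y, `|y - x| <= ep * (size s)%:R -> g y = c) -> St s g x = c.
Proof.
move=> H; elim: s x => [|i s IH] x /= gc.
  by apply: gc; rewrite subrr normr0 mulr0.
rewrite /stek -[RHS]avg_cst; apply/eqP; rewrite eq_le.
have C := @stek_line_continuous _ x i (Lip_continuous (St_lip s H)).
suff E t : 0 <= t <= 1 -> St s g (x + (t * ep) *: eb i) = c.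
  by apply/andP; split; apply: avg_le => //; try (by move=> ?; exact: cst_continuous);
    move=> t /E ->.
move=> /andP[t0 t1]; apply: IH => y Hy; apply: gc.
have -> : y - x = y - (x + (t * ep) *: eb i) + (t * ep) *: eb i by rewrite opprD addrA subrK.
apply: le_trans (ler_normD _ _) _; rewrite -natr1 mulrDr mulr1; apply: lerD => //.
rewrite normrZ ger0_norm ?mulr_ge0 ?(ltW ep0)//.
apply: (@le_trans _ _ (t * ep)); last by rewrite ler_piMl// ltW.
by rewrite ler_piMr ?norm_ebasis_le// mulr_ge0// ltW.
Qed.

Lemma St_mixed2 (L K : R) g s : Lip L g -> mixed2 K g -> mixed2 K (St s g).
Proof.
move=> H HK; elim: s => [//|i s IH] x u v /=.
have C y := @stek_line_continuous _ y i (Lip_continuous (St_lip s H)).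
rewrite /stek -!avgB//; try exact: cB.
apply: avg_norm_le => [|t _]; first by do ! apply: cB.
set w := (t * ep) *: eb i; have := IH (x + w) u v.
by rewrite (addrAC x w u) (addrAC (x + u) w v) (addrAC x w v).
Qed.

(** Increments are compared instead of values, so that division by the length of [v] bounds the
    distance of the derivatives by a multiple of [ep]. *)
Lemma St_close (L K : R) g s x v : Lip L g -> mixed2 K g ->
  `|(St s g (x + v) - St s g x) - (g (x + v) - g x)| <= K * (ep * (size s)%:R) * `|v|.
Proof.
move=> H HK; elim: s x => [|i s IH] x /=.
  by rewrite subrr normr0 mulr0 mulr0 mul0r.
have C y := @stek_line_continuous _ y i (Lip_continuous (St_lip s H)).
have Cc (c : R) : continuous (fun _ : R => c) by move=> ?; exact: cst_continuous.
rewrite /stek -[g (x + v) - g x]avg_cst -!avgB//; try exact: cB.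
apply: avg_norm_le => [|t /andP[t0 t1]]; first by do ! apply: cB.
set w := (t * ep) *: eb i.
have wep : `|w| <= ep.
  rewrite normrZ ger0_norm ?mulr_ge0 ?(ltW ep0)//.
  apply: (@le_trans _ _ (t * ep)); last by rewrite ler_piMl// ltW.
  by rewrite ler_piMr ?norm_ebasis_le// mulr_ge0// ltW.
have K0 : 0 <= K * `|w| * `|v| by exact: le_trans (HK x w v).
have -> : St s g (x + v + w) - St s g (x + w) - (g (x + v) - g x) =
  (St s g (x + w + v) - St s g (x + w) - (g (x + w + v) - g (x + w)))
  + (g (x + w + v) - g (x + w) - (g (x + v) - g x)).
  by rewrite (addrAC x v w); ring.
apply: le_trans (ler_normD _ _) _.
rewrite -natr1 mulrDr mulr1 mulrDr mulrDl; apply: lerD; first exact: IH.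
apply: le_trans (HK _ _ _) _.
(* [mixed2] gives [0 <= K] only if a nonzero vector exists, hence the degenerate cases. *)
have [w0|w0] := eqVneq w 0.
  have [v0|v0] := eqVneq v 0; first by rewrite v0 normr0 !mulr0.
  rewrite w0 normr0 mulr0 mul0r; apply: mulr_ge0 => //; apply: mulr_ge0; last exact: ltW.
  have := HK x v v; move/(le_trans (normr_ge0 _)).
  by rewrite pmulr_lge0 ?normr_gt0// pmulr_lge0 ?normr_gt0.
have [v0|v0] := eqVneq v 0; first by rewrite v0 normr0 !mulr0.
have {}K0 : 0 <= K by move: K0; rewrite pmulr_lge0 ?normr_gt0// pmulr_lge0 ?normr_gt0.
by apply: ler_wpM2r => //; exact: ler_wpM2l.
Qed.

Lemma fdiff_lip (L : R) g i : Lip L g -> Lip (2 / ep * L) (fdiff i g).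
Proof.
move=> H x v.
have -> : fdiff i g (x + v) - fdiff i g x =
  ((g (x + ep *: eb i + v) - g (x + ep *: eb i)) - (g (x + v) - g x)) / ep.
  by rewrite /fdiff (addrAC x v); ring.
rewrite normrM normfV (gtr0_norm ep0) ler_pdivrMr//.
have -> : 2 / ep * L * `|v| * ep = L * `|v| + L * `|v| by field; rewrite gt_eqF.
by apply: le_trans (ler_normB _ _) _; apply: lerD; exact: H.
Qed.

Lemma fdiff_bound (M : R) g i x : (forall y, `|g y| <= M) -> `|fdiff i g x| <= 2 / ep * M.
Proof.
move=> H; rewrite /fdiff normrM normfV (gtr0_norm ep0) ler_pdivrMr//.
have -> : 2 / ep * M * ep = M + M by field; rewrite gt_eqF.
by apply: le_trans (ler_normB _ _) _; apply: lerD; exact: H.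
Qed.

Lemma fdiff_bound_lip (L : R) g i x : Lip L g -> `|fdiff i g x| <= L.
Proof.
move=> H; rewrite /fdiff normrM normfV (gtr0_norm ep0) ler_pdivrMr//.
have d0 : (0 < d)%N by apply: leq_ltn_trans (ltn_ord i).
apply: le_trans (H _ _) _; rewrite normrZ (gtr0_norm ep0) ler_wpM2l ?(Lip_ge0 d0 H)//.
by rewrite ler_piMr ?norm_ebasis_le// ltW.
Qed.

Lemma St_fdiff (L : R) g i s : Lip L g -> St s (fdiff i g) = fdiff i (St s g).
Proof.
move=> H; elim: s => [//|j s IH] /=; rewrite IH; apply/funext => x.
have C y := @stek_line_continuous _ y j (Lip_continuous (St_lip s H)).
rewrite /stek /fdiff -avgB// mulrC -avgZ; last exact: cB.
by congr avg; apply/funext => t; rewrite mulrC (addrAC x).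
Qed.

(** Differentiation along [e_i] consumes one average in that direction and leaves the difference
    quotient [fdiff i g]. The averages in [s1] are applied on top of it; a remainder bound that is
    uniform in [x] passes through them by integration. *)
Lemma St_quad (L : R) g i s1 s2 x (t : R) : Lip L g ->
  `|St (s1 ++ i :: s2) g (x + t *: eb i) - St (s1 ++ i :: s2) g x
     - t * St (s1 ++ s2) (fdiff i g) x| <= (2 * L / ep) * t ^+ 2.
Proof.
move=> H; elim: s1 x => [|j s1 IH] x.
  rewrite [_ ++ s2]/= (St_fdiff _ _ H) [_ ++ _]/=.
  pose h (r : R) := St s2 g (x + r *: eb i).
  have hL r r' : `|h r - h r'| <= L * `|r - r'|.
    have d0 : (0 < d)%N by apply: leq_ltn_trans (ltn_ord i).
    have -> : h r = St s2 g (x + r' *: eb i + (r - r') *: eb i).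
      by rewrite /h -addrA -scalerDl [r' + _]addrC subrK.
    apply: le_trans (St_lip s2 H _ _) _; rewrite normrZ ler_wpM2l ?(Lip_ge0 d0 H)//.
    by rewrite ler_piMr ?norm_ebasis_le.
  have := avg_shift_quad t ep0 hL; rewrite /h scale0r addr0 /stek /fdiff.
  apply: le_trans; rewrite le_eqVlt; apply/orP; left; apply/eqP; congr (`|avg _ - _ - _|).
  by apply/funext => r; rewrite scalerDl addrA (addrAC x).
rewrite [X in `|X|](_ : _ = avg (fun r => (St (s1 ++ i :: s2) g (x + (r * ep) *: eb j + t *: eb i)
     - St (s1 ++ i :: s2) g (x + (r * ep) *: eb j))
     - t * St (s1 ++ s2) (fdiff i g) (x + (r * ep) *: eb j))); last first.
  have C y := @stek_line_continuous _ y j (Lip_continuous (St_lip (s1 ++ i :: s2) H)).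
  have C' y := @stek_line_continuous _ y j (Lip_continuous (St_lip (s1 ++ s2) (fdiff_lip i H))).
  rewrite /= /stek -avgB// -avgZ// -avgB//.
  - by congr avg; apply/funext => r; rewrite (addrAC x).
  - exact: cB.
  - exact: cZ.
apply: avg_norm_le => [|r _]; last exact: IH.
have C y := @stek_line_continuous _ y j (Lip_continuous (St_lip (s1 ++ i :: s2) H)).
have C' y := @stek_line_continuous _ y j (Lip_continuous (St_lip (s1 ++ s2) (fdiff_lip i H))).
apply: cB; last exact: cZ.
  apply: cB; last exact: C.
  rewrite (_ : (fun r => _) = fun r : R => St (s1 ++ i :: s2) g (x + t *: eb i + (r * ep) *: eb j)).
    exact: C.
  by apply/funext => ?; rewrite (addrAC x).
Qed.

Lemma St_is_derive (L : R) g i s1 s2 x : Lip L g ->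
  is_derive x (eb i) (St (s1 ++ i :: s2) g) (St (s1 ++ s2) (fdiff i g) x).
Proof. by move=> H; apply: quad_is_derive => t; exact: St_quad. Qed.

(** Each order of differentiation costs a factor [2 / ep]. The bounds explode as [ep] tends to 0,
    which is harmless because [ep] is fixed before the mesh of the walk. *)
Lemma St_BD k (L M : R) g s : (forall i, (k <= count_mem i s)%N) -> Lip L g ->
  (forall x, `|g x| <= M) -> BD k ((1 + 2 / ep) ^+ k * M) (St s g).
Proof.
elim: k L M g s => [|k IH] L M g s ks H gM.
  by split=> // x; rewrite expr0 mul1r; exact: St_norm_le H gM.
have M0 : 0 <= M by exact: le_trans (gM 0).
have e0 : 0 <= 2 / ep by rewrite divr_ge0// ltW.
have b1 : 1 <= (1 + 2 / ep) ^+ k by rewrite exprn_ege1// lerDl.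
split.
  move=> x; apply: le_trans (St_norm_le s x H gM) _; rewrite ler_peMl//.
  by rewrite exprn_ege1// lerDl.
move=> i.
have : i \in s by rewrite -has_pred1 has_count (leq_trans _ (ks i)).
move=> is_; move: ks; case/splitPr: is_ => s1 s2 ks; split.
  by move=> x; have [] := St_is_derive i s1 s2 x H.
rewrite (_ : partial i _ = St (s1 ++ s2) (fdiff i g)); last first.
  by apply/funext => x; have [_] := St_is_derive i s1 s2 x H.
apply: (@BD_weaken _ _ k ((1 + 2 / ep) ^+ k * (2 / ep * M))).
  have -> : (1 + 2 / ep) ^+ k.+1 * M = (1 + 2 / ep) ^+ k * ((1 + 2 / ep) * M) by rewrite exprS; ring.
  apply: ler_wpM2l; first exact: le_trans ler01 b1.
  by rewrite ler_wpM2r// lerDr.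
apply: (IH _ _ _ _ _ (fdiff_lip i H)); last by move=> x; exact: fdiff_bound.
move=> j; have := ks j; rewrite !count_cat /= => Hj.
by move: Hj; case: (i == j) => /=; rewrite ?add1n ?add0n ?addnS ?ltnS// => /ltnW.
Qed.

(** The first derivative is bounded by the Lipschitz constant at no cost in [ep]. A gentle slope
    thus makes first and second derivatives small even for [ep = 1], which is how [cutoff] uses
    it. *)
Lemma St_BD_partial k (L : R) g i s : (forall j, (k < count_mem j s)%N) -> Lip L g ->
  BD k ((1 + 2 / ep) ^+ k * L) (partial i (St s g)).
Proof.
move=> ks H.
have : i \in s by rewrite -has_pred1 has_count (leq_ltn_trans _ (ks i)).
move=> is_; move: ks; case/splitPr: is_ => s1 s2 ks.
rewrite (_ : partial i _ = St (s1 ++ s2) (fdiff i g)); last first.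
  by apply/funext => x; have [_] := St_is_derive i s1 s2 x H.
apply: (St_BD _ (fdiff_lip i H)); last by move=> x; exact: fdiff_bound_lip.
move=> j; have := ks j; rewrite !count_cat /= => Hj.
by move: Hj; case: (i == j) => /=; rewrite ?add1n ?add0n ?addnS ?ltnS// => /ltnW.
Qed.

End Steklov.

(** * The tilted walk *)

Section ExpBounds.
Context {R : realType}.
Implicit Types y : R.

(** From [(1 - y/2)^2 <= exp(-y)]: it remains to compare [(1 - y/2)^2 (1 + y + 2 y^2)] with 1, and
    their difference factors. *)
Lemma expR_le_quad y : `|y| <= 1 -> expR y <= 1 + y + 2 * y ^+ 2.
Proof.
rewrite ler_norml => /andP[y1 y2].
have h : 0 < 1 - y / 2 by lra.
have e1 : 1 - y / 2 <= expR (- (y / 2)) by have := expR_ge1Dx (- (y / 2)).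
have e2 : (1 - y / 2) ^+ 2 <= expR (- y).
  have -> : - y = - (y / 2) + - (y / 2) by field.
  by rewrite expRD expr2 ler_pM// ltW.
have e3 : (1 - y / 2) ^+ 2 * expR y <= 1.
  by rewrite -[leRHS](expRxMexpNx_1 y) mulrC ler_wpM2l ?expR_ge0.
have p : 0 < (1 - y / 2) ^+ 2 by rewrite exprn_gt0.
rewrite -(ler_pM2l p); apply: le_trans e3 _; rewrite -subr_ge0.
have -> : (1 - y / 2) ^+ 2 * (1 + y + 2 * y ^+ 2) - 1 = y ^+ 2 * ((1 - y) * (5 / 2 - y)) / 2.
  by field.
by rewrite divr_ge0// mulr_ge0 ?sqr_ge0// mulr_ge0//; lra.
Qed.

Lemma coshR_le y : `|y| <= 1 -> (expR y + expR (- y)) / 2 <= 1 + 2 * y ^+ 2.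
Proof.
move=> y1; have h1 := expR_le_quad y1.
have h2 : expR (- y) <= 1 + - y + 2 * (- y) ^+ 2 by apply: expR_le_quad; rewrite normrN.
by rewrite sqrrN in h2; lra.
Qed.

(** With [z = y/2], [cosh y - 1 = (exp z - exp(-z))^2 / 2], and [exp z - exp(-z) >= z] for [z >= 0];
    this is the origin of the 8. *)
Lemma coshR_ge y : 1 + y ^+ 2 / 8 <= (expR y + expR (- y)) / 2.
Proof.
wlog y0 : y / 0 <= y.
  move=> H; have [/H//|/ltW y0] := leP 0 y.
  by have := H (- y); rewrite oppr_ge0 opprK sqrrN addrC [expR (- y) + _]addrC; apply.
pose z := y / 2; have z0 : 0 <= z by rewrite divr_ge0.
have e1 := expR_ge1Dx z.
have p : 0 < 1 + z by lra.
have e2 : expR (- z) <= (1 + z)^-1.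
  by rewrite expRN lef_pV2 ?posrE ?expR_gt0.
have e3 : z <= expR z - expR (- z).
  have : (1 + z)^-1 <= 1 by rewrite invf_le1//; lra.
  by lra.
have e4 : z ^+ 2 <= (expR z - expR (- z)) ^+ 2 by rewrite lerXn2r ?nnegrE//; lra.
have -> : expR y = expR z * expR z by rewrite -expRD /z; congr expR; field.
have -> : expR (- y) = expR (- z) * expR (- z) by rewrite -expRD /z; congr expR; field.
have e5 := expRxMexpNx_1 z.
have -> : y ^+ 2 = 4 * z ^+ 2 by rewrite /z; field.
nra.
Qed.

Lemma expR_taylor1 y : `|y| <= 1 -> `|expR y - 1 - y| <= 2 * y ^+ 2.
Proof.
move=> y1; have h1 := expR_le_quad y1; have h2 := expR_ge1Dx y.
have := sqr_ge0 y; rewrite ler_norml => y2; apply/andP; split; lra.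
Qed.

(** Mean value theorem for [h] minus its quadratic polynomial, whose derivative is the remainder
    bounded by the second hypothesis. *)
Lemma taylor2 (h h1 : R -> R) (h2 C : R) :
  (forall t s, `|h (t + s) - h t - s * h1 t| <= C * s ^+ 2) ->
  (forall t, `|h1 t - h1 0 - t * h2| <= C * t ^+ 2) ->
  forall t, `|h t - h 0 - t * h1 0 - t ^+ 2 / 2 * h2| <= C * `|t| ^+ 3.
Proof.
move=> H1 H2 t.
have C0 : 0 <= C by have := H2 1; rewrite expr1n mulr1; apply: le_trans.
pose W s := h s - s * h1 0 - s ^+ 2 / 2 * h2.
pose W' s := h1 s - h1 0 - s * h2.
have dW (s : R) : is_derive s 1 W (W' s).
  apply: (@quad_is_derive _ _ W s 1 _ (C + `|h2|)) => r; rewrite [r *: 1]mulr1.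
  have -> : W (s + r) - W s - r * W' s =
     (h (s + r) - h s - r * h1 s) - r ^+ 2 / 2 * h2 by rewrite /W /W'; field.
  apply: le_trans (ler_normB _ _) _; rewrite mulrDl; apply: lerD => //.
  rewrite normrM normrM (ger0_norm (sqr_ge0 r)) [`|2^-1|]ger0_norm// mulrC ler_wpM2l//.
  by have := sqr_ge0 r; lra.
have [s [st E]] := MVT0 dW t.
have -> : h t - h 0 - t * h1 0 - t ^+ 2 / 2 * h2 = W t - W 0 by rewrite /W; ring.
rewrite E normrM exprS mulrCA; apply: ler_wpM2l => //.
apply: le_trans (H2 s) _; apply: ler_wpM2l => //.
by rewrite -[s ^+ 2]real_normK ?num_real// lerXn2r ?nnegrE.
Qed.

End ExpBounds.

(** * Random sign vectors and their exponential moments *)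

Section Signs.
Context {R : realType} {d : nat}.
Implicit Types (s : {ffun 'I_d -> bool}) (i j : 'I_d) (x y v a : 'rV[R]_d).

Definition sgn (b : bool) : R := if b then 1 else -1.

Definition sg s : 'rV[R]_d := \row_i sgn (s i).

Definition flip s : {ffun 'I_d -> bool} := [ffun i => ~~ s i].

Lemma flipK : involutive flip.
Proof. by move=> s; apply/ffunP => i; rewrite !ffunE negbK. Qed.

Lemma sgnN b : sgn (~~ b) = - sgn b.
Proof. by case: b => //=; rewrite opprK. Qed.

Lemma sg_flip s : sg (flip s) = - sg s.
Proof. by apply/rowP => i; rewrite !mxE ffunE sgnN. Qed.

Lemma norm_sgn b : `|sgn b| = 1.
Proof. by case: b; rewrite /sgn ?normrN normr1. Qed.

Lemma norm_sg_le s : `|sg s| <= 1.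
Proof. by apply: norm_le_coord => // i; rewrite mxE norm_sgn. Qed.

Lemma big_flip (F : {ffun 'I_d -> bool} -> R) : \sum_s F (flip s) = \sum_s F s.
Proof. by rewrite [RHS](reindex_inj (inv_inj flipK)). Qed.

Lemma sum_cst_signs (c : R) : \sum_(s : {ffun 'I_d -> bool}) c = 2 ^+ d * c.
Proof.
by rewrite sumr_const card_ffun card_bool card_ord -[LHS]mulr_natl natrX.
Qed.

Lemma sum_sgn i : \sum_s sg s 0 i = 0 :> R.
Proof.
apply/eqP; rewrite -(inj_eq (@mulfI R 2 _)) ?pnatr_eq0// mulr0 mulr2n mulrDl !mul1r.
rewrite -{1}big_flip -big_split big1//= => s _; rewrite sg_flip mxE addNr //.
Qed.

Definition flip1 i s : {ffun 'I_d -> bool} := [ffun j => if j == i then ~~ s j else s j].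

Lemma flip1K i : involutive (flip1 i).
Proof. by move=> s; apply/ffunP => j; rewrite !ffunE; case: (j == i); rewrite ?negbK. Qed.

Lemma sum_sgn2 i j : \sum_s sg s 0 i * sg s 0 j = 2 ^+ d * (i == j)%:R :> R.
Proof.
have [<-|ij] := eqVneq i j.
  rewrite -sum_cst_signs; apply: eq_bigr => s _; rewrite mxE /=.
  by case: (s i); rewrite /sgn ?mulrNN mulr1.
rewrite mulr0; apply/eqP; rewrite -(inj_eq (@mulfI R 2 _)) ?pnatr_eq0// mulr0 mulr2n mulrDl !mul1r.
rewrite {1}(reindex_inj (inv_inj (flip1K i))) -big_split big1//= => s _.
by rewrite !mxE !ffunE eqxx (negbTE (_ : j != i)) 1?eq_sym// sgnN mulNr addNr.
Qed.

Lemma dotrDr a x y : dotr a (x + y) = dotr a x + dotr a y.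
Proof. by rewrite /dotr -big_split; apply: eq_bigr => i _; rewrite mxE mulrDr. Qed.

Lemma dotrDl a x y : dotr (x + y) a = dotr x a + dotr y a.
Proof. by rewrite /dotr -big_split; apply: eq_bigr => i _; rewrite mxE mulrDl. Qed.

Lemma dotrZr a x (c : R) : dotr a (c *: x) = c * dotr a x.
Proof. by rewrite /dotr mulr_sumr; apply: eq_bigr => i _; rewrite mxE mulrCA. Qed.

Lemma dotrC a x : dotr a x = dotr x a.
Proof. by apply: eq_bigr => i _; rewrite mulrC. Qed.

Lemma dotrNr a x : dotr a (- x) = - dotr a x.
Proof. by rewrite -scaleN1r dotrZr mulN1r. Qed.

Lemma dotr0 a : dotr a 0 = 0.
Proof. by rewrite -(scale0r (0 : 'rV[R]_d)) dotrZr mul0r. Qed.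

Definition norm1 a : R := \sum_i `|a 0 i|.

Lemma norm1_ge0 a : 0 <= norm1 a.
Proof. exact: sumr_ge0. Qed.

Lemma dotr_norm_le a x : `|dotr a x| <= norm1 a * `|x|.
Proof.
apply: le_trans (ler_norm_sum _ _ _) _; rewrite /norm1 mulr_suml; apply: ler_sum => i _.
by rewrite normrM ler_wpM2l// norm_coord_le.
Qed.

Lemma sum_dotr_sg a : \sum_s dotr a (sg s) = 0.
Proof.
rewrite exchange_big /= big1// => i _; rewrite -mulr_sumr sum_sgn mulr0//.
Qed.

Lemma sum_exp_sg a : 2 ^- d * (\sum_s expR (dotr a (sg s))) =
  \prod_i ((expR (a 0 i) + expR (- a 0 i)) / 2).
Proof.
rewrite (eq_bigr (fun s : {ffun 'I_d -> bool} => \prod_i expR (a 0 i * sgn (s i)))); last first.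
  by move=> s _; rewrite -expR_sum; congr expR; apply: eq_bigr => i _; rewrite mxE.
rewrite -(bigA_distr_bigA (fun i b => expR (a 0 i * sgn b))) /=.
rewrite big_split /= prodr_const card_ord exprVn mulrC; congr (_ * _).
by apply: eq_bigr => i _; rewrite big_bool /sgn /= mulr1 mulrN1.
Qed.

Lemma prod_ge1D (F : 'I_d -> R) : (forall i, 0 <= F i) -> 1 + \sum_i F i <= \prod_i (1 + F i).
Proof.
move=> F0; suff : 1 + \sum_i F i <= \prod_i (1 + F i) /\ 0 <= \sum_i F i by case.
apply: (@big_ind2 _ _ (fun p q : R => 1 + q <= p /\ 0 <= q)); first by rewrite addr0 lexx.
- move=> p1 s1 p2 s2 [H1 h1] [H2 h2]; split; last exact: addr_ge0.
  apply: (@le_trans _ _ ((1 + s1) * (1 + s2))).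
    by rewrite mulrDl mul1r mulrDr mulr1 addrA [1 + s2]addrC -!addrA; nra.
  by apply: ler_pM => //; rewrite addr_ge0.
- by move=> i _; rewrite lexx F0.
Qed.

Lemma prod_le_exp (F : 'I_d -> R) : (forall i, 0 <= F i) -> \prod_i (1 + F i) <= expR (\sum_i F i).
Proof.
move=> F0; rewrite expR_sum; apply: ler_prod => i _.
by rewrite addr_ge0//= expR_ge1Dx.
Qed.

Lemma sum_exp_sg_ge a : 1 + dotr a a / 8 <= 2 ^- d * (\sum_s expR (dotr a (sg s))).
Proof.
rewrite sum_exp_sg; apply: (@le_trans _ _ (\prod_i (1 + (a 0 i) ^+ 2 / 8))).
  rewrite /dotr mulr_suml; apply: prod_ge1D => i.
  by rewrite divr_ge0// sqr_ge0.
by apply: ler_prod => i _; rewrite coshR_ge addr_ge0// divr_ge0// sqr_ge0.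
Qed.

Lemma sum_exp_sg_le a : (forall i, `|a 0 i| <= 1) ->
  2 ^- d * (\sum_s expR (dotr a (sg s))) <= expR (2 * dotr a a).
Proof.
move=> a1; rewrite sum_exp_sg; apply: (@le_trans _ _ (\prod_i (1 + 2 * (a 0 i) ^+ 2))).
  apply: ler_prod => i _; apply/andP; split; last exact: coshR_le.
  by rewrite divr_ge0// addr_ge0// expR_ge0.
rewrite /dotr mulr_sumr; apply: prod_le_exp => i.
by rewrite mulr_ge0// sqr_ge0.
Qed.

End Signs.

Ltac nneg := repeat first [assumption | done | exact: sqr_ge0 | exact: expR_ge0 | exact: norm1_ge0
  | by apply: ltW | apply: exprn_ge0 | apply: addr_ge0 | apply: mulr_ge0 | rewrite invr_ge0].

(** * The tilted step operator *)

Section Walk.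
Context {R : realType} {d : nat}.
Variables (a : 'rV[R]_d) (dl : R).
Hypotheses (dl0 : 0 < dl) (dla : dl * norm1 a <= 1).
Implicit Types (s : {ffun 'I_d -> bool}) (i j : 'I_d) (x y v : 'rV[R]_d) (F f g : 'rV[R]_d -> R).

(** Deliberately not normalised: [SS] is then exactly the simple walk conjugated by [exp(a.x)], and
    the excess of the total mass [cc] over 1 is the source of the contraction. *)
Definition wt s : R := 2 ^- d * expR (dl * dotr a (sg s)).

Definition SS F x : R := \sum_s wt s * F (x + dl *: sg s).

Definition cc : R := \sum_s wt s.

Lemma wt_gt0 s : 0 < wt s.
Proof. by rewrite mulr_gt0 ?expR_gt0// invr_gt0 exprn_gt0. Qed.

Lemma wt_ge0 s : 0 <= wt s. Proof. exact/ltW/wt_gt0. Qed.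

Lemma cc_ge : 1 + dl ^+ 2 * dotr a a / 8 <= cc.
Proof.
have := sum_exp_sg_ge (dl *: a); rewrite dotrZr dotrC dotrZr mulrA -expr2.
move=> H; apply: le_trans H _; rewrite /cc -mulr_sumr le_eqVlt; apply/orP; left; apply/eqP.
by congr (_ * _); apply: eq_bigr => s _; rewrite [in LHS]dotrC dotrZr [in RHS]dotrC.
Qed.

Lemma dl_coord_le i : `|(dl *: a) 0 i| <= 1.
Proof.
rewrite mxE normrM (gtr0_norm dl0); apply: le_trans dla; rewrite ler_wpM2l ?(ltW dl0)//.
by rewrite /norm1 (bigD1 i)//= lerDl sumr_ge0.
Qed.

Lemma cc_le : cc <= expR (2 * (dl ^+ 2 * dotr a a)).
Proof.
have := sum_exp_sg_le (@dl_coord_le).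
have -> : dotr (dl *: a) (dl *: a) = dl ^+ 2 * dotr a a by rewrite dotrZr dotrC dotrZr; ring.
apply: le_trans; rewrite /cc -mulr_sumr le_eqVlt; apply/orP; left; apply/eqP.
by congr (_ * _); apply: eq_bigr => s _; rewrite [in RHS]dotrC dotrZr [in LHS]dotrC.
Qed.

Lemma norm_step s : `|dl *: sg s| <= dl.
Proof.
by rewrite normrZ (gtr0_norm dl0) ler_piMr ?norm_sg_le// ltW.
Qed.

Lemma tilt_le s : `|dl * dotr a (sg s)| <= dl * norm1 a.
Proof.
rewrite normrM (gtr0_norm dl0) ler_wpM2l ?(ltW dl0)//.
apply: le_trans (dotr_norm_le _ _) _.
by rewrite ler_piMr ?norm1_ge0 ?norm_sg_le.
Qed.

(** Pairing [s] with [- s] turns the first-order term into a symmetric second difference, bounded by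
    [K]. The tilt contributes a product of two first-order factors and the remainder of the
    exponential, all of size [dl^2]. *)
Lemma SS_near (M L K : R) g x : (forall y, `|g y| <= M) -> Lip L g -> mixed2 K g ->
  `|SS g x - g x| <= dl ^+ 2 * (`|K| / 2 + norm1 a * `|L| + 2 * norm1 a ^+ 2 * M).
Proof.
move=> gM gL gK.
pose u s := dl * dotr a (sg s); pose z s := dl *: sg s.
have W (c : R) : \sum_(s : {ffun 'I_d -> bool}) 2 ^- d * c = c.
  by rewrite -mulr_sumr sum_cst_signs mulrA mulVf ?mul1r// expf_neq0// pnatr_eq0.
have E : SS g x - g x = \sum_s 2 ^- d * ((g (x + z s) - g x) + u s * (g (x + z s) - g x)
    + (expR (u s) - 1 - u s) * g (x + z s)).
  have -> : g x = \sum_s 2 ^- d * (g x + u s * g x).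
    rewrite -mulr_sumr big_split /= mulrDr mulr_sumr W -mulr_suml.
    by rewrite /u -mulr_sumr sum_dotr_sg mulr0 mul0r mulr0 addr0.
  rewrite /SS -sumrB; apply: eq_bigr => s _; rewrite /wt -/(u s) -/(z s).
  have -> : \sum_s 2 ^- d * (g x + u s * g x) = g x.
    rewrite -mulr_sumr big_split /= mulrDr mulr_sumr W -mulr_suml.
    by rewrite /u -mulr_sumr sum_dotr_sg mulr0 mul0r mulr0 addr0.
  by ring.
have {}E : SS g x - g x = \sum_s 2 ^- d * ((g (x + z s) + g (x - z s) - 2 * g x) / 2
    + (u s * (g (x + z s) - g x) + (expR (u s) - 1 - u s) * g (x + z s))).
  rewrite E; under eq_bigr do rewrite -addrA mulrDr.
  rewrite big_split /=; under [RHS]eq_bigr do rewrite mulrDr.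
  rewrite [RHS]big_split /=; congr (_ + _).
  have F1 : \sum_s 2 ^- d * (g (x + z s) - g x) = \sum_s 2 ^- d * (g (x - z s) - g x).
    rewrite -[LHS]big_flip; apply: eq_bigr => s _.
    by rewrite /z sg_flip scalerN.
  rewrite -[LHS](@mulfK _ 2) ?pnatr_eq0// mulrDr mulr1 {2}F1 -big_split /= mulr_suml.
  by apply: eq_bigr => s _; field; rewrite expf_neq0// pnatr_eq0.
rewrite E; set B := dl ^+ 2 * _; rewrite -(W B).
apply: le_trans (ler_norm_sum _ _ _) _; apply: ler_sum => s _.
rewrite normrM ger0_norm ?invr_ge0 ?exprn_ge0// ler_wpM2l ?invr_ge0 ?exprn_ge0//.
have zd : `|z s| <= dl by exact: norm_step.
have ud : `|u s| <= dl * norm1 a by exact: tilt_le.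
have u1 : `|u s| <= 1 by exact: le_trans ud dla.
have M0 : 0 <= M by exact: le_trans (gM 0).
have -> : B = dl ^+ 2 * (`|K| / 2) + (dl ^+ 2 * (norm1 a * `|L|) + dl ^+ 2 * (2 * norm1 a ^+ 2 * M)).
  by rewrite /B; ring.
apply: le_trans (ler_normD _ _) _; apply: lerD.
  rewrite normrM [`|2^-1|]ger0_norm// mulrA ler_wpM2r//.
  have := gK x (z s) (- z s); rewrite addrK => H.
  have -> : g (x + z s) + g (x - z s) - 2 * g x = - (g x - g (x + z s) - (g (x - z s) - g x)) by ring.
  rewrite normrN; apply: le_trans H _; rewrite normrN -mulrA -expr2 mulrC.
  apply: (@le_trans _ _ (`|z s| ^+ 2 * `|K|)).
    by rewrite ler_wpM2l ?sqr_ge0// ler_norm.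
  by rewrite ler_wpM2r// lerXn2r ?nnegrE// ltW.
apply: le_trans (ler_normD _ _) _; apply: lerD.
  rewrite normrM; apply: (@le_trans _ _ ((dl * norm1 a) * (`|L| * dl))); last first.
    by rewrite le_eqVlt; apply/orP; left; apply/eqP; ring.
  apply: ler_pM => //; apply: le_trans (gL _ _) _.
  by apply: (@le_trans _ _ (`|L| * `|z s|)); [rewrite ler_wpM2r// ler_norm | rewrite ler_wpM2l].
rewrite normrM; apply: (@le_trans _ _ ((2 * (dl * norm1 a) ^+ 2) * M)); last first.
  by rewrite le_eqVlt; apply/orP; left; apply/eqP; ring.
apply: ler_pM => //; apply: le_trans (expR_taylor1 u1) _.
rewrite ler_wpM2l// -[u s ^+ 2]real_normK ?num_real// lerXn2r ?nnegrE//.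
by rewrite mulr_ge0 ?norm1_ge0// ltW.
Qed.

End Walk.

(** * The reversible chain *)

Section WalkRegularity.
Context {R : realType} {d : nat}.
Implicit Types (s : {ffun 'I_d -> bool}) (i j : 'I_d) (x y u v a : 'rV[R]_d) (F f g psi : 'rV[R]_d -> R).
Local Notation eb := (@ebasis R d).

Lemma BD_mixed2 M f : BD 2 M f -> mixed2 (d%:R * (d%:R * M)) f.
Proof.
move=> H x u v.
pose w y := f (y + v) - f y.
have -> : d%:R * (d%:R * M) * `|u| * `|v| = d%:R * (d%:R * M * `|v|) * `|u| by ring.
change (`|w (x + u) - w x| <= d%:R * (d%:R * M * `|v|) * `|u|).
apply: coord_lipschitz => i y t.
apply: line_lipschitz => [y'|y'].
  apply: derivableB; last exact: BD_derivable H.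
  by apply: derivable_shift_rV; exact: BD_derivable H.
have dF w' : derivable (fun y => f (y + v)) w' (eb i).
  by apply: derivable_shift_rV; exact: BD_derivable H.
rewrite deriveB//; last exact: BD_derivable H.
rewrite derive_shift_rV; exact: (BD_lipschitz y' v (BD_partial i H)).
Qed.

Lemma SS_is_derive a (dl : R) F F' v : (forall x, is_derive x v F (F' x)) ->
  forall x, is_derive x v (SS a dl F) (SS a dl F' x).
Proof.
move=> H x; rewrite /SS.
have -> : (fun x => \sum_s wt a dl s * F (x + dl *: sg s)) =
   (\sum_s (fun x => wt a dl s * F (x + dl *: sg s)) : _ -> _).
  by apply/funext => y; rewrite fct_sumE.
apply: (@big_ind2 _ _ (fun (h : 'rV[R]_d -> R) (h' : R) => is_derive x v h h')).
- exact: is_derive_cst.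
- by move=> h1 h1' h2 h2' D1 D2; exact: is_deriveD.
- move=> s _; have [D E] := H (x + dl *: sg s).
  have DS : is_derive x v (fun y => F (y + dl *: sg s)) (F' (x + dl *: sg s)).
    by apply: DeriveDef; [exact: derivable_shift_rV | rewrite derive_shift_rV].
  exact: (@is_deriveZ _ _ _ (fun y => F (y + dl *: sg s)) (wt a dl s) x v _ DS).
Qed.

Lemma SS_derivable k M a (dl : R) F i x : BD k.+1 M F -> derivable (SS a dl F) x (eb i).
Proof.
move=> H; have [] // := @SS_is_derive a dl F (partial i F) (eb i) _ x.
by move=> y; apply: DeriveDef => //; exact: BD_derivable H.
Qed.

Lemma SS_partial k M a (dl : R) F i : BD k.+1 M F -> partial i (SS a dl F) = SS a dl (partial i F).
Proof.
move=> H; apply/funext => x; have [] // := @SS_is_derive a dl F (partial i F) (eb i) _ x.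
by move=> y; apply: DeriveDef => //; exact: BD_derivable H.
Qed.

Lemma SS_BD k M a (dl : R) F : BD k M F -> BD k (cc a dl * M) (SS a dl F).
Proof.
move=> H; rewrite /cc mulr_suml.
change (BD k (\sum_s wt a dl s * M) (fun x => \sum_s wt a dl s * F (x + dl *: sg s))).
apply: BD_sum => s; rewrite -{1}(ger0_norm (wt_ge0 a dl s)); apply: BD_scale.
exact: BD_shift.
Qed.

Definition nearC a : R := d%:R ^+ 2 / 2 + norm1 a * d%:R + 2 * norm1 a ^+ 2.

(** [SS] commutes with partial derivatives, so [SS_near] applies to each of them; the gain [dl^2] is
    paid with two derivatives. *)
Lemma SS_sub_BD k M a (dl : R) g : 0 < dl -> dl * norm1 a <= 1 -> BD k.+2 M g ->
  BD k (dl ^+ 2 * (nearC a * M)) (fun x => SS a dl g x - g x).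
Proof.
move=> dl0 dla; elim: k g => [|k IH] g H.
  split=> // x; have M0 := BD_ge0 H.
  have L : Lip (d%:R * M) g by move=> y v; exact: BD_lipschitz (BD_pred H).
  have := SS_near dl0 dla x (fun y => BD_le y H) L (BD_mixed2 H).
  rewrite [`|_ * (_ * M)|]ger0_norm ?mulr_ge0// [`|_ * M|]ger0_norm ?mulr_ge0// => /le_trans; apply.
  by rewrite le_eqVlt; apply/orP; left; apply/eqP; rewrite /nearC; field.
split.
  by move=> x; exact: (BD_le x (IH _ (BD_pred H))).
move=> i; split.
  move=> x; apply: derivableB; last exact: BD_derivable H.
  exact: SS_derivable H.
rewrite (_ : partial i _ = fun x => SS a dl (partial i g) x - partial i g x).
  exact: IH (BD_partial i H).
apply/funext => x; rewrite -(SS_partial a dl i H); apply: deriveB; last exact: BD_derivable H.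
exact: SS_derivable H.
Qed.

Lemma cc_le_e2 a (dl : R) : 0 < dl -> dl * norm1 a <= 1 -> cc a dl <= expR 2.
Proof.
move=> dl0 dla; apply: le_trans (cc_le dl0 dla) _; rewrite ler_expR -[leRHS]mulr1 ler_wpM2l//.
apply: (@le_trans _ _ ((dl * norm1 a) ^+ 2)); last first.
  by rewrite expr_le1// mulr_ge0 ?norm1_ge0// ltW.
rewrite exprMn ler_wpM2l ?sqr_ge0//; apply: le_trans (ler_norm _) _.
apply: le_trans (dotr_norm_le _ _) _; rewrite expr2 ler_wpM2l ?norm1_ge0//.
apply: norm_le_coord; first exact: norm1_ge0.
by move=> i; rewrite /norm1 (bigD1 i)//= lerDl sumr_ge0.
Qed.

End WalkRegularity.

(** * The normalised chain: positivity and Lipschitz bounds *)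

Section Chain.
Context {R : realType} {d : nat}.
Implicit Types (s t : {ffun 'I_d -> bool}) (i j : 'I_d) (x y u v a : 'rV[R]_d) (F f g psi : 'rV[R]_d -> R).

(** Division by [SS psi] makes constants invariant. The first-order variation of [psi] inside [SS]
    is what produces the drift [grad psi / psi]. *)
Definition Qop a (dl : R) psi f x : R := SS a dl (fun y => psi y * f y) x / SS a dl psi x.

(* [c], [Mp], [Lp], [Kp]: lower bound, upper bound, Lipschitz constant and
   Lipschitz constant of the gradient of the weight. *)
Definition weight (c Mp Lp Kp : R) psi :=
  [/\ forall x, c <= psi x, forall x, psi x <= Mp, Lip Lp psi & mixed2 Kp psi].

(** The constant of [SS_near] for a weight, divided by its lower bound: [SS psi] is [psi] up to a
    relative error [dl^2 * driftC]. *)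
Definition driftC a (c Mp Lp Kp : R) : R := (Kp / 2 + norm1 a * Lp + 2 * norm1 a ^+ 2 * Mp) / c.

Variables (a : 'rV[R]_d) (c Mp Lp Kp dl : R) (psi : 'rV[R]_d -> R).
Hypotheses (c0 : 0 < c) (L0 : 0 <= Lp) (K0 : 0 <= Kp).
Hypothesis W : weight c Mp Lp Kp psi.
Hypotheses (dl0 : 0 < dl) (dla : dl * norm1 a <= 1).
Hypothesis dlc : dl ^+ 2 * driftC a c Mp Lp Kp <= 1 / 2.

Local Notation c1 := (driftC a c Mp Lp Kp).
Local Notation Q := (Qop a dl psi).

Lemma psi_gt0 x : 0 < psi x.
Proof. by case: W => H _ _ _; exact: lt_le_trans c0 (H x). Qed.

Lemma Mp_gt0 : 0 < Mp.
Proof. by case: W => _ H _ _; exact: lt_le_trans (psi_gt0 0) (H 0). Qed.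

Lemma driftC_ge0 : 0 <= c1.
Proof.
rewrite divr_ge0 ?(ltW c0)// !addr_ge0// ?divr_ge0// ?mulr_ge0 ?norm1_ge0//.
exact/ltW/Mp_gt0.
Qed.

Lemma SSpsi_near x : `|SS a dl psi x - psi x| <= dl ^+ 2 * c1 * c.
Proof.
have [W1 W2 W3 W4] := W.
have PM y : `|psi y| <= Mp by rewrite gtr0_norm ?psi_gt0.
have := SS_near dl0 dla x PM W3 W4; rewrite (ger0_norm L0) (ger0_norm K0) => /le_trans; apply.
rewrite le_eqVlt; apply/orP; left; apply/eqP; rewrite /driftC; field.
by rewrite gt_eqF.
Qed.

Lemma SSpsi_ge x : (1 - dl ^+ 2 * c1) * psi x <= SS a dl psi x.
Proof.
have := SSpsi_near x; rewrite ler_distl => /andP[H _]; apply: le_trans H.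
rewrite mulrBl mul1r lerB// ler_wpM2l//; last by case: W.
by apply: mulr_ge0; [exact: sqr_ge0 | exact: driftC_ge0].
Qed.

Lemma SSpsi_ge2 x : c / 2 <= SS a dl psi x.
Proof.
apply: le_trans (SSpsi_ge x); have [W1 _ _ _] := W.
rewrite mulrC; apply: ler_pM => //; rewrite ?(ltW c0) ?invr_ge0//.
by move: dlc; set w := _ * c1; lra.
Qed.

Lemma SSpsi_gt0 x : 0 < SS a dl psi x.
Proof. by apply: lt_le_trans (SSpsi_ge2 x); rewrite divr_gt0. Qed.

Lemma SSpsi_neq0 x : SS a dl psi x != 0.
Proof. by rewrite gt_eqF// SSpsi_gt0. Qed.

Lemma SS_mono f g x : (forall y, f y <= g y) -> SS a dl f x <= SS a dl g x.
Proof. by move=> H; apply: ler_sum => s _; rewrite ler_wpM2l ?wt_ge0. Qed.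

Lemma SS_ge0 f x : (forall y, 0 <= f y) -> 0 <= SS a dl f x.
Proof. by move=> H; apply: sumr_ge0 => s _; rewrite mulr_ge0 ?wt_ge0. Qed.

Lemma Q_mono f g x : (forall y, f y <= g y) -> Q f x <= Q g x.
Proof.
move=> H; rewrite ler_pM2r ?invr_gt0 ?SSpsi_gt0//; apply: SS_mono => y.
by rewrite ler_wpM2l// ltW// psi_gt0.
Qed.

Lemma Q_ge0 f x : (forall y, 0 <= f y) -> 0 <= Q f x.
Proof.
move=> H; rewrite divr_ge0 ?(ltW (SSpsi_gt0 x))// SS_ge0// => y.
by rewrite mulr_ge0// ltW// psi_gt0.
Qed.

Lemma Qn_ge0 n f x : (forall y, 0 <= f y) -> 0 <= iter n Q f x.
Proof. by elim: n x => [//|n IH] x H /=; apply: Q_ge0 => y; exact: IH. Qed.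

Lemma SSD f g x : SS a dl (fun y => f y + g y) x = SS a dl f x + SS a dl g x.
Proof. by rewrite /SS -big_split; apply: eq_bigr => s _; rewrite mulrDr. Qed.

Lemma QD f g : Q (fun y => f y + g y) = (fun x => Q f x + Q g x).
Proof.
apply/funext => x; rewrite /Qop -mulrDl -SSD; congr (SS a dl _ x / _).
by apply/funext => y; rewrite mulrDr.
Qed.

Lemma QnD n f g : iter n Q (fun y => f y + g y) = (fun x => iter n Q f x + iter n Q g x).
Proof. by elim: n => [//|n IH] /=; rewrite IH QD. Qed.

Definition lipC : R := expR 2 ^+ 2 * (2 * Lp ^+ 2 + 2 * (Mp * Kp)) * (4 / c ^+ 2).

(** The transition probabilities at [x] and [x + v] differ by [O(dl |v|)] and a jump changes [f] by
    [O(dl)], so the constant grows by a factor [1 + O(dl^2)] per step, which stays bounded over a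
    fixed time. Only the constants of [weight] enter, so the smoothing of [psi] can be chosen after
    the Lipschitz constant of the iterates. *)
Lemma Q_lip (L : R) f : 0 <= L -> Lip L f -> Lip ((1 + dl ^+ 2 * lipC) * L) (Q f).
Proof.
move=> Lf0 Hf x v; have [W1 W2 W3 W4] := W.
pose z s := dl *: sg s : 'rV[R]_d.
have zd s : `|z s| <= dl by exact: norm_step.
pose p s y := wt a dl s * psi (y + z s) / SS a dl psi y.
have p0 s y : 0 <= p s y.
  apply: divr_ge0; last exact/ltW/SSpsi_gt0.
  by apply: mulr_ge0; [exact: wt_ge0 | exact/ltW/psi_gt0].
have p1 y : \sum_s p s y = 1 by rewrite -mulr_suml divff// SSpsi_neq0.
have QE y : Q f y = \sum_s p s y * f (y + z s).
  by rewrite /Qop /SS mulr_suml; apply: eq_bigr => s _; rewrite /p /z; ring.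
have E : Q f (x + v) - Q f x = \sum_s p s (x + v) * (f (x + z s + v) - f (x + z s))
     + \sum_s (p s (x + v) - p s x) * (f (x + z s) - f x).
  (* Both families of probabilities sum to 1, so [f x] may be subtracted in the second sum. *)
  have Z : \sum_s (p s (x + v) - p s x) * f x = 0.
    by rewrite -mulr_suml sumrB !p1 subrr mul0r.
  rewrite !QE -sumrB -big_split /= -[LHS]subr0 -[X in _ - X = _]Z -sumrB; apply: eq_bigr => s _.
  by rewrite (addrAC x v); ring.
pose B := 2 * Lp ^+ 2 + 2 * (Mp * Kp).
have B0 : 0 <= B by rewrite addr_ge0 ?mulr_ge0 ?sqr_ge0// ltW// Mp_gt0.
have pd s : `|p s (x + v) - p s x| <= wt a dl s * (cc a dl * (dl * `|v| * B) * (4 / c ^+ 2)).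
  (* Over a common denominator each term of the numerator vanishes both for [v = 0] and for
     [z s = z t], hence is of order [dl |v|]; the second difference of [psi] enters here. *)
  have -> : p s (x + v) - p s x = wt a dl s *
    ((\sum_t wt a dl t * (psi (x + v + z s) * psi (x + z t) - psi (x + z s) * psi (x + v + z t)))
     * ((SS a dl psi x)^-1 * (SS a dl psi (x + v))^-1)).
    have -> : \sum_t wt a dl t * (psi (x + v + z s) * psi (x + z t) - psi (x + z s) * psi (x + v + z t))
      = psi (x + v + z s) * SS a dl psi x - psi (x + z s) * SS a dl psi (x + v).
      by rewrite /SS !mulr_sumr -sumrB; apply: eq_bigr => t _; rewrite /z; ring.
    by rewrite /p; field; rewrite !SSpsi_neq0.
  rewrite normrM (ger0_norm (wt_ge0 _ _ _)) ler_wpM2l ?wt_ge0// normrM.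
  apply: ler_pM => //.
    apply: le_trans (ler_norm_sum _ _ _) _; rewrite /cc mulr_suml; apply: ler_sum => t _.
    rewrite normrM (ger0_norm (wt_ge0 _ _ _)) ler_wpM2l ?wt_ge0//.
    have -> : psi (x + v + z s) * psi (x + z t) - psi (x + z s) * psi (x + v + z t) =
      (psi (x + v + z s) - psi (x + z s)) * (psi (x + z t) - psi (x + z s)) +
      psi (x + z s) * ((psi (x + v + z s) - psi (x + z s)) - (psi (x + v + z t) - psi (x + z t))).
      by ring.
    have zz : `|z s - z t| <= 2 * dl.
      by apply: le_trans (ler_normB _ _) _; have := zd s; have := zd t; lra.
    have dl0' := ltW dl0.
    apply: le_trans (ler_normD _ _) _.
    have -> : dl * `|v| * B = (Lp * `|v|) * (Lp * (2 * dl)) + Mp * (Kp * (2 * dl) * `|v|).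
      by rewrite /B; ring.
    apply: lerD; rewrite normrM; apply: ler_pM => //.
    + by rewrite (addrAC x v); exact: W3.
    + have -> : x + z s = x + z t + (z s - z t) by rewrite addrA addrAC addrK.
      rewrite distrC; apply: le_trans (W3 _ _) _; exact: ler_wpM2l.
    + by rewrite gtr0_norm ?psi_gt0.
    + have := W4 (x + z t) (z s - z t) v.
      have -> : x + z t + (z s - z t) = x + z s by rewrite addrA addrAC addrK.
      rewrite (addrAC x v (z s)) (addrAC x v (z t)) => /le_trans; apply.
      by rewrite ler_wpM2r// ler_wpM2l.
  rewrite ger0_norm; last by rewrite mulr_ge0// invr_ge0 ltW// SSpsi_gt0.
  have -> : 4 / c ^+ 2 = (c / 2)^-1 * (c / 2)^-1 by field; rewrite gt_eqF.
  by apply: ler_pM; rewrite ?invr_ge0 ?(ltW (SSpsi_gt0 _))// lef_pV2 ?posrE ?SSpsi_ge2 ?SSpsi_gt0 ?divr_gt0.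
rewrite E mulrDl mul1r mulrDl; apply: le_trans (ler_normD _ _) _; apply: lerD.
  apply: le_trans (ler_norm_sum _ _ _) _; rewrite -[leRHS]mul1r -(p1 (x + v)) mulr_suml.
  by apply: ler_sum => s _; rewrite normrM (ger0_norm (p0 _ _)) ler_wpM2l.
apply: le_trans (ler_norm_sum _ _ _) _.
have cc0 : 0 <= cc a dl by apply: sumr_ge0 => s _; exact: wt_ge0.
apply: (@le_trans _ _ (cc a dl * ((cc a dl * (dl * `|v| * B) * (4 / c ^+ 2)) * (L * dl)))).
  rewrite /cc mulr_suml; apply: ler_sum => s _; rewrite normrM mulrA; apply: ler_pM => //.
  by apply: le_trans (Hf _ _) _; rewrite ler_wpM2l.
have -> : cc a dl * (cc a dl * (dl * `|v| * B) * (4 / c ^+ 2) * (L * dl)) =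
  (cc a dl ^+ 2) * (B * (4 / c ^+ 2) * (dl ^+ 2 * L * `|v|)) by ring.
have -> : dl ^+ 2 * lipC * L * `|v| = expR 2 ^+ 2 * (B * (4 / c ^+ 2) * (dl ^+ 2 * L * `|v|)).
  by rewrite /lipC -/B; ring.
have hc : 0 <= 4 / c ^+ 2 by rewrite divr_ge0 ?sqr_ge0.
have hd : 0 <= dl ^+ 2 * L * `|v| by rewrite !mulr_ge0// ltW.
apply: ler_wpM2r; first exact: mulr_ge0 (mulr_ge0 B0 hc) hd.
by rewrite lerXn2r ?nnegrE ?expR_ge0// cc_le_e2.
Qed.

Lemma lipC_ge0 : 0 <= lipC.
Proof.
rewrite /lipC !mulr_ge0 ?sqr_ge0// ?expR_ge0 ?invr_ge0 ?sqr_ge0//.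
by rewrite addr_ge0 ?mulr_ge0 ?sqr_ge0// ltW// Mp_gt0.
Qed.

Lemma pow1D_le_exp (u : R) n : 0 <= u -> (1 + u) ^+ n <= expR (n%:R * u).
Proof.
move=> u0; rewrite expRM_natl; apply: lerXn2r; rewrite ?nnegrE ?expR_ge0 ?addr_ge0//.
exact: expR_ge1Dx.
Qed.

Lemma Qn_lip (L : R) n f : 0 <= L -> Lip L f -> Lip (expR (n%:R * (dl ^+ 2 * lipC)) * L) (iter n Q f).
Proof.
move=> L1 Hf; have u0 : 0 <= dl ^+ 2 * lipC by rewrite mulr_ge0 ?sqr_ge0 ?lipC_ge0.
have H : Lip ((1 + dl ^+ 2 * lipC) ^+ n * L) (iter n Q f).
  elim: n => [|n IH]; first by rewrite expr0 mul1r.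
  rewrite exprS -mulrA /=; apply: Q_lip => //; rewrite mulr_ge0// exprn_ge0// addr_ge0//.
move=> x v; apply: le_trans (H x v) _; rewrite ler_wpM2r// ler_wpM2r//.
exact: pow1D_le_exp.
Qed.

End Chain.

(** * Derivative bounds and generator of the chain *)

Section ChainRegularity.
Context {R : realType} {d : nat}.
Implicit Types (s t : {ffun 'I_d -> bool}) (i j : 'I_d) (x y u v a : 'rV[R]_d) (F f g psi : 'rV[R]_d -> R).

(* The chain is studied through [F = psi * f], which evolves by [F |-> (psi / SS psi) * SS F]:
   convolution preserves the bounds on the derivatives and the factor is [1 + O(dl^2)]. *)
Lemma Qn_BD a (Mb c : R) : 0 < c -> exists C3 : R, 0 <= C3 /\ forall (dl : R) psi,
  0 < dl -> dl * norm1 a <= 1 -> BD 5 Mb psi -> (forall x, c <= psi x) ->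
  (forall x, c / 2 <= SS a dl psi x) ->
  forall n N f, BD 3 N f -> BD 3 (C3 * N * expR (C3 * (n%:R * dl ^+ 2))) (iter n (Qop a dl psi) f).
Proof.
move=> c0.
have [Ci HCi] := @BD_inv R d 3 (expR 2 * Mb) (c / 2) (divr_gt0 c0 (ltr0Sn _ 1)).
have [Cp HCp] := @BD_inv R d 3 Mb c c0.
have aa0 : 0 <= dotr a a by apply: sumr_ge0 => i _; rewrite -expr2 sqr_ge0.
pose C' := 2 ^+ 3 * (2 ^+ 3 * ((nearC a * `|Mb|) * `|Ci|)).
have nC0 : 0 <= nearC a.
  by rewrite /nearC !addr_ge0 ?divr_ge0 ?mulr_ge0 ?sqr_ge0 ?norm1_ge0.
have C'0 : 0 <= C' by rewrite /C' !mulr_ge0.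
pose C3 := 2 ^+ 3 * (2 ^+ 3 * `|Mb| * `|Cp|) + (2 * dotr a a + C').
have C30 : 0 <= C3 by rewrite /C3 addr_ge0 ?addr_ge0// !mulr_ge0.
exists C3; split=> // dl psi dl0 dla Hpsi psic SSc n N f Hf.
have Mb0 : 0 <= Mb := BD_ge0 Hpsi.
have N0 : 0 <= N := BD_ge0 Hf.
pose Q := Qop a dl psi; pose F k := (fun x => psi x * iter k Q f x).
have psi3 : BD 3 Mb psi by exact: BD_leq Hpsi.
have SS0 x : SS a dl psi x != 0 by rewrite gt_eqF// (lt_le_trans _ (SSc x))// divr_gt0.
have Hi : BD 3 Ci (fun x => (SS a dl psi x)^-1).
  apply: HCi => //; apply: BD_weaken (SS_BD a dl psi3).
  by rewrite ler_wpM2r// cc_le_e2.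
have Hp : BD 3 Cp (fun x => (psi x)^-1) by exact: HCp.
have Ci0 : 0 <= Ci := BD_ge0 Hi; have Cp0 : 0 <= Cp := BD_ge0 Hp.
(* Comparing [SS psi] with [psi] costs two derivatives: hence order 5 for [psi] and order 3 for the
   iterates. *)
have Hk : BD 3 (dl ^+ 2 * (2 ^+ 3 * ((nearC a * Mb) * Ci)))
    (fun x => -1 * (SS a dl psi x - psi x) * (SS a dl psi x)^-1).
  have := BD_mul (BD_scale (-1) (SS_sub_BD dl0 dla Hpsi)) Hi.
  by apply: BD_weaken; rewrite normrN1 le_eqVlt; apply/orP; left; apply/eqP; ring.
have cc0 : 0 <= cc a dl by apply: sumr_ge0 => s _; exact: wt_ge0.
have FS k M : BD 3 M (F k) -> BD 3 (cc a dl * (1 + dl ^+ 2 * C') * M) (F k.+1).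
  move=> HF; have E : F k.+1 = (fun x => SS a dl (F k) x +
      (-1 * (SS a dl psi x - psi x) * (SS a dl psi x)^-1) * SS a dl (F k) x).
    apply/funext => x; rewrite /F /= {1}/Q /Qop -/Q; set S1 := SS a dl _ x.
    by field; rewrite SS0.
  rewrite E; have HS := SS_BD a dl HF.
  apply: BD_weaken (BD_add HS (BD_mul Hk HS)).
  rewrite le_eqVlt; apply/orP; left; apply/eqP.
  by rewrite /C' (ger0_norm Mb0) (ger0_norm Ci0); ring.
have FB k : BD 3 (expR (k%:R * (2 * (dl ^+ 2 * dotr a a) + dl ^+ 2 * C')) * (2 ^+ 3 * (Mb * N))) (F k).
  elim: k => [|k IH].
    by rewrite mul0r expR0 mul1r; exact: BD_mul.
  apply: BD_weaken (FS _ _ IH); rewrite mulrA ler_wpM2r ?mulr_ge0//.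
  have -> : (k.+1%:R : R) = 1 + k%:R by rewrite addrC natr1.
  rewrite [(1 + _) * (_ + _)]mulrDl mul1r expRD; apply: ler_pM => //.
  - by rewrite mulr_ge0// addr_ge0// mulr_ge0// sqr_ge0.
  - rewrite expRD; apply: ler_pM => //; first by rewrite addr_ge0// mulr_ge0// sqr_ge0.
      exact: cc_le.
    exact: expR_ge1Dx.
have EQ : iter n Q f = (fun x => F n x * (psi x)^-1).
  apply/funext => x; rewrite /F mulrAC divff ?mul1r//.
  by rewrite gt_eqF// (lt_le_trans c0).
rewrite -/Q EQ; apply: BD_weaken (BD_mul (FB n) Hp).
have e0 : 0 <= dl ^+ 2 by exact: sqr_ge0.
have n0 : (0 : R) <= n%:R by [].
have -> : 2 ^+ 3 * (expR (n%:R * (2 * (dl ^+ 2 * dotr a a) + dl ^+ 2 * C')) * (2 ^+ 3 * (Mb * N)) * Cp)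
  = (2 ^+ 3 * (2 ^+ 3 * Mb * Cp)) * N * expR (n%:R * (2 * (dl ^+ 2 * dotr a a) + dl ^+ 2 * C')) by ring.
apply: ler_pM; rewrite ?expR_ge0//; first by rewrite !mulr_ge0.
  rewrite ler_wpM2r// /C3 (ger0_norm Mb0) (ger0_norm Cp0) lerDl addr_ge0// mulr_ge0//.
rewrite ler_expR.
have -> : n%:R * (2 * (dl ^+ 2 * dotr a a) + dl ^+ 2 * C') = (2 * dotr a a + C') * (n%:R * dl ^+ 2) by ring.
by apply: ler_wpM2r; [nneg | rewrite /C3 lerDr; nneg].
Qed.

Definition drift a psi y : 'rV[R]_d := (psi y)^-1 *: grad psi y + a.

Lemma sum_sg_lin (p q : 'I_d -> R) :
  2 ^- d * \sum_s (\sum_i sg s 0 i * p i) * (\sum_j sg s 0 j * q j) = \sum_i p i * q i.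
Proof.
have -> : \sum_s (\sum_i sg s 0 i * p i) * (\sum_j sg s 0 j * q j) =
  \sum_i \sum_j (p i * q j) * \sum_s sg s 0 i * sg s 0 j.
  under eq_bigr do rewrite big_distrlr /=.
  rewrite exchange_big; apply: eq_bigr => i _; rewrite exchange_big; apply: eq_bigr => j _.
  by rewrite mulr_sumr; apply: eq_bigr => s _; ring.
rewrite mulr_sumr; apply: eq_bigr => i _; rewrite (bigD1 i)//= [X in _ + X]big1 => [|j ji].
  by rewrite addr0 sum_sgn2 eqxx mulr1 [_ * 2 ^+ d]mulrC mulKf// expf_neq0// pnatr_eq0.
by rewrite sum_sgn2 eq_sym (negbTE ji) !mulr0.
Qed.

Lemma sum_sg_quad (p : 'I_d -> 'I_d -> R) :
  2 ^- d * \sum_s \sum_i \sum_j sg s 0 i * sg s 0 j * p i j = \sum_i p i i.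
Proof.
have -> : \sum_s \sum_i \sum_j sg s 0 i * sg s 0 j * p i j =
  \sum_i \sum_j p i j * \sum_s sg s 0 i * sg s 0 j.
  rewrite exchange_big; apply: eq_bigr => i _; rewrite exchange_big; apply: eq_bigr => j _.
  by rewrite mulr_sumr; apply: eq_bigr => s _; ring.
rewrite mulr_sumr; apply: eq_bigr => i _; rewrite (bigD1 i)//= [X in _ + X]big1 => [|j ji].
  by rewrite addr0 sum_sgn2 eqxx mulr1 [_ * 2 ^+ d]mulrC mulKf// expf_neq0// pnatr_eq0.
by rewrite sum_sgn2 eq_sym (negbTE ji) !mulr0.
Qed.

Lemma sum_norm_le (p : 'I_d -> R) (C : R) : (forall i, `|p i| <= C) -> `|\sum_i p i| <= d%:R * C.
Proof.
move=> H; apply: le_trans (ler_norm_sum _ _ _) _.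
by rewrite [leRHS]mulr_natl -[X in _ *+ X]card_ord -sumr_const; apply: ler_sum => i _.
Qed.

Lemma norm_sg0 s i : `|sg s 0 i| = 1 :> R.
Proof. by rewrite mxE norm_sgn. Qed.

Lemma sg_taylor (N dl : R) f x s : 0 < dl -> BD 3 N f ->
  `|f (x + dl *: sg s) - f x - dl * (\sum_i sg s 0 i * partial i f x)
     - dl ^+ 2 / 2 * (\sum_i \sum_j sg s 0 i * sg s 0 j * partial j (partial i f) x)|
  <= (2 * d%:R ^+ 2 + 2 * d%:R ^+ 3) * N * dl ^+ 3.
Proof.
move=> dl0 Hf; have N0 := BD_ge0 Hf.
pose h (t : R) := f (x + t *: sg s); pose h1 (t : R) := \sum_i sg s 0 i * partial i f (x + t *: sg s).
pose h2 := \sum_i \sum_j sg s 0 i * sg s 0 j * partial j (partial i f) x.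
pose C := (2 * d%:R ^+ 2 + 2 * d%:R ^+ 3) * N.
have sq (r : R) : `|r *: (sg s : 'rV[R]_d)| ^+ 2 <= r ^+ 2.
  rewrite normrZ -[r ^+ 2]real_normK ?num_real// lerXn2r ?nnegrE ?mulr_ge0//.
  by rewrite ler_piMr// norm_sg_le.
have F g (y : 'rV[R]_d) (r : R) : BD 2 N g ->
  `|g (y + r *: sg s) - g y - r * \sum_i sg s 0 i * partial i g y| <= 2 * d%:R ^+ 2 * N * r ^+ 2.
  move=> Hg; have := BD_frechet y (r *: sg s) Hg.
  have -> : \sum_i (r *: sg s) 0 i * partial i g y = r * \sum_i sg s 0 i * partial i g y.
    by rewrite mulr_sumr; apply: eq_bigr => i _; rewrite mxE mulrA.
  move=> /le_trans; apply.
  have -> : d%:R * (2 * (d%:R * N)) = 2 * d%:R ^+ 2 * N :> R by ring.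
  by rewrite ler_wpM2l ?sq// !mulr_ge0.
have H1 (t r : R) : `|h (t + r) - h t - r * h1 t| <= C * r ^+ 2.
  rewrite /h scalerDl addrA; apply: le_trans (F _ _ _ (BD_pred Hf)) _.
  by rewrite ler_wpM2r ?sqr_ge0// /C ler_wpM2r// lerDl mulr_ge0// exprn_ge0.
have H2 (t : R) : `|h1 t - h1 0 - t * h2| <= C * t ^+ 2.
  have -> : h1 t - h1 0 - t * h2 = \sum_i sg s 0 i * (partial i f (x + t *: sg s) - partial i f x
      - t * \sum_j sg s 0 j * partial j (partial i f) x).
    rewrite /h1 /h2 mulr_sumr -!sumrB; apply: eq_bigr => i _; rewrite scale0r addr0 !mulrBr.
    by rewrite !mulr_sumr; congr (_ - _); apply: eq_bigr => j _; ring.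
  apply: (@le_trans _ _ (d%:R * (2 * d%:R ^+ 2 * N * t ^+ 2))).
    apply: sum_norm_le => i; rewrite normrM norm_sg0 mul1r.
    exact: F (BD_partial i Hf).
  have -> : d%:R * (2 * d%:R ^+ 2 * N * t ^+ 2) = 2 * d%:R ^+ 3 * N * t ^+ 2 by ring.
  by rewrite ler_wpM2r ?sqr_ge0// /C ler_wpM2r// lerDr mulr_ge0// exprn_ge0.
have := taylor2 H1 H2 dl; rewrite (gtr0_norm dl0) /h scale0r addr0.
have -> : h1 0 = \sum_i sg s 0 i * partial i f x.
  by apply: eq_bigr => i _; rewrite scale0r addr0.
by [].
Qed.

(** After multiplication by [SS psi] the increment is an average of
    [exp(dl a.s) psi(x + z) (f(x + z) - f x)]. Since the last factor is already of order [dl], [psi]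
    is expanded to first order only. The product of the two first-order terms yields the drift, the
    second-order term of [f] yields the Laplacian, and the odd term averages to 0. *)
Lemma Q_taylor a (Mb c : R) : 0 < c -> exists C4 : R, 0 <= C4 /\ forall (dl : R) psi,
  0 < dl -> dl <= 1 -> dl * norm1 a <= 1 -> BD 2 Mb psi -> (forall x, c <= psi x) ->
  (forall x, c / 2 <= SS a dl psi x) ->
  forall N f x, BD 3 N f ->
  `|Qop a dl psi f x - f x - dl ^+ 2 * generator (drift a psi) f x| <= C4 * N * dl ^+ 3.
Proof.
move=> c0.
pose D : R := d%:R; have D0 : 0 <= D by [].
pose n1 := norm1 a; have n10 : 0 <= n1 := norm1_ge0 a.
pose kD := D + n1; pose kR3 := 2 * D ^+ 2 + 2 * D ^+ 3.
pose kR2 := 2 * n1 ^+ 2 + 2 * D ^+ 2 + n1 * D.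
pose kE := kD * D ^+ 2 / 2 + (1 + kD) * kR3 + kR2 * D.
have kD0 : 0 <= kD by rewrite addr_ge0.
have kR30 : 0 <= kR3 by rewrite addr_ge0 ?mulr_ge0 ?exprn_ge0.
have kR20 : 0 <= kR2 by rewrite !addr_ge0 ?mulr_ge0 ?exprn_ge0.
have kE0 : 0 <= kE by rewrite /kE; nneg.
have nC0 : 0 <= nearC a.
  by rewrite /nearC !addr_ge0 ?divr_ge0 ?mulr_ge0 ?sqr_ge0 ?norm1_ge0.
pose G0 := D / 2 + (`|Mb| / c * D + n1).
have G00 : 0 <= G0 by rewrite /G0; nneg.
exists ((kE * `|Mb| + G0 * (nearC a * `|Mb|)) * (2 / c)); split.
  by nneg.
move=> dl psi dl0 dl1 dla Hpsi psic SSc N f x Hf.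
have Mb0 : 0 <= Mb := BD_ge0 Hpsi; have N0 : 0 <= N := BD_ge0 Hf.
rewrite !(ger0_norm Mb0) in G00 *.
have psi0 y : 0 < psi y by exact: lt_le_trans c0 (psic y).
have SS0 y : 0 < SS a dl psi y by apply: lt_le_trans (SSc y); rewrite divr_gt0.
have SS0' y : SS a dl psi y != 0 by rewrite gt_eqF.
pose A s := \sum_i sg s 0 i * partial i f x.
pose B s := \sum_i \sum_j sg s 0 i * sg s 0 j * partial j (partial i f) x.
pose E s := \sum_i sg s 0 i * (partial i psi x + psi x * a 0 i).
pose z s := dl *: sg s : 'rV[R]_d.
have zd s : `|z s| <= dl by exact: norm_step.
have fz s : `|f (x + z s) - f x| <= D * N * dl.
  apply: le_trans (BD_lipschitz _ _ (BD_leq (isT : (1 <= 3)%N) Hf)) _.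
  by rewrite ler_wpM2l ?mulr_ge0.
have pz s : `|psi (x + z s) - psi x| <= D * Mb * dl.
  apply: le_trans (BD_lipschitz _ _ (BD_pred Hpsi)) _.
  by rewrite ler_wpM2l ?mulr_ge0.
have R3 s : `|f (x + z s) - f x - dl * A s - dl ^+ 2 / 2 * B s| <= kR3 * N * dl ^+ 3.
  exact: sg_taylor.
have dotE s : dotr a (sg s) = \sum_i sg s 0 i * a 0 i.
  by apply: eq_bigr => i _; rewrite mulrC.
have R2 s : `|expR (dl * dotr a (sg s)) * psi (x + z s) - psi x - dl * E s| <= kR2 * Mb * dl ^+ 2.
  pose u := dl * dotr a (sg s).
  have ud : `|u| <= dl * n1 by exact: tilt_le.
  have u1 : `|u| <= 1 by exact: le_trans dla.
  have -> : expR u * psi (x + z s) - psi x - dl * E s =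
    (expR u - 1 - u) * psi (x + z s) + (psi (x + z s) - psi x - \sum_i (z s) 0 i * partial i psi x)
    + u * (psi (x + z s) - psi x).
    have -> : \sum_i (z s) 0 i * partial i psi x = dl * \sum_i sg s 0 i * partial i psi x.
      by rewrite mulr_sumr; apply: eq_bigr => i _; rewrite mxE mulrA.
    have -> : E s = \sum_i sg s 0 i * partial i psi x + psi x * dotr a (sg s).
      rewrite dotE mulr_sumr -big_split; apply: eq_bigr => i _ /=; ring.
    by rewrite /u; ring.
  have -> : kR2 * Mb * dl ^+ 2 = (2 * (dl * n1) ^+ 2) * Mb + D * (2 * (D * Mb)) * dl ^+ 2
     + (dl * n1) * (D * Mb * dl) by rewrite /kR2; ring.
  apply: le_trans (ler_normD _ _) _; apply: lerD; last first.
    by rewrite normrM; apply: ler_pM.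
  apply: le_trans (ler_normD _ _) _; apply: lerD.
    rewrite normrM; apply: ler_pM => //; last exact: BD_le Hpsi.
    apply: le_trans (expR_taylor1 u1) _; rewrite ler_wpM2l// -[u ^+ 2]real_normK ?num_real//.
    by rewrite lerXn2r ?nnegrE// mulr_ge0// ltW.
  apply: le_trans (BD_frechet _ _ Hpsi) _.
  by rewrite ler_wpM2l ?mulr_ge0// lerXn2r ?nnegrE// ltW.
have sg1 s i (r : R) : `|sg s 0 i * r| = `|r| by rewrite normrM norm_sg0 mul1r.
have AN s : `|A s| <= D * N.
  by apply: sum_norm_le => i; rewrite sg1; exact: BD_le (BD_partial i Hf).
have BN s : `|B s| <= D * (D * N).
  apply: sum_norm_le => i; apply: sum_norm_le => j.
  rewrite -mulrA sg1 sg1; exact: BD_le (BD_partial j (BD_partial i Hf)).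
have EN s : `|E s| <= kD * Mb.
  have -> : E s = \sum_i sg s 0 i * partial i psi x + psi x * dotr a (sg s).
    rewrite dotE mulr_sumr -big_split; apply: eq_bigr => i _ /=; ring.
  rewrite /kD mulrDl; apply: le_trans (ler_normD _ _) _; apply: lerD.
    by apply: sum_norm_le => i; rewrite sg1; exact: BD_le (BD_partial i Hpsi).
  rewrite normrM mulrC; apply: ler_pM => //; last exact: BD_le Hpsi.
  apply: le_trans (dotr_norm_le _ _) _.
  by rewrite ler_piMr ?norm_sg_le.
have W (k : R) : \sum_(s : {ffun 'I_d -> bool}) 2 ^- d * k = k.
  by rewrite -mulr_sumr sum_cst_signs mulrA mulVf ?mul1r// expf_neq0// pnatr_eq0.
pose G := generator (drift a psi) f x.
have GE : psi x * G = psi x / 2 * (\sum_i partial i (partial i f) x)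
     + \sum_i (partial i psi x + psi x * a 0 i) * partial i f x.
  rewrite /G /generator /laplacian mulrDr; congr (_ + _); first by rewrite mulrA.
  rewrite /dotr mulr_sumr; apply: eq_bigr => i _.
  rewrite /drift /grad !mxE; field; rewrite gt_eqF//.
have M1 : \sum_s 2 ^- d * (psi x * dl * A s) = 0.
  have -> : \sum_s 2 ^- d * (psi x * dl * A s) = 2 ^- d * (psi x * dl) * \sum_s A s.
    by rewrite mulr_sumr; apply: eq_bigr => s _; ring.
  rewrite /A exchange_big /= big1 ?mulr0// => i _; rewrite -mulr_suml sum_sgn mul0r//.
have M2 : \sum_s 2 ^- d * (dl ^+ 2 * (psi x / 2 * B s + E s * A s)) = dl ^+ 2 * (psi x * G).
  have -> : \sum_s 2 ^- d * (dl ^+ 2 * (psi x / 2 * B s + E s * A s)) =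
     dl ^+ 2 * (psi x / 2 * (2 ^- d * \sum_s B s) + 2 ^- d * \sum_s E s * A s).
    rewrite !mulr_sumr -big_split /= mulr_sumr; apply: eq_bigr => s _; ring.
  by rewrite sum_sg_quad sum_sg_lin GE.
have main : `|SS a dl psi x * (Qop a dl psi f x - f x) - dl ^+ 2 * (psi x * G)| <= kE * Mb * N * dl ^+ 3.
  have -> : SS a dl psi x * (Qop a dl psi f x - f x) - dl ^+ 2 * (psi x * G) =
    \sum_s 2 ^- d * (expR (dl * dotr a (sg s)) * psi (x + z s) * (f (x + z s) - f x)
      - psi x * dl * A s - dl ^+ 2 * (psi x / 2 * B s + E s * A s)).
    have -> : SS a dl psi x * (Qop a dl psi f x - f x) =
       \sum_s 2 ^- d * (expR (dl * dotr a (sg s)) * psi (x + z s) * (f (x + z s) - f x)).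
      rewrite mulrBr /Qop mulrC divfK// /SS mulr_suml -sumrB; apply: eq_bigr => s _.
      by rewrite /wt /z; ring.
    rewrite -M2 -[X in X - _]subr0 -[X in _ - X - _ = _]M1 -!sumrB; apply: eq_bigr => s _.
    by ring.
  rewrite -(W (kE * Mb * N * dl ^+ 3)).
  apply: le_trans (ler_norm_sum _ _ _) _; apply: ler_sum => s _.
  rewrite normrM ger0_norm ?invr_ge0 ?exprn_ge0// ler_wpM2l ?invr_ge0 ?exprn_ge0//.
  set P := expR _ * _; set fd := f _ - _.
  have -> : P * fd - psi x * dl * A s - dl ^+ 2 * (psi x / 2 * B s + E s * A s) =
     dl ^+ 3 / 2 * (E s * B s) + (psi x + dl * E s) * (fd - dl * A s - dl ^+ 2 / 2 * B s)
     + (P - psi x - dl * E s) * fd by field.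
  have -> : kE * Mb * N * dl ^+ 3 = dl ^+ 3 / 2 * ((kD * Mb) * (D * (D * N)))
     + (Mb + kD * Mb) * (kR3 * N * dl ^+ 3) + (kR2 * Mb * dl ^+ 2) * (D * N * dl).
    by rewrite /kE; field.
  apply: le_trans (ler_normD _ _) _; apply: lerD; last first.
    by rewrite normrM; apply: ler_pM => //; [exact: R2 | exact: fz].
  apply: le_trans (ler_normD _ _) _; apply: lerD.
    rewrite normrM (ger0_norm (divr_ge0 (exprn_ge0 3 (ltW dl0)) _))//.
    rewrite ler_wpM2l ?divr_ge0 ?exprn_ge0 ?(ltW dl0)// normrM; apply: ler_pM => //.
  rewrite normrM; apply: ler_pM => //; last exact: R3.
  apply: le_trans (ler_normD _ _) _; apply: lerD; first exact: BD_le Hpsi.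
  rewrite normrM (gtr0_norm dl0); apply: le_trans (EN s).
  by rewrite ler_piMl.
have GN : `|G| <= G0 * N.
  rewrite /G /generator /G0 mulrDl; apply: le_trans (ler_normD _ _) _; apply: lerD.
    rewrite normrM ger0_norm// [D / 2]mulrC -mulrA ler_wpM2l//.
    by apply: sum_norm_le => i; exact: BD_le (BD_partial i (BD_partial i Hf)).
  rewrite /drift dotrDl mulrDl; apply: le_trans (ler_normD _ _) _; apply: lerD.
    have -> : `|Mb| / c * D * N = D * ((c^-1 * Mb) * N) by rewrite ger0_norm//; ring.
    apply: sum_norm_le => i; rewrite !mxE !normrM; apply: ler_pM; rewrite ?mulr_ge0//; last first.
      exact: BD_le (BD_partial i Hf).
    apply: ler_pM => //; last exact: BD_le (BD_partial i Hpsi).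
    by rewrite gtr0_norm ?invr_gt0// lef_pV2 ?posrE.
  apply: le_trans (dotr_norm_le _ _) _; rewrite ler_wpM2l//.
  by apply: norm_le_coord => // i; rewrite mxE; exact: BD_le (BD_partial i Hf).
have near : `|SS a dl psi x - psi x| <= dl ^+ 2 * (nearC a * Mb).
  exact: (BD_le x (SS_sub_BD dl0 dla Hpsi)).
rewrite -/G.
(* Using [SS psi] in place of [psi] in front of [G] costs a further [dl^2 * dl^2], absorbed into
   [dl^3] by [dl <= 1]. *)
have -> : Qop a dl psi f x - f x - dl ^+ 2 * G =
  ((SS a dl psi x * (Qop a dl psi f x - f x) - dl ^+ 2 * (psi x * G))
   - dl ^+ 2 * (G * (SS a dl psi x - psi x))) * (SS a dl psi x)^-1 by field; rewrite SS0'.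
rewrite normrM.
have -> : (kE * Mb + G0 * (nearC a * Mb)) * (2 / c) * N * dl ^+ 3 =
   (kE * Mb * N * dl ^+ 3 + dl ^+ 3 * ((G0 * N) * (nearC a * Mb))) * (2 / c) by ring.
apply: ler_pM => //.
  apply: le_trans (ler_normB _ _) _; apply: lerD => //.
  have -> : dl ^+ 3 * (G0 * N * (nearC a * Mb)) = dl ^+ 2 * ((G0 * N) * (dl * (nearC a * Mb))) by ring.
  rewrite normrM ger0_norm ?sqr_ge0// ler_wpM2l ?sqr_ge0//.
  rewrite normrM; apply: ler_pM => //; apply: le_trans near _.
  by rewrite ler_wpM2r ?mulr_ge0// expr2 ler_piMl// ltW.
rewrite ger0_norm ?invr_ge0 ?(ltW (SS0 x))//.
have -> : 2 / c = (c / 2)^-1 by field; rewrite gt_eqF.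
by rewrite lef_pV2 ?posrE// divr_gt0.
Qed.

End ChainRegularity.

(** * Spectral and tail estimates for the chain *)

Section Levels.
Context {R : realType} {d : nat}.
Variable dl : R.
Implicit Types (s : {ffun 'I_d -> bool}) (i : 'I_d) (x y : 'rV[R]_d) (F : 'rV[R]_d -> R).

(* The points that the walk can reach from 0 in exactly [k] steps. *)
Definition site k (j : {ffun 'I_d -> 'I_k.+1}) : 'rV[R]_d :=
  \row_i (dl * ((j i : nat).*2%:R - k%:R)).

Lemma step_proof k (m : 'I_k.+1) (b : bool) : (m + b < k.+2)%N.
Proof. by case: b; rewrite ?addn1 ?addn0 ltnS ?ltn_ord// ltnW. Qed.

Definition nb k (s : {ffun 'I_d -> bool}) (j : {ffun 'I_d -> 'I_k.+1}) : {ffun 'I_d -> 'I_k.+2} :=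
  [ffun i => Ordinal (step_proof (j i) (s i))].

Lemma nb_inj k s : injective (@nb k s).
Proof.
move=> j j' /ffunP E; apply/ffunP => i; apply: val_inj.
by have := E i; rewrite !ffunE => /(congr1 val) /= /eqP; rewrite eqn_add2r => /eqP.
Qed.

Lemma site_nb k s (j : {ffun 'I_d -> 'I_k.+1}) : site (nb s j) = site j + dl *: sg s.
Proof.
apply/rowP => i; rewrite !mxE ffunE /= -mulrDr; congr (_ * _).
by case: (s i); rewrite /sgn ?addn1 ?addn0 ?doubleS -!natr1; ring.
Qed.

Lemma sum_inj_le (A B : finType) (h : A -> B) (G : B -> R) : injective h ->
  (forall b, 0 <= G b) -> \sum_a G (h a) <= \sum_b G b.
Proof.
move=> hi G0; rewrite [leRHS](bigID (mem (h @: [set: A]%SET)))/=.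
have -> : \sum_(b in h @: [set: A]%SET) G b = \sum_a G (h a).
  rewrite big_imset /=; last by move=> x y _ _; exact: hi.
  by apply: eq_bigl => x; rewrite inE.
by rewrite lerDl; apply: sumr_ge0.
Qed.

Lemma sum_inj_eq (A B : finType) (h : A -> B) (G : B -> R) : injective h ->
  (forall b, (forall a, h a <> b) -> G b = 0) -> \sum_a G (h a) = \sum_b G b.
Proof.
move=> hi G0; rewrite [RHS](bigID (mem (h @: [set: A]%SET)))/=.
have -> : \sum_(b in h @: [set: A]%SET) G b = \sum_a G (h a).
  rewrite big_imset /=; last by move=> x y _ _; exact: hi.
  by apply: eq_bigl => x; rewrite inE.
rewrite [X in _ + X]big1 ?addr0// => b /negP hb; apply: G0 => a ha; apply: hb.
by rewrite -ha; apply: imset_f; rewrite inE.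
Qed.

Definition S0 F x : R := 2 ^- d * \sum_s F (x + dl *: sg s).

(** Binomial weight of the predecessor of [m]; the value 0 at [m = 0] makes Pascal's rule hold there
    too. *)
Definition binc (n m : nat) (b : bool) : R :=
  if b then (if m is m'.+1 then 'C(n, m')%:R else 0) else 'C(n, m)%:R.

Lemma binc_sum n m : binc n m true + binc n m false = 'C(n.+1, m)%:R.
Proof.
by case: m => [|m] /=; rewrite /binc ?bin0 ?add0r// binS natrD addrC.
Qed.

Definition pmf n (j : {ffun 'I_d -> 'I_n.+1}) : R := \prod_i ('C(n, j i)%:R / 2 ^+ n).

Lemma iter_S0 n F : iter n S0 F 0 = \sum_(j : {ffun 'I_d -> 'I_n.+1}) pmf j * F (site j).
Proof.
elim: n F => [|n IH] F.
  rewrite /= (bigD1 [ffun => ord0])//= big1 ?addr0 => [|j /eqP ne]; last first.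
    by case: ne; apply/ffunP => i; rewrite ffunE; exact: ord1.
  rewrite /pmf big1 ?mul1r => [|i _]; last by rewrite ffunE bin0 expr0 divr1.
  by congr F; apply/rowP => i; rewrite !mxE ffunE /= subr0 mulr0.
rewrite iterSr IH /S0.
have -> : \sum_(j : {ffun 'I_d -> 'I_n.+1}) pmf j * (2 ^- d * \sum_s F (site j + dl *: sg s)) =
  \sum_s \sum_(j : {ffun 'I_d -> 'I_n.+1}) 2 ^- d * pmf j * F (site (nb s j)).
  rewrite exchange_big; apply: eq_bigr => j _; rewrite !mulr_sumr; apply: eq_bigr => s _.
  by rewrite site_nb; ring.
have -> : \sum_s \sum_(j : {ffun 'I_d -> 'I_n.+1}) 2 ^- d * pmf j * F (site (nb s j)) =
  \sum_(s : {ffun 'I_d -> bool}) \sum_(j : {ffun 'I_d -> 'I_n.+2})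
     2 ^- d * (\prod_i (binc n (j i) (s i) / 2 ^+ n)) * F (site j).
  apply: eq_bigr => s _; rewrite -(sum_inj_eq (@nb_inj n s)) /=.
    apply: eq_bigr => j _; congr (_ * _ * _); apply: eq_bigr => i _; congr (_ / _).
    by rewrite ffunE /binc /=; case: (s i); rewrite ?addn1 ?addn0.
  move=> j hj.
  suff [i hi] : exists i, binc n (j i) (s i) = 0.
    by rewrite (bigD1 i)//= hi mul0r mul0r mulr0 mul0r.
  (* If all weights were nonzero, subtracting the step coordinatewise would give a predecessor of
     [j]. *)
  apply: contrapT => /forallNP H; apply: (hj [ffun i => inord (j i - s i)]).
  apply/ffunP => i; apply: val_inj; rewrite !ffunE /=.
  have := H i; rewrite /binc; case: (s i) => /=.
    case: (j i) => -[|m] mn //= Hm; rewrite ?subn1 ?addn1 /=.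
    by rewrite inordK.
  rewrite subn0 addn0 => Hm; rewrite inordK//.
  rewrite ltnS leqNgt; apply/negP => /bin_small E; by case: Hm; rewrite E.
rewrite exchange_big; apply: eq_bigr => j _ /=.
rewrite -mulr_suml -mulr_sumr; congr (_ * _).
rewrite -(bigA_distr_bigA (fun i b => binc n (j i) b / 2 ^+ n)) /pmf.
rewrite -[2 ^- d]exprVn -{1}[d]card_ord -prodr_const -big_split /=; apply: eq_bigr => i _.
rewrite big_bool /= -mulrDl binc_sum exprS; field.
by rewrite expf_neq0// pnatr_eq0.
Qed.

Lemma sum_binsq n : \sum_(m < n.+1) ('C(n, m)%:R / 2 ^+ n) ^+ 2 = 'C(n.*2, n)%:R / 4 ^+ n :> R.
Proof.
rewrite -addnn -binomial.Vandermonde natr_sum mulr_suml; apply: eq_bigr => m _.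
have mn : (m <= n)%N by rewrite -ltnS.
rewrite bin_sub// natrM exprMn expr2; congr (_ * _).
have -> : (4 : R) = 2 ^+ 2 by rewrite -natrX.
by rewrite exprVn -!exprM mulnC.
Qed.

(** The factor [2 n + 1] closes the induction because [(2 n + 1) (2 n + 3) <= 4 (n + 1)^2]. At
    [n = M^2] it gives the bound [1 / M] per coordinate. *)
Lemma central_bin n : ('C(n.*2, n) ^ 2 * n.*2.+1 <= 16 ^ n)%N.
Proof.
elim: n => [//|n IH].
have E : (n.+1 * 'C(n.+1.*2, n.+1) = 2 * n.*2.+1 * 'C(n.*2, n))%N.
  have sym : ('C(n.*2.+1, n.+1) = 'C(n.*2.+1, n))%N.
    rewrite -bin_sub -addnn; last by rewrite ltnS leq_addl.
    by rewrite subSS addnK.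
  have e1 : ('C(n.+1.*2, n.+1) = 2 * 'C(n.*2.+1, n))%N.
    by rewrite doubleS binS sym addnn mul2n.
  have e2 : (n.+1 * 'C(n.*2.+1, n) = n.*2.+1 * 'C(n.*2, n))%N.
    by rewrite -sym -mul_bin_diag.
  by rewrite e1 mulnCA e2 mulnA.
have H : (n.+1 ^ 2 * ('C(n.+1.*2, n.+1) ^ 2 * n.+1.*2.+1) <= n.+1 ^ 2 * 16 ^ n.+1)%N.
  rewrite mulnA -expnMn E !expnMn expnS.
  have h : (n.*2.+1 * n.+1.*2.+1 <= 4 * n.+1 ^ 2)%N by rewrite -!mul2n; nia.
  apply: (@leq_trans (4 * (n.*2.+1 * n.+1.*2.+1) * ('C(n.*2, n) ^ 2 * n.*2.+1))%N).
    by rewrite leq_eqVlt; apply/orP; left; apply/eqP; ring.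
  apply: (@leq_trans (4 * (4 * n.+1 ^ 2) * 16 ^ n)%N).
    by apply: leq_mul => //; rewrite leq_mul2l.
  by rewrite leq_eqVlt; apply/orP; left; apply/eqP; rewrite (expnS 16 n); ring.
by rewrite leq_pmul2l in H.
Qed.

End Levels.

(** * Heat kernel bound and weighted L^2 contraction *)

Section Spectral.
Context {R : realType} {d : nat}.
Implicit Types (s : {ffun 'I_d -> bool}) (i : 'I_d) (x y : 'rV[R]_d) (F f g : 'rV[R]_d -> R).

Lemma sum_pmfsq n : \sum_(j : {ffun 'I_d -> 'I_n.+1}) (pmf j) ^+ 2 = ('C(n.*2, n)%:R / 4 ^+ n) ^+ d :> R.
Proof.
rewrite -sum_binsq -[in RHS](card_ord d) -prodr_const (bigA_distr_bigA (fun _ m => _)).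
by apply: eq_bigr => j _; rewrite /pmf -prodrXl.
Qed.

Lemma central_bin_le (M : nat) : (0 < M)%N ->
  'C((M ^ 2).*2, M ^ 2)%:R / 4 ^+ (M ^ 2) <= M%:R^-1 :> R.
Proof.
move=> M0; set n := (M ^ 2)%N; have Mp : (0 : R) < M%:R by rewrite ltr0n.
rewrite ler_pdivrMr ?exprn_gt0// mulrC ler_pdivlMr//.
rewrite -natrX -natrM ler_nat -leq_sqr expnMn.
apply: (@leq_trans ('C(n.*2, n) ^ 2 * n.*2.+1)%N).
  by rewrite leq_mul2l -/n; apply/orP; right; rewrite -addnn; lia.
have -> : ((4 ^ n) ^ 2 = 16 ^ n)%N by rewrite -expnM mulnC expnM.
exact: central_bin.
Qed.

(** Cauchy-Schwarz with a free [tau] in place of square roots. For the mesh [1 / M], [M^2] steps are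
    one unit of time, after which the squared l^2 norm of the law of the simple walk is at most
    [M^-d]. *)
Lemma S0_cauchy (dl : R) (M : nat) F (tau : R) : (0 < M)%N -> 0 < tau ->
  iter (M ^ 2) (S0 dl) F 0 <=
  (tau * M%:R^-1 ^+ d + tau^-1 * \sum_(j : {ffun 'I_d -> 'I_(M ^ 2).+1}) F (site dl j) ^+ 2) / 2.
Proof.
move=> M0 t0; rewrite iter_S0.
have H : \sum_(j : {ffun 'I_d -> 'I_(M ^ 2).+1}) (pmf j) ^+ 2 <= M%:R^-1 ^+ d :> R.
  rewrite sum_pmfsq lerXn2r ?nnegrE ?invr_ge0 ?divr_ge0 ?exprn_ge0//.
  exact: central_bin_le.
apply: (@le_trans _ _ ((tau * (\sum_(j : {ffun 'I_d -> 'I_(M ^ 2).+1}) (pmf j) ^+ 2)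
  + tau^-1 * \sum_(j : {ffun 'I_d -> 'I_(M ^ 2).+1}) F (site dl j) ^+ 2) / 2)); last first.
  by rewrite ler_pM2r// lerD2r ler_pM2l.
rewrite !mulr_sumr -big_split mulr_suml; apply: ler_sum => j _ /=.
set p := pmf j; set w := F _.
have : 0 <= tau^-1 * (tau * p - w) ^+ 2 by rewrite mulr_ge0 ?sqr_ge0// invr_ge0 ltW.
have -> : tau^-1 * (tau * p - w) ^+ 2 = tau * p ^+ 2 + tau^-1 * w ^+ 2 - 2 * (p * w).
  by field; rewrite gt_eqF.
by lra.
Qed.

Variables (a : 'rV[R]_d) (dl q : R) (psi : 'rV[R]_d -> R).
Hypotheses (dl0 : 0 < dl) (dl1 : dl <= 1) (q0 : 0 < q).
Hypothesis psi_pos : forall x, 0 < psi x.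
Hypothesis psi_q : forall x y, q <= psi x * psi y.
Hypothesis psi_q' : forall x y, psi x * psi y <= q^-1.

Local Notation Q := (Qop a dl psi).

Definition Ee (x : 'rV[R]_d) : R := expR (dotr a x).

(** Row sums of the symmetric kernel [2^-d Ee x psi x Ee y psi y]: the reversible measure of [Q]. *)
Definition revm (x : 'rV[R]_d) : R := Ee x ^+ 2 * psi x * SS a dl psi x.

(** Finite sums suffice: values of [Q f] at level [k] are computed from values of [f] at level
    [k + 1]. *)
Definition nrm k f : R := \sum_(j : {ffun 'I_d -> 'I_k.+1}) revm (site dl j) * f (site dl j) ^+ 2.

(** The excess of mass [dl^2 |a|^2 / 8] relative to the total mass: [q] bounds the products
    [psi x * psi y] from below and [q^-1] from above, whence [q^2]; the denominator absorbs [cc]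
    itself. *)
Definition kap : R := q ^+ 2 * dotr a a / (8 + dotr a a).

Lemma dotr_ge0 : 0 <= dotr a a.
Proof. by apply: sumr_ge0 => i _; rewrite -expr2 sqr_ge0. Qed.

Lemma SS_psi_gt0 x : 0 < SS a dl psi x.
Proof.
rewrite /SS (bigD1 [ffun => true])//= ltr_pwDl//.
  by apply: mulr_gt0 => //; exact: wt_gt0.
by apply: sumr_ge0 => s _; rewrite mulr_ge0 ?wt_ge0// ltW.
Qed.

Lemma Ee_step x s : Ee x * wt a dl s = 2 ^- d * Ee (x + dl *: sg s).
Proof. by rewrite /Ee /wt dotrDr dotrZr expRD; ring. Qed.

Lemma q_le1 : q ^+ 2 <= 1.
Proof.
have := le_trans (psi_q 0 0) (psi_q' 0 0); rewrite -(ler_pM2r q0) mulVf ?gt_eqF//.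
Qed.

Lemma kap_ge0 : 0 <= kap.
Proof. by have := dotr_ge0 => h; rewrite /kap; nneg. Qed.

Lemma kap_lt1 : kap < 1.
Proof.
have h := dotr_ge0; have q1 := q_le1; rewrite /kap ltr_pdivrMr; last by rewrite ltr_pwDl.
rewrite mul1r; apply: (@le_lt_trans _ _ (dotr a a)); last by rewrite ltrDr.
by rewrite ler_piMl.
Qed.

Lemma rho_gt0 : 0 < 1 - kap * dl ^+ 2.
Proof.
rewrite subr_gt0; apply: le_lt_trans kap_lt1; rewrite ler_piMr ?kap_ge0//.
by rewrite expr_le1// ltW.
Qed.

Lemma revm_gap x : revm x - q * (cc a dl - 1) * Ee x ^+ 2 <= (1 - kap * dl ^+ 2) * revm x.
Proof.
rewrite mulrBl mul1r lerB//.
have h := dotr_ge0; set A := dotr a a in h *.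
have E0 : 0 <= Ee x ^+ 2 := sqr_ge0 _.
have hc : 1 + dl ^+ 2 * A / 8 <= cc a dl := cc_ge a dl.
have p1 : revm x <= Ee x ^+ 2 * (q^-1 * cc a dl).
  rewrite /revm -mulrA ler_wpM2l// /SS mulr_sumr /cc mulr_sumr; apply: ler_sum => s _.
  by rewrite mulrCA mulrC ler_wpM2r ?wt_ge0.
have k0 : 0 <= kap * dl ^+ 2 by rewrite mulr_ge0 ?kap_ge0 ?sqr_ge0.
apply: le_trans (ler_wpM2l k0 p1) _.
have -> : kap * dl ^+ 2 * (Ee x ^+ 2 * (q^-1 * cc a dl)) =
   (q * (dl ^+ 2 * A / (8 + A) * cc a dl)) * Ee x ^+ 2.
  by rewrite /kap -/A; field; rewrite !gt_eqF// ltr_pwDl.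
rewrite ler_wpM2r// ler_pM2l//.
set w := dl ^+ 2 * A / (8 + A).
have d2 : dl ^+ 2 <= 1 by rewrite expr_le1// ltW.
have d20 : 0 <= dl ^+ 2 := sqr_ge0 _.
have w1 : w * (8 + A) = dl ^+ 2 * A by rewrite /w divfK// gt_eqF// ltr_pwDl.
have w0 : 0 <= w by rewrite /w; nneg.
have w2 : w * (8 + dl ^+ 2 * A) <= dl ^+ 2 * A.
  by rewrite -{2}w1 ler_wpM2l// lerD2l ler_piMl.
have wl1 : w <= 1.
  rewrite /w ler_pdivrMr ?ltr_pwDl// mul1r; apply: (@le_trans _ _ A); first by rewrite ler_piMl.
  by rewrite lerDr.
have : (1 - w) * (1 + dl ^+ 2 * A / 8) <= (1 - w) * cc a dl.
  by rewrite ler_wpM2l// subr_ge0.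
have -> : (1 - w) * (1 + dl ^+ 2 * A / 8) = 1 + (dl ^+ 2 * A - w * (8 + dl ^+ 2 * A)) / 8 by field.
by lra.
Qed.

(** Schur test with two sets of weights. The factor [psi x * psi y] of the kernel is split into
    [psi x * psi y - q], tested with constant weights, and the constant [q], tested with the weights
    [Ee]. For the second part the row sum is [Ee x ^ 2] instead of [cc * Ee x ^ 2]; by [revm_gap]
    this saves at least the fraction [kap dl^2] of [revm]. *)
Lemma nrm_step k f : nrm k (Q f) <= (1 - kap * dl ^+ 2) ^+ 2 * nrm k.+1 f.
Proof.
set rho := 1 - _; have r0 : 0 < rho := rho_gt0.
pose z s := dl *: sg s : 'rV[R]_d.
pose U s x := (2 * rho)^-1 * Q f x ^+ 2 *
  (Ee x ^+ 2 * wt a dl s * (psi x * psi (x + z s) - q) + q * 2 ^- d * Ee x ^+ 2).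
pose V s y := rho / 2 * f y ^+ 2 *
  (2 ^- d * Ee y * Ee (y - z s) * (psi (y - z s) * psi y - q) + q * 2 ^- d * Ee y ^+ 2).
have d2 : (0 : R) <= 2 ^- d by rewrite invr_ge0 exprn_ge0.
have V0 s y : 0 <= V s y.
  have := psi_q (y - z s) y; rewrite -subr_ge0 => h.
  by rewrite /V /Ee; nneg.
have T s x : Ee x ^+ 2 * psi x * (wt a dl s * (psi (x + z s) * f (x + z s))) * Q f x
    <= U s x + V s (x + z s).
  set y := x + z s; have yz : y - z s = x by rewrite /y addrK.
  rewrite /U /V yz -/y.
  have hw : Ee x ^+ 2 * wt a dl s = 2 ^- d * Ee x * Ee y.
    by rewrite expr2 -mulrA Ee_step; rewrite /y; ring.
  have -> : Ee x ^+ 2 * psi x * (wt a dl s * (psi y * f y)) * Q f x =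
    (Ee x ^+ 2 * wt a dl s) * (psi x * psi y * (f y * Q f x)) by ring.
  rewrite hw; set g := Q f x; set w := f y.
  have h1 : 0 <= psi x * psi y - q by rewrite subr_ge0.
  have e1 : 0 <= Ee x := expR_ge0 _; have e2 : 0 <= Ee y := expR_ge0 _.
  (* The two Young inequalities, written as squares with the common parameter [rho]; together with
     the factor from [revm_gap] it produces [rho^2]. *)
  have a1 : 0 <= 2 ^- d * Ee x * Ee y * (psi x * psi y - q) * ((g - rho * w) ^+ 2 / (2 * rho)).
    by have r00 := ltW r0; nneg.
  have a2 : 0 <= q * 2 ^- d * ((Ee x * g - rho * Ee y * w) ^+ 2 / (2 * rho)).
    by have r00 := ltW r0; have q00 := ltW q0; nneg.
  rewrite -subr_ge0; apply: le_trans (addr_ge0 a1 a2) _; rewrite le_eqVlt; apply/orP; left; apply/eqP.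
  by move: (2 ^- d) => D; field; rewrite gt_eqF.
have SU x : \sum_s U s x <= (revm x * Q f x ^+ 2) / 2.
  have -> : \sum_s U s x = (2 * rho)^-1 * Q f x ^+ 2 * (revm x - q * (cc a dl - 1) * Ee x ^+ 2).
    rewrite -mulr_sumr; congr (_ * _); rewrite big_split /= sum_cst_signs.
    have -> : \sum_s Ee x ^+ 2 * wt a dl s * (psi x * psi (x + z s) - q) =
       revm x - q * cc a dl * Ee x ^+ 2.
      rewrite /revm /SS /cc mulr_sumr mulr_sumr mulr_suml -sumrB; apply: eq_bigr => s _.
      by rewrite /z; ring.
    have -> : 2 ^+ d * (q * 2 ^- d * Ee x ^+ 2) = q * Ee x ^+ 2 * (2 ^- d * 2 ^+ d) by ring.
    rewrite mulVf ?expf_neq0 ?pnatr_eq0//; ring.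
  have g0 : 0 <= (2 * rho)^-1 * Q f x ^+ 2 by have r00 := ltW r0; nneg.
  apply: le_trans (ler_wpM2l g0 (revm_gap x)) _; rewrite -/rho le_eqVlt; apply/orP; left; apply/eqP.
  by field; rewrite gt_eqF.
have SV y : \sum_s V s y <= rho ^+ 2 / 2 * (revm y * f y ^+ 2).
  rewrite -big_flip /=.
  have -> : \sum_s V (flip s) y = rho / 2 * f y ^+ 2 * (revm y - q * (cc a dl - 1) * Ee y ^+ 2).
    rewrite -mulr_sumr; congr (_ * _); rewrite big_split /= sum_cst_signs.
    have -> : \sum_s 2 ^- d * Ee y * Ee (y - z (flip s)) * (psi (y - z (flip s)) * psi y - q) =
       revm y - q * cc a dl * Ee y ^+ 2.
      rewrite /revm /SS /cc mulr_sumr mulr_sumr mulr_suml -sumrB; apply: eq_bigr => s _.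
      have -> : y - z (flip s) = y + dl *: sg s by rewrite /z sg_flip scalerN opprK.
      have hw : Ee y ^+ 2 * wt a dl s = 2 ^- d * Ee y * Ee (y + dl *: sg s).
        by rewrite expr2 -mulrA Ee_step; ring.
      by rewrite -hw; ring.
    have -> : 2 ^+ d * (q * 2 ^- d * Ee y ^+ 2) = q * Ee y ^+ 2 * (2 ^- d * 2 ^+ d) by ring.
    rewrite mulVf ?expf_neq0 ?pnatr_eq0//; ring.
  have g0 : 0 <= rho / 2 * f y ^+ 2 by have r00 := ltW r0; nneg.
  apply: le_trans (ler_wpM2l g0 (revm_gap y)) _; rewrite -/rho le_eqVlt; apply/orP; left; apply/eqP.
  by field.
have main : nrm k (Q f) <= nrm k (Q f) / 2 + rho ^+ 2 / 2 * nrm k.+1 f.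
  have E : nrm k (Q f) = \sum_(j : {ffun 'I_d -> 'I_k.+1}) \sum_s
     Ee (site dl j) ^+ 2 * psi (site dl j) *
       (wt a dl s * (psi (site dl j + z s) * f (site dl j + z s))) * Q f (site dl j).
    apply: eq_bigr => j _; set x := site dl j.
    rewrite -mulr_suml -mulr_sumr /revm expr2 mulrA; congr (_ * _); rewrite -!mulrA.
    congr (_ * (_ * (_ * _))); rewrite /Qop mulrC divfK// gt_eqF// SS_psi_gt0//.
  rewrite {1}E; apply: (@le_trans _ _ (\sum_(j : {ffun 'I_d -> 'I_k.+1}) \sum_s U s (site dl j)
     + \sum_s \sum_(j : {ffun 'I_d -> 'I_k.+1}) V s (site dl (nb s j)))).
    rewrite [X in _ <= _ + X]exchange_big -big_split; apply: ler_sum => j _ /=.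
    by rewrite -big_split; apply: ler_sum => s _; rewrite site_nb; exact: T.
  apply: lerD.
    by rewrite /nrm mulr_suml; apply: ler_sum => j _; exact: SU.
  apply: (@le_trans _ _ (\sum_s \sum_(j : {ffun 'I_d -> 'I_k.+2}) V s (site dl j))).
    apply: ler_sum => s _; apply: (sum_inj_le (G := fun j => V s (site dl j)) (@nb_inj d k s)).
    by move=> j; exact: V0.
  by rewrite exchange_big /nrm mulr_sumr; apply: ler_sum => j _; exact: SV.
by lra.
Qed.

Lemma nrm_iter m k f : nrm k (iter m Q f) <= (1 - kap * dl ^+ 2) ^+ (m.*2) * nrm (k + m) f.
Proof.
elim: m k => [|m IH] k; first by rewrite expr0 mul1r addn0.
apply: le_trans (nrm_step _ _) _.
set rho := 1 - _.
have -> : rho ^+ m.+1.*2 = rho ^+ 2 * rho ^+ m.*2 by rewrite doubleS -addn2 addnC exprD.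
rewrite -[rho ^+ 2 * rho ^+ _ * _]mulrA; apply: ler_wpM2l; first exact: sqr_ge0.
by rewrite -addSnnS; exact: IH.
Qed.

End Spectral.

Section GeometricSum.
Context {R : realType}.

(** The values [2 m - k] run over [-k, -k + 2, ..., k]: removing both ends leaves the sum for
    [k - 2], so the induction goes by two. The sharper bound in the proof makes room for the two
    removed terms. *)
Lemma geo_sum_le (u : R) k : 0 < u ->
  \sum_(m < k.+1) expR (- (u * `|m.*2%:R - k%:R|)) <= 2 / (1 - expR (- u)).
Proof.
move=> u0; set r := expR (- u).
have r0 : 0 < r by exact: expR_gt0.
have r1 : r < 1 by rewrite expR_lt1 oppr_lt0.
have rn n : expR (- (u * n%:R)) = r ^+ n by rewrite -mulNr mulrC expRM_natl.
suff H : \sum_(m < k.+1) expR (- (u * `|m.*2%:R - k%:R|)) <= 2 * (1 - r ^+ k.+1) / (1 - r).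
  apply: le_trans H _; rewrite ler_pM2r ?invr_gt0 ?subr_gt0// ler_piMr// gerBl.
  by rewrite exprn_ge0// ltW.
have p1 : 0 < 1 - r by rewrite subr_gt0.
elim/ltn_ind: k => -[|[|k]] IH.
- rewrite big_ord_recl big_ord0 addr0 /= subrr normr0 mulr0 oppr0 expR0 expr1 mulfK ?gt_eqF//.
  by rewrite ler1n.
- rewrite big_ord_recl big_ord_recl big_ord0 addr0 /= sub0r normrN normr1 mulr1.
  have -> : `|2 - 1 : R| = 1 by rewrite (_ : 2 - 1 = 1 :> R) ?normr1//; ring.
  rewrite mulr1 -/r ler_pdivlMr// expr2; nra.
have := IH k (leqnSn _); set a := \sum_(m < k.+1) _ => Ha.
rewrite big_ord_recl big_ord_recr /=.
have -> : \sum_(i < k.+1) expR (- (u * `|(bump 0 (widen_ord (leqnSn k.+1) i)).*2%:R - k.+2%:R|)) = a.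
  apply: eq_bigr => i _; congr (expR (- (u * `|_|))).
  by rewrite /bump /= add1n doubleS -!natr1; ring.
have -> : `|0.*2%:R - k.+2%:R| = k.+2%:R :> R by rewrite double0 sub0r normrN normr_nat.
have -> : `|(bump 0 k.+1).*2%:R - k.+2%:R| = k.+2%:R :> R.
  by rewrite /bump /= add1n -addnn natrD addrK normr_nat.
rewrite !rn addrCA; apply: le_trans (lerD Ha (lexx _)) _.
rewrite -lerBrDl -mulrBl ler_pdivlMr//.
have -> : 2 * (1 - r ^+ k.+3) - 2 * (1 - r ^+ k.+1) = 2 * (r ^+ k.+1 * (1 - r ^+ 2)).
  by rewrite -[k.+3]addn2 exprD; ring.
have -> : (r ^+ k.+2 + r ^+ k.+2) * (1 - r) = 2 * (r ^+ k.+1 * (r * (1 - r))).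
  by rewrite [r ^+ k.+2]exprSr; ring.
rewrite ler_pM2l// ler_pM2l ?exprn_gt0//; nra.
Qed.

Lemma geo_bound (u : R) : 0 < u -> u <= 1 -> 2 / (1 - expR (- u)) <= 4 / u.
Proof.
move=> u0 u1; have h : expR (- u) <= (1 + u)^-1.
  by rewrite expRN lef_pV2 ?posrE ?expR_gt0 ?expR_ge1Dx// ltr_pwDl// ltW.
have p : 0 < 1 + u by rewrite ltr_pwDl// ltW.
have h2 : u / 2 <= 1 - expR (- u).
  have : (1 + u)^-1 <= 1 - u / 2.
    rewrite invf_ple ?posrE//; last by lra.
    rewrite -[leLHS]mul1r ler_pdivrMr; last by lra.
    by nra.
  by lra.
have -> : 4 / u = 2 / (u / 2) by field; rewrite gt_eqF.
by rewrite ler_pM2l// lef_pV2 ?posrE// ?divr_gt0//; apply: lt_le_trans h2; rewrite divr_gt0.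
Qed.

End GeometricSum.

(** * Comparison with the simple walk and exponential moments *)

Section ChainTail.
Context {R : realType} {d : nat}.
Implicit Types (s : {ffun 'I_d -> bool}) (i : 'I_d) (x y v w : 'rV[R]_d) (F f g : 'rV[R]_d -> R).

Lemma S0_mono (dl : R) n F g x : (forall y, F y <= g y) -> iter n (S0 dl) F x <= iter n (S0 dl) g x.
Proof.
move=> H; elim: n x => [//|n IH] x /=; rewrite ler_wpM2l ?invr_ge0 ?exprn_ge0//.
by apply: ler_sum => s _; exact: IH.
Qed.

Lemma S0_scale (dl : R) n F (k : R) : iter n (S0 dl) (fun y => k * F y) = (fun x => k * iter n (S0 dl) F x).
Proof.
elim: n => [//|n IH] /=; apply/funext => x; rewrite IH /S0 -mulr_sumr; ring.
Qed.

Lemma S0_exp (I : finType) (dl : R) n (v : I -> 'rV[R]_d) :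
  iter n (S0 dl) (fun y => \sum_i expR (dotr (v i) y)) =
  (fun x => \sum_i cc (v i) dl ^+ n * expR (dotr (v i) x)).
Proof.
elim: n => [|n IH] /=; apply/funext => x; first by apply: eq_bigr => i _; rewrite expr0 mul1r.
rewrite IH /S0 exchange_big /= mulr_sumr; apply: eq_bigr => i _.
have E : 2 ^- d * (\sum_s expR (dotr (v i) (x + dl *: sg s))) = cc (v i) dl * expR (dotr (v i) x).
  rewrite /cc mulr_suml mulr_sumr; apply: eq_bigr => s _.
  by rewrite dotrDr dotrZr expRD /wt; ring.
by rewrite -mulr_sumr mulrCA E exprS; ring.
Qed.

Variables (a : 'rV[R]_d) (c Lp Kp dl : R) (psi : 'rV[R]_d -> R).
Hypotheses (c0 : 0 < c) (L0 : 0 <= Lp) (K0 : 0 <= Kp).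
Hypothesis W : weight c c^-1 Lp Kp psi.
Hypotheses (dl0 : 0 < dl) (dla : dl * norm1 a <= 1).
Local Notation c1 := (driftC a c c^-1 Lp Kp).
Hypothesis dlc : dl ^+ 2 * c1 <= 1 / 2.
Local Notation Q := (Qop a dl psi).

Definition DD : R := (1 - dl ^+ 2 * c1)^-1.

Lemma DD_pos : 0 < 1 - dl ^+ 2 * c1.
Proof. by move: dlc; set w := _ * c1; lra. Qed.

Lemma DD_gt0 : 0 < DD. Proof. by rewrite invr_gt0 DD_pos. Qed.

Lemma c1_ge0 : 0 <= c1. Proof. exact: driftC_ge0 W. Qed.

Lemma DD_le2 : DD <= 2.
Proof.
have := DD_pos; have := c1_ge0; move: dlc; rewrite /DD; set w := _ * c1 => h1 h2 h3.
by rewrite invf_ple ?posrE//; lra.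
Qed.

Lemma DDn_le n : DD ^+ n <= expR (2 * c1 * (n%:R * dl ^+ 2)).
Proof.
have -> : 2 * c1 * (n%:R * dl ^+ 2) = n%:R * (2 * (dl ^+ 2 * c1)) by ring.
rewrite expRM_natl; apply: lerXn2r; rewrite ?nnegrE ?expR_ge0 ?(ltW DD_gt0)//.
have h2 : 0 <= dl ^+ 2 * c1 by rewrite mulr_ge0 ?sqr_ge0 ?c1_ge0.
apply: le_trans (expR_ge1Dx _).
move: dlc h2 DD_pos; rewrite /DD; set w := _ * c1 => h1 h2 h3.
rewrite -[leLHS]mul1r ler_pdivrMr//; nra.
Qed.

(** Conjugation by [psi * Ee a] turns [Q] into the simple walk [S0] times the factor [psi / SS psi],
    which is at most [DD]. By [DDn_le] the power of [DD] stays bounded as long as [n dl^2] does. *)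
Lemma chain_le_walk n g x : (forall y, 0 <= g y) ->
  iter n Q g x <= DD ^+ n * ((psi x * Ee a x)^-1 * iter n (S0 dl) (fun y => psi y * Ee a y * g y) x).
Proof.
move=> g0; have P0 y : 0 < psi y * Ee a y by rewrite mulr_gt0 ?expR_gt0 ?(psi_gt0 c0 W).
elim: n x => [|n IH] x.
  by rewrite expr0 mul1r /= mulKf// gt_eqF.
rewrite [iter n.+1 Q g]iterS.
have SP : 0 < SS a dl psi x by exact: (SSpsi_gt0 c0 L0 K0 W dl0 dla dlc).
set h := fun y => DD ^+ n * ((psi y * Ee a y)^-1 * iter n (S0 dl) (fun y => psi y * Ee a y * g y) y).
apply: (@le_trans _ _ (Q h x)).
  exact: (Q_mono c0 L0 K0 W dl0 dla dlc).
have E : SS a dl (fun y => psi y * h y) x =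
   DD ^+ n * ((Ee a x)^-1 * iter n.+1 (S0 dl) (fun y => psi y * Ee a y * g y) x).
  rewrite iterS /S0 /SS !mulr_sumr; apply: eq_bigr => s _; rewrite /h.
  set y := x + _; set I := iter n _ _ y.
  have wE : wt a dl s = 2 ^- d * Ee a y * (Ee a x)^-1.
    by rewrite -(Ee_step) mulrC mulKf// gt_eqF// expR_gt0.
  rewrite wE; have e1 : Ee a y != 0 by rewrite gt_eqF// expR_gt0.
  have e2 : psi y != 0 by rewrite gt_eqF// (psi_gt0 c0 W).
  have e3 : Ee a x != 0 by rewrite gt_eqF// expR_gt0.
  move: (2 ^- d) (DD ^+ n) => D1 D2; field; rewrite e1 e2 e3//.
rewrite /Qop E.
set J := iter n.+1 _ _ x.
have J0 : 0 <= J.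
  rewrite /J; elim: (n.+1) x {SP h E J} => [|m IHm] x /=; first by rewrite mulr_ge0// ltW.
  by rewrite mulr_ge0 ?invr_ge0 ?exprn_ge0// sumr_ge0// => s _; exact: IHm.
clearbody J.
have Sge : (SS a dl psi x)^-1 <= DD * (psi x)^-1.
  rewrite /DD -invfM lef_pV2 ?posrE ?mulr_gt0 ?DD_pos ?(psi_gt0 c0 W)//.
  exact: (SSpsi_ge c0 L0 K0 W dl0 dla).
rewrite exprSr -!mulrA ler_wpM2l ?exprn_ge0 ?(ltW DD_gt0)//.
rewrite invfM [leRHS](_ : _ = (Ee a x)^-1 * (J * (DD * (psi x)^-1))); last by ring.
rewrite ler_wpM2l ?invr_ge0 ?expR_ge0// ler_wpM2l//.
Qed.

(** Exponentials are eigenfunctions of [S0], and the factor [Ee a] of the conjugation shifts their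
    exponents from [v o] to [a + v o]. *)
Lemma chain_tail (I : finType) (v : I -> 'rV[R]_d) (k b : R) n g :
  (forall y, 0 <= g y) -> 0 <= k -> (forall y, g y <= k * \sum_o expR (dotr (v o) y)) ->
  (forall o, norm1 (a + v o) <= b) -> dl * b <= 1 ->
  iter n Q g 0 <= c^-1 ^+ 2 * k * #|I|%:R * expR ((2 * c1 + 2 * b ^+ 2) * (n%:R * dl ^+ 2)).
Proof.
move=> g0 k0 gk vb db; apply: le_trans (chain_le_walk n 0 g0) _.
have [W1 W2 _ _] := W.
have t0 : 0 <= n%:R * dl ^+ 2 by rewrite mulr_ge0 ?sqr_ge0.
have H : iter n (S0 dl) (fun y => psi y * Ee a y * g y) 0 <=
    (c^-1 * k) * \sum_o cc (a + v o) dl ^+ n.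
  apply: (@le_trans _ _ (iter n (S0 dl) (fun y => (c^-1 * k) * \sum_o expR (dotr (a + v o) y)) 0)).
    apply: S0_mono => y; rewrite -mulrA.
    have -> : c^-1 * k * \sum_o expR (dotr (a + v o) y) = c^-1 * (Ee a y * (k * \sum_o expR (dotr (v o) y))).
      by rewrite /Ee !mulr_sumr; apply: eq_bigr => o _; rewrite dotrDl expRD; ring.
    apply: ler_pM; rewrite ?mulr_ge0 ?expR_ge0//; first exact/ltW/(psi_gt0 c0 W).
    by rewrite ler_wpM2l ?expR_ge0.
  rewrite S0_scale S0_exp ler_wpM2l ?mulr_ge0 ?invr_ge0 ?(ltW c0)//.
  by apply: ler_sum => o _; rewrite dotr0 expR0 mulr1.
have cb o : cc (a + v o) dl ^+ n <= expR (2 * b ^+ 2 * (n%:R * dl ^+ 2)).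
  have b0 : 0 <= b by apply: le_trans (vb o); exact: norm1_ge0.
  have -> : 2 * b ^+ 2 * (n%:R * dl ^+ 2) = n%:R * (2 * (dl ^+ 2 * b ^+ 2)) by ring.
  rewrite expRM_natl; apply: lerXn2r; rewrite ?nnegrE ?expR_ge0//.
    by apply: sumr_ge0 => s _; exact: wt_ge0.
  apply: le_trans (cc_le dl0 _) _.
    by apply: le_trans db; rewrite ler_wpM2l// ltW.
  rewrite ler_expR ler_wpM2l// ler_wpM2l ?sqr_ge0//.
  apply: le_trans (ler_norm _) _; apply: le_trans (dotr_norm_le _ _) _.
  rewrite expr2; apply: ler_pM; rewrite ?norm1_ge0//; apply: le_trans (vb o).
  apply: norm_le_coord; first exact: norm1_ge0.
  by move=> j; rewrite /norm1 (bigD1 j)//= lerDl sumr_ge0.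
have psi1 : (psi 0 * Ee a 0)^-1 <= c^-1.
  by rewrite /Ee dotr0 expR0 mulr1 lef_pV2 ?posrE ?(psi_gt0 c0 W).
rewrite mulrDl expRD.
have -> : c^-1 ^+ 2 * k * #|I|%:R * (expR (2 * c1 * (n%:R * dl ^+ 2)) * expR (2 * b ^+ 2 * (n%:R * dl ^+ 2)))
  = expR (2 * c1 * (n%:R * dl ^+ 2)) * (c^-1 * ((c^-1 * k) * (#|I|%:R * expR (2 * b ^+ 2 * (n%:R * dl ^+ 2))))).
  by ring.
have S0p : 0 <= iter n (S0 dl) (fun y => psi y * Ee a y * g y) 0.
  elim: n {t0 H cb} (0 : 'rV[R]_d) => [|m IHm] x /=.
    by rewrite !mulr_ge0 ?expR_ge0// ltW// (psi_gt0 c0 W).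
  by rewrite mulr_ge0 ?invr_ge0 ?exprn_ge0// sumr_ge0// => s _; exact: IHm.
have pe0 : 0 <= (psi 0 * Ee a 0)^-1.
  by rewrite invr_ge0 mulr_ge0 ?expR_ge0// ltW// (psi_gt0 c0 W).
apply: ler_pM; rewrite ?exprn_ge0 ?(ltW DD_gt0)//; first by rewrite mulr_ge0.
  exact: DDn_le.
apply: ler_pM => //; apply: le_trans H _.
rewrite ler_wpM2l ?mulr_ge0 ?invr_ge0 ?(ltW c0)//.
by rewrite mulr_natl -sumr_const; apply: ler_sum => o _; exact: cb.
Qed.

Hypothesis dl1 : dl <= 1.

Lemma psi_q1 x y : c ^+ 2 <= psi x * psi y.
Proof. by have [W1 _ _ _] := W; rewrite expr2 ler_pM// ltW. Qed.

Lemma psi_q2 x y : psi x * psi y <= (c ^+ 2)^-1.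
Proof.
have [_ W2 _ _] := W; rewrite -exprVn expr2.
by apply: ler_pM; rewrite ?W2//; exact/ltW/(psi_gt0 c0 W).
Qed.

(** Decay in [norm1] factorises the sum over sites into one geometric sum per coordinate. The factor
    [(1 / dl)^d] reflects the density of the sites and is cancelled later by the heat kernel
    bound. *)
Lemma nrm_bound k f (th B : R) : 0 < th -> th * dl <= 1 ->
  (forall x, Ee a x ^+ 2 * f x ^+ 2 <= expR (B - th * norm1 x)) ->
  nrm a dl psi k f <= (c ^+ 2)^-1 * expR 2 * expR B * (4 / (th * dl)) ^+ d.
Proof.
move=> th0 thd H.
have p x : psi x * SS a dl psi x <= (c ^+ 2)^-1 * expR 2.
  apply: (@le_trans _ _ ((c ^+ 2)^-1 * cc a dl)); last first.
    by rewrite ler_wpM2l ?invr_ge0 ?sqr_ge0// cc_le_e2.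
  rewrite /SS /cc !mulr_sumr; apply: ler_sum => s _.
  by rewrite mulrCA mulrC ler_wpM2r ?wt_ge0// psi_q2.
apply: (@le_trans _ _ (\sum_(j : {ffun 'I_d -> 'I_k.+1})
   (c ^+ 2)^-1 * expR 2 * expR B * \prod_i expR (- (th * dl * `|(j i : nat).*2%:R - k%:R|)))).
  apply: ler_sum => j _; set x := site dl j.
  have -> : revm a dl psi x * f x ^+ 2 = (psi x * SS a dl psi x) * (Ee a x ^+ 2 * f x ^+ 2).
    by rewrite /revm; ring.
  rewrite -[_ * expR 2 * _ * _]mulrA; apply: ler_pM => //.
  - by rewrite mulr_ge0// ltW ?(psi_gt0 c0 W)// (SSpsi_gt0 c0 L0 K0 W dl0 dla dlc).
  - by rewrite mulr_ge0 ?sqr_ge0.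
  apply: le_trans (H x) _; rewrite expRD -expR_sum ler_wpM2l ?expR_ge0// ler_expR.
  rewrite sumrN lerN2 -mulr_sumr -mulrA ler_wpM2l ?(ltW th0)// /norm1 mulr_sumr.
  by apply: ler_sum => i _; rewrite mxE normrM (gtr0_norm dl0).
rewrite -mulr_sumr ler_wpM2l ?mulr_ge0 ?invr_ge0 ?sqr_ge0 ?expR_ge0//.
rewrite -(bigA_distr_bigA (fun _ m => expR (- (th * dl * `|(m : 'I_k.+1).*2%:R - k%:R|)))) /=.
rewrite prodr_const card_ord; have u0 : 0 < th * dl by rewrite mulr_gt0.
apply: lerXn2r; rewrite ?nnegrE ?sumr_ge0 ?divr_ge0 ?(ltW u0)//.
by apply: le_trans (geo_sum_le k u0) (geo_bound u0 thd).
Qed.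

End ChainTail.

(** * Decay of the chain in time and in depth *)

Section ChainDecay.
Context {R : realType} {d : nat}.
Implicit Types (i : 'I_d) (x y v w l : 'rV[R]_d) (f g psi : 'rV[R]_d -> R).

Lemma coord_le_enorm w i : `|w 0 i| <= enorm w.
Proof.
rewrite /enorm -sqrtr_sqr ler_wsqrtr// /dotr (bigD1 i)//= -expr2 lerDl.
by apply: sumr_ge0 => j _; rewrite -expr2 sqr_ge0.
Qed.

Lemma norm1_le_enorm w : norm1 w <= d%:R * enorm w.
Proof.
rewrite [leRHS]mulr_natl -[X in _ *+ X]card_ord -sumr_const.
by apply: ler_sum => i _; exact: coord_le_enorm.
Qed.

Lemma dotr_le_enorm x w : `|dotr x w| <= norm1 x * enorm w.
Proof.
apply: le_trans (ler_norm_sum _ _ _) _; rewrite /norm1 mulr_suml; apply: ler_sum => i _.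
by rewrite normrM ler_wpM2l// coord_le_enorm.
Qed.

Lemma enorm1_dotr l : enorm l = 1 -> dotr l l = 1.
Proof.
move=> H; have p : 0 <= dotr l l by apply: sumr_ge0 => i _; rewrite -expr2 sqr_ge0.
by rewrite -(sqr_sqrtr p) -/(enorm l) H expr1n.
Qed.

(** The first [M^2] steps are compared with the simple walk to pass from a sum of squares to the
    value at 0; the other [m] steps contract. [tau = M^d y] cancels the mesh factors and leaves [y]
    free to balance the two terms. *)
Lemma chain_spectral (a : 'rV[R]_d) (c Lp Kp y N : R) (M m : nat) psi f :
  0 < c -> 0 <= Lp -> 0 <= Kp -> weight c c^-1 Lp Kp psi -> (0 < M)%N ->
  M%:R^-1 * norm1 a <= 1 -> M%:R^-1 ^+ 2 * driftC a c c^-1 Lp Kp <= 1 / 2 ->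
  (forall x, 0 <= f x) -> 0 < y -> nrm a M%:R^-1 psi (M ^ 2 + m) f <= N * M%:R ^+ d ->
  iter (M ^ 2 + m) (Qop a M%:R^-1 psi) f 0 <=
   expR (2 * driftC a c c^-1 Lp Kp) * c^-1 *
   ((y + y^-1 * (2 * ((1 - kap a (c ^+ 2) * M%:R^-1 ^+ 2) ^+ m.*2 * N))) / 2).
Proof.
move=> c0 L0 K0 W M0; set dl := M%:R^-1; set c1 := driftC _ _ _ _ _ => dla dlc f0 y0 HN.
have Mp : (0 : R) < M%:R by rewrite ltr0n.
have dl0 : 0 < dl by rewrite invr_gt0.
have dl1 : dl <= 1 by rewrite invf_le1// ler1n.
have Md : 0 < (M%:R : R) ^+ d by rewrite exprn_gt0.
set Q := Qop a dl psi; set g := iter m Q f.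
have g0 x : 0 <= g x by exact: (Qn_ge0 c0 L0 K0 W dl0 dla dlc).
rewrite iterD -/g; apply: le_trans (chain_le_walk c0 L0 K0 W dl0 dla dlc _ _ g0) _.
have psi0 x : 0 < psi x by exact: (psi_gt0 c0 W).
have D0 := DD_gt0 dlc.
have D2 := DD_le2 c0 L0 K0 W dlc.
have tau0 : 0 < M%:R ^+ d * y by rewrite mulr_gt0.
have H1 := @S0_cauchy R d dl M (fun x => psi x * Ee a x * g x) _ M0 tau0.
have rho0 : 0 < 1 - kap a (c ^+ 2) * dl ^+ 2.
  exact: (@rho_gt0 R d a dl (c ^+ 2) psi dl0 dl1 (exprn_gt0 2 c0) (psi_q1 c0 W) (psi_q2 c0 W)).
have H2 : \sum_(j : {ffun 'I_d -> 'I_(M ^ 2).+1}) (psi (site dl j) * Ee a (site dl j) * g (site dl j)) ^+ 2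
   <= 2 * nrm a dl psi (M ^ 2) g.
  rewrite /nrm mulr_sumr; apply: ler_sum => j _; set x := site dl j.
  have -> : (psi x * Ee a x * g x) ^+ 2 = (Ee a x ^+ 2 * psi x * g x ^+ 2) * psi x by ring.
  have -> : 2 * (revm a dl psi x * g x ^+ 2) = (Ee a x ^+ 2 * psi x * g x ^+ 2) * (2 * SS a dl psi x).
    by rewrite /revm; ring.
  apply: ler_wpM2l; first by have ps0 := ltW (psi0 x); nneg.
  have := SSpsi_ge c0 L0 K0 W dl0 dla x; have := psi0 x; move: dlc; rewrite -/c1.
  by set w := _ * c1; nra.
have H3 : nrm a dl psi (M ^ 2) g <= (1 - kap a (c ^+ 2) * dl ^+ 2) ^+ m.*2 * (N * M%:R ^+ d).
  apply: le_trans (nrm_iter a dl0 dl1 (exprn_gt0 2 c0) psi0 (psi_q1 c0 W) (psi_q2 c0 W) _ _ _) _.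
  by rewrite ler_wpM2l// exprn_ge0// ltW.
have p0 : (psi 0 * Ee a 0)^-1 <= c^-1.
  by rewrite /Ee dotr0 expR0 mulr1 lef_pV2 ?posrE//; case: W.
have p1 : 0 <= (psi 0 * Ee a 0)^-1 by rewrite invr_ge0 mulr_ge0 ?expR_ge0// ltW.
have I0 : 0 <= iter (M ^ 2) (S0 dl) (fun x => psi x * Ee a x * g x) 0.
  elim: (M ^ 2)%N {H1 H2 H3} (0 : 'rV[R]_d) => [|k IHk] x /=.
    by rewrite !mulr_ge0 ?expR_ge0// ltW.
  by rewrite mulr_ge0 ?invr_ge0 ?exprn_ge0// sumr_ge0// => s _; exact: IHk.
set rho := 1 - kap a (c ^+ 2) * dl ^+ 2 in rho0 H3 *; clearbody rho.
rewrite -mulrA; apply: ler_pM; rewrite ?exprn_ge0 ?(ltW D0)//; first by rewrite mulr_ge0.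
  apply: le_trans (DDn_le c0 L0 K0 W dlc _) _; rewrite -/c1 ler_expR.
  by rewrite natrX /dl -exprMn divff ?expr1n ?mulr1// gt_eqF.
apply: ler_pM => //; apply: le_trans H1 _; rewrite ler_pM2r//; apply: lerD.
  by rewrite mulrAC exprVn divff ?mul1r// gt_eqF.
set Sg := \sum_j _ in H2 *.
have -> : (M%:R ^+ d * y)^-1 * Sg = y^-1 * ((M%:R ^+ d)^-1 * Sg) by rewrite invfM; ring.
rewrite ler_pM2l ?invr_gt0// ler_pdivrMl//; apply: le_trans H2 _.
have -> : M%:R ^+ d * (2 * (rho ^+ m.*2 * N)) = 2 * (rho ^+ m.*2 * (N * M%:R ^+ d)) by ring.
by rewrite ler_pM2l.
Qed.

Lemma norm1D x y : norm1 (x + y) <= norm1 x + norm1 y.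
Proof. by rewrite /norm1 -big_split; apply: ler_sum => i _; rewrite mxE ler_normD. Qed.

Lemma norm1N x : norm1 (- x) = norm1 x.
Proof. by apply: eq_bigr => i _; rewrite mxE normrN. Qed.

Lemma norm1_ebasis i (k : R) : `|k| <= 1 -> norm1 (k *: ebasis R i) <= 1.
Proof.
move=> k1; rewrite /norm1 (bigD1 i)//= big1 ?addr0 => [|j ji].
  by rewrite !mxE !eqxx mulr1.
by rewrite !mxE eqxx (negbTE ji) mulr0 normr0.
Qed.

(** The weight [exp(2 a.x)] is in general not summable over a half space. The first bound therefore
    splits [f] by a box of side proportional to [t]: inside, the contraction outweighs the growth of
    the norm; outside, exponential moments apply. The second bound is an exponential moment in the
    direction [- l']. *)
Lemma chain_decay (lambda c Lp Kp : R) l : (0 < d)%N -> 0 < lambda -> enorm l = 1 ->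
  0 < c -> c <= 1 -> 0 <= Lp -> 0 <= Kp ->
  exists eps C0 k0 M0 : R, [/\ 0 < eps, 0 < C0, 0 < k0 &
   forall l', enorm l' = 1 -> enorm (l' - l) < eps ->
   forall (M t : nat) psi f, M0 <= M%:R -> (0 < t)%N -> weight c c^-1 Lp Kp psi ->
   (forall x, 0 <= f x <= 1) ->
   [/\ (0 < M)%N, M%:R^-1 * norm1 (lambda *: l) <= 1,
       M%:R^-1 ^+ 2 * driftC (lambda *: l) c c^-1 Lp Kp <= 1 / 2,
       (forall r, 0 <= r -> (forall x, f x != 0 -> dotr x l' <= r) ->
         iter (t * M ^ 2) (Qop (lambda *: l) M%:R^-1 psi) f 0 <= C0 * expR (C0 * r) * expR (- (k0 * t%:R)))
     & (forall al, (forall x, f x != 0 -> dotr x l' <= - al) ->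
         iter (t * M ^ 2) (Qop (lambda *: l) M%:R^-1 psi) f 0 <= C0 * expR (C0 * t%:R - al))]].
Proof.
move=> d0 lam0 l1 c0 cle1 L0 K0; set a := lambda *: l.
have D0 : (0 : R) < d%:R by rewrite ltr0n.
set n1 := norm1 a; have n10 : 0 <= n1 := norm1_ge0 a.
set c1 := driftC a c c^-1 Lp Kp.
have c10 : 0 <= c1 by rewrite /c1 /driftC; nneg.
set kp := kap a (c ^+ 2).
have aE : dotr a a = lambda ^+ 2 by rewrite /a dotrZr dotrC dotrZr enorm1_dotr// mulr1 expr2.
have lam2 : 0 < lambda ^+ 2 by rewrite exprn_gt0.
have kp0 : 0 < kp.
  by rewrite /kp /kap aE divr_gt0 ?mulr_gt0 ?exprn_gt0// ltr_pwDl// ltW.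
have kp1 : kp <= 1.
  rewrite /kp /kap aE ler_pdivrMr ?ltr_pwDl ?(ltW lam2)// mul1r.
  apply: (@le_trans _ _ (lambda ^+ 2)); last by rewrite lerDr.
  by rewrite ler_piMl ?(ltW lam2)// -exprM exprn_ile1// ltW.
(* [chain_tail] with unit coordinate exponents has rate [2 c1 + 2 (n1 + 1)^2]; the extra 1 leaves
   [exp(- t)] outside the box of radius [CC t]. *)
set CC := 2 * c1 + 2 * (n1 + 1) ^+ 2 + 1.
have CC1 : 1 <= CC.
  by rewrite /CC lerDr; nneg.
have CC0 : 0 < CC by exact: lt_le_trans CC1.
(* Equal shares of a budget: [2 lambda eps + th = kp / (d CC)]. On the box, where
   [norm1 x <= d CC t], tilting [l] to [l'] and inserting the weight [exp(- th norm1 x)] cost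
   together at most [exp(kp t)], while the contraction of the squared norm is
   [exp(- 2 kp (t - 1))]. *)
set th := kp / (2 * d%:R * CC); set eps := kp / (4 * lambda * d%:R * CC).
have th0 : 0 < th by apply: divr_gt0 => //; do ? apply: mulr_gt0 => //.
have eps0 : 0 < eps by apply: divr_gt0 => //; do ? apply: mulr_gt0 => //.
have th1 : th <= 1.
  rewrite /th ler_pdivrMr ?mul1r; last by do ? apply: mulr_gt0 => //.
  apply: le_trans kp1 _.
  by apply: mulr_ege1 => //; apply: mulr_ege1; rewrite ler1n.
set N0 := (c ^+ 2)^-1 * expR 2 * (4 / th) ^+ d.
have N00 : 0 <= N0 by rewrite /N0; have := ltW th0; have := ltW c0 => ? ?; nneg.
set E1 := expR (2 * c1) * c^-1.
have E10 : 0 <= E1 by rewrite /E1; have := ltW c0 => ?; nneg.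
(* The summands serve the requirements [C01] to [C04]. *)
set C0 := E1 * (1 + N0 * expR 2) + 2 * d%:R * c^-1 ^+ 2 + 2 * lambda + c^-1 ^+ 2 +
   (2 * c1 + 2 * (n1 + d%:R) ^+ 2).
have ci0 : 0 < c^-1 ^+ 2 by rewrite exprn_gt0// invr_gt0.
have T1 : 0 <= E1 * (1 + N0 * expR 2) by nneg.
have T2 : 0 <= 2 * d%:R * c^-1 ^+ 2 by have := ltW c0 => ?; nneg.
have T3 : 0 <= 2 * lambda by have := ltW lam0 => ?; nneg.
have T5 : 0 <= 2 * c1 + 2 * (n1 + d%:R) ^+ 2 by nneg.
have C00 : 0 < C0 by rewrite /C0; lra.
have C01 : E1 * (1 + N0 * expR 2) + 2 * d%:R * c^-1 ^+ 2 <= C0 by rewrite /C0; lra.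
have C02 : 2 * lambda <= C0 by rewrite /C0; lra.
have C03 : c^-1 ^+ 2 <= C0 by rewrite /C0; lra.
have C04 : 2 * c1 + 2 * (n1 + d%:R) ^+ 2 <= C0 by rewrite /C0; lra.
(* The threshold for [M] makes [dl] times each of [n1], [n1 + 1], [n1 + d] and [2 c1] at most 1. *)
exists eps, C0, (kp / 2), (n1 + d%:R + 1 + 2 * c1); split=> //; first by rewrite divr_gt0.
move=> l' l'1 l'eps M t psi f MM t0 W f01.
have M1 : 1 <= (M%:R : R) by apply: le_trans MM; rewrite -addrA addrC -addrA lerDl; nneg.
have M0 : (0 < M)%N by rewrite -(@ltr0n R) (lt_le_trans _ M1).
have Mp : (0 : R) < M%:R by rewrite ltr0n.
set dl := M%:R^-1; have dl0 : 0 < dl by rewrite invr_gt0.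
have dl1 : dl <= 1 by rewrite invf_le1.
have dlb b : b <= M%:R -> dl * b <= 1 by move=> bM; rewrite ler_pdivrMl// mulr1.
have dla : dl * norm1 a <= 1.
  by apply: dlb; apply: le_trans MM; rewrite -!addrA lerDl; nneg.
have dlc : dl ^+ 2 * c1 <= 1 / 2.
  have : dl * (2 * c1) <= 1 by apply: dlb; apply: le_trans MM; rewrite lerDr; nneg.
  move=> h; have : dl ^+ 2 * c1 <= dl * c1 by rewrite ler_wpM2r// expr2 ler_piMl// ltW.
  by lra.
have f0 x : 0 <= f x by case/andP: (f01 x).
have f1 x : f x <= 1 by case/andP: (f01 x).
have nt : (t * M ^ 2)%:R * dl ^+ 2 = t%:R :> R.
  by rewrite natrM natrX -mulrA -exprMn divff ?expr1n ?mulr1// gt_eqF.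
have tp : (0 : R) < t%:R by rewrite ltr0n.
split=> // [r r0 fr|al fal]; last first.
  have H := @chain_tail R d a c Lp Kp dl psi c0 L0 K0 W dl0 dla dlc unit (fun _ => - l') (expR (- al))
     (n1 + d%:R) (t * M ^ 2) f f0 (expR_ge0 _).
  have {}H := H _ _ _; rewrite nt card_unit mulr1 -/c1 in H.
  apply: le_trans (H _ _ _) _.
  - move=> y; rewrite big_const card_unit /= addr0.
    have [->|fy] := eqVneq (f y) 0; first by rewrite mulr_ge0 ?expR_ge0.
    apply: le_trans (f1 y) _; rewrite -expRD -expR0 ler_expR dotrC dotrNr.
    by rewrite subr_ge0; exact: fal.
  - move=> _; apply: le_trans (norm1D _ _) _; rewrite norm1N lerD2l.
    by apply: le_trans (norm1_le_enorm _) _; rewrite l'1 mulr1.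
  - by apply: dlb; apply: le_trans MM; rewrite -[n1 + d%:R + 1 + _]addrA lerDl; nneg.
  rewrite -mulrA -expRD; apply: ler_pM; rewrite ?expR_ge0 ?(ltW ci0)//.
  by rewrite ler_expR addrC lerD2r ler_wpM2r.
set n := (t * M ^ 2)%N in nt *.
pose bx x := [forall i, `|x 0 i| <= CC * t%:R].
pose g1 x := if bx x then f x else 0; pose g2 x := if bx x then 0 else f x.
have fE : f = (fun x => g1 x + g2 x).
  by apply/funext => x; rewrite /g1 /g2; case: (bx x); rewrite ?addr0 ?add0r.
rewrite fE (QnD a dl psi).
have g10 x : 0 <= g1 x by rewrite /g1; case: (bx x).
have g20 x : 0 <= g2 x by rewrite /g2; case: (bx x).
have er1 : 1 <= expR (2 * lambda * r) by rewrite -expR0 ler_expR mulr_ge0// mulr_ge0// ltW.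
have A1 : iter n (Qop a dl psi) g1 0 <=
   E1 * (1 + N0 * expR 2) * expR (2 * lambda * r) * expR (- (kp / 2 * t%:R)).
  pose B := 2 * lambda * r + kp * t%:R.
  pose m := (t.-1 * M ^ 2)%N.
  have nm : n = (M ^ 2 + m)%N by rewrite /n /m -mulSn prednK.
  have thdl : th * dl <= 1.
    by rewrite -[1]mulr1; apply: ler_pM => //; exact: ltW.
  have HB x : Ee a x ^+ 2 * g1 x ^+ 2 <= expR (B - th * norm1 x).
    rewrite /g1; case: ifP => [bxx|_]; last by rewrite expr0n mulr0 expR_ge0.
    have [->|fx] := eqVneq (f x) 0; first by rewrite expr0n mulr0 expR_ge0.
    apply: (@le_trans _ _ (Ee a x ^+ 2)).
      by rewrite ler_piMr ?sqr_ge0// expr_le1.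
    rewrite /Ee expr2 -expRD ler_expR.
    have aEx : dotr a x = lambda * dotr x l by rewrite /a dotrC dotrZr.
    have lx : dotr x l <= r + norm1 x * eps.
      have -> : l = l' + (l - l') by rewrite addrC subrK.
      rewrite dotrDr; apply: lerD; first exact: fr.
      apply: le_trans (ler_norm _) _; apply: le_trans (dotr_le_enorm _ _) _.
      rewrite ler_wpM2l ?norm1_ge0//.
      have -> : enorm (l - l') = enorm (l' - l).
        by rewrite -opprB /enorm dotrNr dotrC dotrNr opprK.
      exact: ltW.
    have nx : norm1 x <= d%:R * (CC * t%:R).
      rewrite [leRHS]mulr_natl -[X in _ *+ X]card_ord -sumr_const.
      by apply: ler_sum => i _; move/forallP: bxx.
    have e2 : 2 * lambda * eps + th = kp / (d%:R * CC).
      by rewrite /eps /th; field; rewrite !gt_eqF.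
    have e3 : kp / (d%:R * CC) * norm1 x <= kp * t%:R.
      apply: (@le_trans _ _ (kp / (d%:R * CC) * (d%:R * (CC * t%:R)))).
        apply: ler_wpM2l => //; apply: divr_ge0; first exact: ltW.
        by apply: mulr_ge0 => //; exact: ltW.
      by rewrite le_eqVlt; apply/orP; left; apply/eqP; field; rewrite !gt_eqF.
    have e4 : lambda * dotr x l <= lambda * (r + norm1 x * eps) by rewrite ler_pM2l.
    rewrite aEx /B; rewrite -e2 in e3; nra.
  have HN : nrm a dl psi (M ^ 2 + m) g1 <= (N0 * expR B) * M%:R ^+ d.
    apply: le_trans (nrm_bound c0 L0 K0 W dl0 dla dlc _ th0 thdl HB) _.
    have -> : 4 / (th * dl) = (4 / th) * M%:R by rewrite /dl; field; rewrite !gt_eqF.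
    rewrite exprMn /N0 le_eqVlt; apply/orP; left; apply/eqP; ring.
  (* This [y] balances the two terms: [y^-1 exp(- 2 kp t) exp(kp t)] is again [exp(- kp t / 2)], up
     to factors independent of [t]. *)
  have := chain_spectral c0 L0 K0 W M0 dla dlc g10 (expR_gt0 (- (kp / 2 * t%:R))) HN.
  rewrite -/c1 -/kp -/dl -/E1 -nm => /le_trans; apply.
  clear HN HB; clearbody E1 N0 kp.
  set y := expR (- (kp / 2 * t%:R)).
  rewrite -[leRHS]mulrA -(mulrA E1); apply: ler_wpM2l => //.
  set rho := 1 - _.
  have rho0 : 0 <= rho.
    rewrite subr_ge0; apply: mulr_ile1 => //; [exact: ltW|exact: sqr_ge0|].
    by rewrite expr_le1// ltW.
  have Hrho : rho ^+ m.*2 <= expR (- (2 * kp * (t%:R - 1))).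
    have -> : - (2 * kp * (t%:R - 1)) = m.*2%:R * (- (kp * dl ^+ 2)).
      have -> : (m.*2%:R : R) = 2 * ((t%:R - 1) * M%:R ^+ 2).
        rewrite -mul2n natrM /m natrM natrX; congr (_ * (_ * _)).
        by rewrite -subn1 natrB.
      by rewrite /dl; field; rewrite gt_eqF.
    by rewrite expRM_natl lerXn2r ?nnegrE ?expR_ge0// expR_ge1Dx.
  have y0 : 0 < y by exact: expR_gt0.
  have Hy : y^-1 * (rho ^+ m.*2 * expR B) <= expR 2 * expR (2 * lambda * r) * y.
    rewrite /y -expRN opprK.
    apply: (@le_trans _ _ (expR (kp / 2 * t%:R) * (expR (- (2 * kp * (t%:R - 1))) * expR B))).
      by rewrite ler_wpM2l ?expR_ge0// ler_wpM2r ?expR_ge0.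
    rewrite -!expRD ler_expR /B.
    by move: kp1; clear; lra.
  have -> : y^-1 * (2 * (rho ^+ m.*2 * (N0 * expR B))) = 2 * N0 * (y^-1 * (rho ^+ m.*2 * expR B)) by ring.
  have h1 : 2 * N0 * (y^-1 * (rho ^+ m.*2 * expR B)) <= 2 * N0 * (expR 2 * expR (2 * lambda * r) * y).
    by rewrite ler_wpM2l// mulr_ge0.
  have h2 : y <= expR (2 * lambda * r) * y by rewrite ler_peMl// ltW.
  have -> : (1 + N0 * expR 2) * (expR (2 * lambda * r) * y) = expR (2 * lambda * r) * y +
     N0 * (expR 2 * expR (2 * lambda * r) * y) by ring.
  have h3 : 0 <= expR (2 * lambda * r) * y by rewrite mulr_ge0 ?expR_ge0// ltW.
  rewrite -mulrA in h1; lra.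
have A2 : iter n (Qop a dl psi) g2 0 <=
   2 * d%:R * c^-1 ^+ 2 * expR (2 * lambda * r) * expR (- (kp / 2 * t%:R)).
  pose v (o : 'I_d * bool) := sgn o.2 *: ebasis R o.1 : 'rV[R]_d.
  have H := @chain_tail R d a c Lp Kp dl psi c0 L0 K0 W dl0 dla dlc _ v (expR (- (CC * t%:R)))
     (n1 + 1) n g2 g20 (expR_ge0 _).
  have {}H := H _ _ _; rewrite nt card_prod card_ord card_bool -/c1 in H.
  apply: le_trans (H _ _ _) _.
  - move=> y; rewrite /g2; case: ifPn => [_|].
      by rewrite mulr_ge0 ?expR_ge0// sumr_ge0// => o _; rewrite expR_ge0.
    rewrite negb_forall => /existsP[i]; rewrite -ltNge => yi.
    apply: le_trans (f1 y) _; rewrite mulr_sumr.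
    have [b yb] : exists b, sgn b * y 0 i = `|y 0 i|.
      have [yp|yn] := leP 0 (y 0 i); first by exists true; rewrite /sgn mul1r ger0_norm.
      by exists false; rewrite /sgn mulN1r ltr0_norm.
    rewrite (bigD1 (i, b))//= -[leLHS]addr0; apply: lerD; last first.
      by apply: sumr_ge0 => o _; rewrite mulr_ge0 ?expR_ge0.
    rewrite -expRD -[leLHS]expR0 ler_expR /v /= dotrC dotrZr.
    have -> : dotr y (ebasis R i) = y 0 i.
      rewrite /dotr (bigD1 i)//= big1 ?addr0 => [|j ji]; first by rewrite !mxE !eqxx mulr1.
      by rewrite !mxE eqxx (negbTE ji) mulr0.
    by rewrite yb addrC subr_ge0 ltW.
  - move=> o; apply: le_trans (norm1D _ _) _; rewrite lerD2l.
    by apply: norm1_ebasis; rewrite norm_sgn.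
  - by apply: dlb; apply: le_trans MM; move: c10 D0; clear; lra.
  have -> : c^-1 ^+ 2 * expR (- (CC * t%:R)) * (d * 2)%:R * expR ((2 * c1 + 2 * (n1 + 1) ^+ 2) * t%:R) =
     2 * d%:R * c^-1 ^+ 2 * expR (- t%:R).
    have -> : expR (- t%:R) = expR (- (CC * t%:R)) * expR ((2 * c1 + 2 * (n1 + 1) ^+ 2) * t%:R) :> R.
      by rewrite -expRD; congr expR; rewrite /CC; ring.
    by rewrite natrM; ring.
  rewrite -[leRHS]mulrA; apply: ler_wpM2l => //.
  apply: (@le_trans _ _ (expR (- (kp / 2 * t%:R)))).
    by rewrite ler_expR lerN2 ler_piMl ?ltW//; lra.
  by rewrite ler_peMl ?expR_ge0.
apply: le_trans (lerD A1 A2) _.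
rewrite -!mulrDl ler_wpM2r ?expR_ge0//; apply: ler_pM; rewrite ?expR_ge0//.
- by nneg.
- by rewrite ler_expR ler_wpM2r.
Qed.

End ChainDecay.

(** * Path space and the martingale problem *)

Section MeasurableTools.
Context {dT : measure_display} {T : measurableType dT}.

Lemma measurable_forall (I : countType) (A : I -> set T) :
  (forall i, measurable (A i)) -> measurable [set w | forall i, A i w].
Proof.
move=> mA; rewrite (_ : [set _ | _] = ~` \bigcup_i ~` A i).
  by apply/measurableC/countable_bigcupT_measurable => // i; exact: measurableC.
apply/seteqP; split=> [w Aw [i _]|w Aw i] /=; first by move/(_ (Aw i)).
by apply: contrapT => Ai; apply: Aw; exists i.
Qed.

Lemma measurable_exists (I : countType) (A : I -> set T) :
  (forall i, measurable (A i)) -> measurable [set w | exists i, A i w].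
Proof.
move=> mA; rewrite (_ : [set _ | _] = \bigcup_i A i).
  exact: countable_bigcupT_measurable.
by apply/seteqP; split=> [w [i Ai]|w [i _ Ai]] /=; exists i.
Qed.

Lemma measurable_imp (C : Prop) (A : set T) : measurable A -> measurable [set w | C -> A w].
Proof.
move=> mA; have [c|nc] := pselect C.
  by rewrite (_ : [set _ | _] = A)//; apply/seteqP; split=> w //=; exact.
by rewrite (_ : [set _ | _] = setT)//; apply/seteqP; split=> w //= _ /nc.
Qed.

Lemma measurable_and (C : Prop) (A : set T) : measurable A -> measurable [set w | C /\ A w].
Proof.
move=> mA; have [c|nc] := pselect C.
  by rewrite (_ : [set _ | _] = A)//; apply/seteqP; split=> w //= [].
by rewrite (_ : [set _ | _] = set0)//; apply/seteqP; split=> w //= [].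
Qed.

(* The Lebesgue integral of the library is monotone even on non-measurable functions,
   because its positive part is a supremum over simple functions. *)
Lemma integral_mono {R : realType} (mu : {measure set T -> \bar R}) (D : set T)
    (f g : T -> \bar R) : (forall x, D x -> f x <= g x)%E ->
  (\int[mu]_(x in D) f x <= \int[mu]_(x in D) g x)%E.
Proof.
move=> fg; have fgD x : ((f \_ D) x <= (g \_ D) x)%E.
  by rewrite /patch; case: ifPn => //; rewrite inE => /fg.
rewrite /integral; apply: leeB; apply: le_ereal_sup => _ [h hf <-]; exists h => // x.
  by apply: le_trans (hf x) _; rewrite !funeposE ge_max !le_max fgD lexx orbT.
apply: le_trans (hf x) _; rewrite !funenegE ge_max !le_max lexx orbT andbT.
by rewrite leeN2 fgD.
Qed.

End MeasurableTools.

(** * Observables of the path and the one-sided martingale inequality *)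

Section PathMeasurability.
Context {R : realType} {d : nat}.
Implicit Types (s : \bar R) (t : R).

Local Notation F s := (g_sigma_algebraType (@cyl_upto R d s)).

Lemma coord_measurable s t i : 0 <= t -> (t%:E <= s)%E ->
  measurable_fun [set: F s] (fun w : F s => (w : cpath R d) t 0 i).
Proof.
move=> t0 ts _ B mB; rewrite setTI.
by apply: sub_sigma_algebra; exists t, i, B.
Qed.

(** An open set is a countable union of rational boxes, and boxes are finite intersections of
    coordinate events. *)
Lemma open_at_measurable s t (U : set 'rV[R]_d) : 0 <= t -> (t%:E <= s)%E -> open U ->
  measurable ([set w | U ((w : cpath R d) t)] : set (F s)).
Proof.
move=> t0 ts oU.
pose box (q : 'rV[rat]_d * rat) : set 'rV[R]_d :=
  [set x | forall i, `|x 0 i - ratr (q.1 0 i)| < ratr q.2].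
rewrite (_ : [set _ | _] = [set w | exists q, box q `<=` U /\ box q ((w : cpath R d) t)]).
  apply: measurable_exists => q; apply: measurable_and; apply: measurable_forall => i.
  have m : measurable_fun [set: F s] (fun w : F s => `|(w : cpath R d) t 0 i - ratr (q.1 0 i)|).
    apply: measurableT_comp => //; apply: measurable_funB => //; exact: coord_measurable.
  have := m measurableT [set r | r < ratr q.2]; rewrite setTI; apply.
  by rewrite (_ : [set _ | _] = `]-oo, ratr q.2[%classic)//; apply/seteqP; split=> r /=; rewrite in_itv.
apply/seteqP; split=> w /=; last by case=> q [bU]; exact: bU.
set x := (w : cpath R d) t => Ux.
have /nbhs_ballP[e /= e0 be] : nbhs x U by exact: open_nbhs_nbhs.
have [r] := rat_in_itvoo (divr_gt0 e0 (ltr0Sn R 1)); rewrite in_itv /= => /andP[r0 re].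
have Hq i : exists q : rat, `|x 0 i - ratr q| < ratr r.
  have /rat_in_itvoo[q] : x 0 i - ratr r < x 0 i + ratr r by rewrite ltrD2l gt0_cp.
  by rewrite in_itv /= -ltr_distl distrC => ?; exists q.
pose q i := xchoose (Hq i); have qP i := xchooseP (Hq i).
exists (\row_i q i, r); split=> [y /= Hy|i]; last by rewrite mxE; exact: qP.
apply: be; rewrite -ball_normE /=; apply: (@le_lt_trans _ _ (ratr r + ratr r)); last first.
  by move: re; set z := ratr r; lra.
apply: norm_le_coord => [|i]; first by rewrite addr_ge0// ltW.
have -> : (x - y) 0 i = (x 0 i - ratr (q i)) - (y 0 i - ratr (q i)) by rewrite !mxE; ring.
apply: le_trans (ler_normB _ _) _; apply: lerD; apply: ltW; first exact: qP.
by have := Hy i; rewrite mxE.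
Qed.

Lemma continuous_at_measurable s t (f : 'rV[R]_d -> R) : 0 <= t -> (t%:E <= s)%E -> continuous f ->
  measurable_fun [set: F s] (fun w : F s => f ((w : cpath R d) t)).
Proof.
move=> t0 ts cf; apply: (measurability _ (RGenOpens.measurableE R)).
move=> _ [_ [a [b ->]] <-]; rewrite setTI.
have := @open_at_measurable s t (f @^-1` `]a, b[%classic) t0 ts; apply.
by apply: open_comp => // x _; exact: cf.
Qed.

Lemma cyl_upto_measurable s (A : set (cpath R d)) :
  <<s cyl_upto s >> A -> measurable (A : set (pathM R d)).
Proof.
apply: smallest_sub; first exact: sigma_algebra_measurable.
move=> _ [t [i [B [t0 ts mB ->]]]]; apply: sub_sigma_algebra.
by exists t, i, B; split=> //; rewrite leey.
Qed.

Lemma bounded_integrable (P : probability (pathM R d) R) (A : set (pathM R d)) (G : pathM R d -> R) (B : R) :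
  measurable A -> measurable_fun setT G -> (forall w, `|G w| <= B) ->
  P.-integrable A (EFin \o G).
Proof.
move=> mA mG GB; apply: measurable_bounded_integrable => //.
- by apply: le_lt_trans (probability_le1 P mA) _; rewrite ltry.
- exact: measurable_funTS.
- by exists B; split; [exact: num_real|move=> y By w _; exact: le_trans (GB w) (ltW By)].
Qed.

Lemma at_integrable (P : probability (pathM R d) R) (A : set (pathM R d)) (f : 'rV[R]_d -> R) (B t : R) :
  measurable A -> 0 <= t -> continuous f -> (forall x, `|f x| <= B) ->
  P.-integrable A (EFin \o (fun w => f (cpath_fun w t))).
Proof.
move=> mA t0 cf fB; apply: (@bounded_integrable _ _ _ B) => //.
by apply: continuous_at_measurable => //; rewrite leey.
Qed.

(** One-sided form of the martingale problem. The time integral of the generator along the path is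
    replaced by the majorant [G] through [integral_mono], which leaves only [G] and observables at
    fixed times. *)
Lemma mp_le (b : 'rV[R]_d -> 'rV[R]_d) x (P : probability (pathM R d) R)
    (f : 'rV[R]_d -> R) (r t Bf Bg : R) (A : set (pathM R d)) (G : pathM R d -> R) :
  solves_mp b x P -> Cc2 f -> (forall y, `|f y| <= Bf) -> continuous (generator b f) ->
  0 <= r -> r <= t -> <<s cyl_upto r%:E >> A -> measurable_fun setT G -> (forall w, `|G w| <= Bg) ->
  (forall w u, A w -> r <= u <= t -> generator b f (cpath_fun w u) <= G w) ->
  Rintegral P A (fun w => f (cpath_fun w t)) <=
    Rintegral P A (fun w => f (cpath_fun w r)) + (t - r) * Rintegral P A G.
Proof.
move=> [_ H] Cf fB cg r0 rt FA mG GB HG; have mA := cyl_upto_measurable FA.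
have cf : continuous f by move=> y; apply: differentiable_continuous; case: Cf.
have t0 : 0 <= t by exact: le_trans rt.
have If u : 0 <= u -> P.-integrable A (EFin \o (fun w => f (cpath_fun w u))).
  by move=> u0; exact: at_integrable fB.
have IG : P.-integrable A (EFin \o G) by exact: bounded_integrable GB.
have IG' : P.-integrable A (EFin \o (fun w => (t - r) * G w)).
  by rewrite (_ : EFin \o _ = (fun w => (t - r)%:E * (EFin \o G) w)%E)//; exact: integrableZl.
have IB : P.-integrable A (EFin \o (fun w => f (cpath_fun w t) - f (cpath_fun w r))).
  rewrite (_ : EFin \o _ = ((EFin \o (fun w => f (cpath_fun w t))) \- (EFin \o (fun w => f (cpath_fun w r))))%E) //.
  by apply: integrableB => //; exact: If.
have := H f Cf r t r0 rt A FA => /esym/eqP; rewrite eq_le => /andP[_].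
have : (\int[P]_(w in A) (f (cpath_fun w t) - f (cpath_fun w r) - (t - r) * G w)%:E <=
   \int[P]_(w in A) (f (cpath_fun w t) - f (cpath_fun w r)
         - Rintegral lebesgue_measure `[r, t] (fun u => generator b f (cpath_fun w u)))%:E)%E.
  apply: integral_mono => w Aw; rewrite lee_fin lerD2l lerN2.
  have cw : continuous (fun u => generator b f (cpath_fun w u)).
    by move=> u; apply: continuous_comp; [exact: cpath_cont|exact: cg].
  apply: (@le_trans _ _ (Rintegral lebesgue_measure `[r, t] (fun=> G w))).
    apply: le_Rintegral => //; [exact: continuous_itv_integrable| |].
      by apply: continuous_itv_integrable => u; exact: cst_continuous.
    by move=> u /=; rewrite in_itv /=; exact: HG.
  rewrite Rintegral_cst//= lebesgue_measure_itv /= lte_fin.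
  have [_|tr] := ltP r t; first by rewrite /= mulrC.
  have -> : t = r by apply/eqP; rewrite eq_le tr rt.
  by rewrite mulr0 subrr mul0r.
move=> /le_trans h /h{h}.
have -> : (\int[P]_(w in A) (f (cpath_fun w t) - f (cpath_fun w r) - (t - r) * G w)%:E =
  (Rintegral P A (fun w => f (cpath_fun w t) - f (cpath_fun w r) - (t - r) * G w))%:E)%E.
  have I3 : P.-integrable A (EFin \o (fun w => f (cpath_fun w t) - f (cpath_fun w r) - (t - r) * G w)).
    rewrite (_ : EFin \o _ = ((EFin \o (fun w => f (cpath_fun w t) - f (cpath_fun w r))%R) \-
      (EFin \o (fun w => (t - r) * G w)%R))%E) //.
    exact: integrableB.
  by rewrite /Rintegral fineK//; exact: integrable_fin_num.
rewrite lee_fin RintegralB// RintegralB ?RintegralZl//; [|exact: If|exact: If].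
by rewrite subr_le0 lerBlDl.
Qed.

Lemma path_unif_cont (w : R -> 'rV[R]_d) (T e : R) : continuous w -> 0 < e ->
  \forall m \near \oo, forall x, 0 <= x <= T -> forall y, `|y - x| < m.+1%:R^-1 -> `|w y - w x| <= e.
Proof.
move=> cw e0.
have /compact_near_coveringP := @segment_compact R 0 T.
move=> /(_ nat \oo (fun m x => forall y, `|y - x| < m.+1%:R^-1 -> `|w y - w x| <= e)) H.
suff : \forall m \near \oo, forall x, `[0, T]%classic x ->
    forall y, `|y - x| < m.+1%:R^-1 -> `|w y - w x| <= e.
  by apply: filterS => m Hm x xT; apply: Hm; rewrite /= in_itv.
apply: H => x _; have /cvgrPdist_lt/(_ (e / 2)) := cw x.
rewrite divr_gt0// => /(_ isT)/nbhs_ballP[r /= r0 Hr].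
have r20 : 0 < r / 2 by rewrite divr_gt0.
have r2r : r / 2 < r by lra.
exists (ball x (r / 2), [set m : nat | m.+1%:R^-1 < r / 2]) => /=.
  split; first exact: nbhsx_ballx.
  exact: near_infty_natSinv_lt (PosNum r20).
move=> [x' m] /= []; rewrite -ball_normE /= => xx' mr y yx'.
have Hx' : `|w x - w x'| < e / 2 by apply: Hr; rewrite -ball_normE /= (lt_trans xx').
have Hy : `|w x - w y| < e / 2.
  apply: Hr; rewrite -ball_normE /=.
  have -> : x - y = (x - x') + (x' - y) by ring.
  apply: le_lt_trans (ler_normD _ _) _; rewrite -(distrC y).
  by move: (lt_trans yx' mr) xx'; lra.
rewrite (_ : w y - w x' = (w x - w x') - (w x - w y)); last first.
  by rewrite opprB [RHS]addrC addrA subrK.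
by apply: le_trans (ler_normB _ _) _; lra.
Qed.

(** A modulus of continuity tested at rational times, so that the event is a countable intersection;
    real times follow by continuity of the paths in [modset_le]. *)
Definition modset (T dlt : R) (m : nat) : set (pathM R d) :=
  [set w | forall p q : rat, 0 <= (ratr p : R) <= T -> 0 <= (ratr q : R) <= T ->
     `|ratr p - ratr q : R| < m.+1%:R^-1 -> forall i,
     `|cpath_fun w (ratr p) 0 i - cpath_fun w (ratr q) 0 i| <= dlt].

Lemma modset_measurable T dlt m : measurable (modset T dlt m).
Proof.
apply: measurable_forall => p; apply: measurable_forall => q.
have [p0|np] := pselect (0 <= (ratr p : R) <= T); last first.
  by rewrite [X in measurable X](_ : _ = setT)//; apply/seteqP; split=> // w _ /np.
have [q0|nq] := pselect (0 <= (ratr q : R) <= T); last first.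
  by rewrite [X in measurable X](_ : _ = setT)//; apply/seteqP; split=> // w _ _ /nq.
do 3 apply: measurable_imp; apply: measurable_forall => i.
have m1 : measurable_fun [set: pathM R d]
   (fun w => `|cpath_fun w (ratr p) 0 i - cpath_fun w (ratr q) 0 i|).
  apply: measurableT_comp => //; apply: measurable_funB; apply: coord_measurable; rewrite ?leey//.
    by case/andP: p0.
  by case/andP: q0.
have := m1 measurableT [set r | r <= dlt]; rewrite setTI; apply.
by rewrite (_ : [set _ | _] = `]-oo, dlt]%classic)//; apply/seteqP; split=> r /=; rewrite in_itv.
Qed.

Lemma modset_prob (P : probability (pathM R d) R) T dlt e : 0 < dlt -> 0 < e ->
  exists m, 1 - e <= fine (P (modset T dlt m)).
Proof.
move=> dl0 e0.
have nd : nondecreasing_seq (modset T dlt).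
  move=> m n mn; apply/subsetPset => w Hw p q Hp Hq pq; apply: Hw => //.
  by apply: lt_le_trans pq _; rewrite lef_pV2 ?posrE// ler_nat.
have U : \bigcup_m modset T dlt m = setT.
  apply/seteqP; split=> // w _.
  have [N _ /(_ N (leqnn N))H] := path_unif_cont T (@cpath_cont _ _ w) dl0.
  exists N => // p q Hp Hq pq i.
  have := H _ Hq _ pq; apply: le_trans.
  by apply: le_trans (norm_coord_le _ i); rewrite !mxE.
have : P \o modset T dlt @ \oo --> (1%:E)%E.
  rewrite -(probability_setT P) -U; apply: nondecreasing_cvg_mu => //; last exact: bigcupT_measurable (modset_measurable T dlt).
  exact: modset_measurable.
move=> /fine_cvgP[_] /cvgrPdist_lt/(_ e e0)[N _ /(_ N (leqnn N))] /= H.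
by exists N; move: H; rewrite ltr_norml => /andP[_]; lra.
Qed.

Lemma modset_le (w : pathM R d) T dlt m (s : rat) (h u : R) : modset T dlt m w -> 0 <= dlt ->
  0 <= (ratr s : R) -> ratr s <= u <= ratr s + h -> ratr s + h < T -> h < m.+1%:R^-1 ->
  `|cpath_fun w u - cpath_fun w (ratr s)| <= dlt.
Proof.
move=> Hw dl0 s0 /andP[su uh] hT hm.
apply: norm_le_coord => // i; rewrite !mxE leNgt; apply/negP => H.
have c : continuous (fun v => `|cpath_fun w v 0 i - cpath_fun w (ratr s) 0 i|).
  move=> v; apply: cvg_norm; apply: cvgB; last exact: cvg_cst.
  apply: (@continuous_comp _ _ _ (cpath_fun w) (fun x : 'rV[R]_d => x 0 i)); first exact: cpath_cont.
  exact: coord_continuous.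
have /nbhs_ballP[e /= e0 He] : nbhs u [set v | dlt < `|cpath_fun w v 0 i - cpath_fun w (ratr s) 0 i|].
  exact: cvgr_gt (c u) _ H.
(* Rational times slightly to the right of [u] still satisfy the constraints, because the bounds on
   [ratr s + h] and on [h] are strict. *)
have lt : u < u + Num.min e (Num.min (T - (ratr s + h)) (m.+1%:R^-1 - h)).
  by rewrite ltrDl !lt_min e0 !subr_gt0 hT hm.
have [q] := rat_in_itvoo lt; rewrite in_itv /= -ltrBlDl !lt_min => /and4P[uq q1 q2 q3].
have := He (ratr q); rewrite -ball_normE /= => H2.
have {}H2 : ~~ (`|cpath_fun w (ratr q) 0 i - cpath_fun w (ratr s) 0 i| <= dlt).
  by rewrite -ltNge; apply: H2; rewrite ltr0_norm; lra.
move/negP: H2; apply; apply: Hw; [lra|lra|].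
by move: q3 su uh uq; set z := m.+1%:R^-1 => q3 su uh uq; rewrite ger0_norm; lra.
Qed.

End PathMeasurability.

(** * Comparison of the diffusion with the chain *)

Section WeightApproximation.
Context {R : realType} {d : nat}.
Implicit Types (i : 'I_d) (x y v w l : 'rV[R]_d) (f g phi psi : 'rV[R]_d -> R).
Local Notation eb := (ebasis R).

Lemma St_near (ep L : R) g s x : 0 < ep -> 0 <= L -> Lip L g -> `|St ep s g x - g x| <= L * (ep * (size s)%:R).
Proof.
move=> ep0 L0 H; elim: s x => [|i s IH] x /=; first by rewrite subrr normr0 mulr0 mulr0.
have C y := @stek_line_continuous R d ep _ y i (Lip_continuous (St_lip ep s H)).
have Cc (c : R) : continuous (fun _ : R => c) by move=> ?; exact: cst_continuous.
have CC : continuous (fun t : R => St ep s g (x + (t * ep) *: eb i) - g x).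
  by move=> t; apply: cvgB; [exact: C|exact: Cc].
rewrite /stek -[g x]avg_cst -avgB//.
apply: avg_norm_le => // t /andP[t0 t1].
set w := (t * ep) *: eb i.
have wep : `|w| <= ep.
  rewrite normrZ ger0_norm ?mulr_ge0 ?(ltW ep0)//.
  apply: (@le_trans _ _ (t * ep)); last by rewrite ler_piMl// ltW.
  by rewrite ler_piMr ?norm_ebasis_le// mulr_ge0// ltW.
have -> : St ep s g (x + w) - g x = (St ep s g (x + w) - g (x + w)) + (g (x + w) - g x) by ring.
apply: le_trans (ler_normD _ _) _; rewrite -natr1 mulrDr mulr1 mulrDr; apply: lerD; first exact: IH.
by apply: le_trans (H _ _) _; exact: ler_wpM2l.
Qed.

Lemma derive_lip_le f x v (L : R) : derivable f x v ->
  (forall t : R, `|f (x + t *: v) - f x| <= L * `|t|) -> `|'D_v f x| <= L.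
Proof.
move=> df H; apply: cvgr_to_le (cvg_norm df) _; near=> h.
have h0 : h != 0 by near: h; exact: nbhs_dnbhs_neq.
rewrite normrZ normfV ler_pdivrMl ?normr_gt0//= [h *: v + x]addrC [leRHS]mulrC; exact: H.
Unshelve. all: by end_near.
Qed.

Lemma derive_exp f x v : differentiable f x ->
  is_derive x v (fun y => expR (f y)) (expR (f x) * 'D_v f x).
Proof.
move=> df; have de : differentiable expR (f x) by apply/derivable1_diffP; exact: derivable_expR.
have dc : differentiable (expR \o f) x by exact: differentiable_comp.
apply: DeriveDef; first exact: diff_derivable.
rewrite -[X in 'D_v X x]/(expR \o f) deriveE// diff_comp//= deriveE// diff1E// derive1E derive_val.
by rewrite /GRing.scale /= mulrC.
Qed.

Lemma mixed2_partial f (K : R) : (forall i x, derivable f x (eb i)) ->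
  (forall i x v, `|partial i f (x + v) - partial i f x| <= K * `|v|) -> mixed2 (d%:R * K) f.
Proof.
move=> df H x u v.
pose w y := f (y + v) - f y.
have -> : d%:R * K * `|u| * `|v| = d%:R * (K * `|v|) * `|u| by ring.
change (`|w (x + u) - w x| <= d%:R * (K * `|v|) * `|u|).
apply: coord_lipschitz => i y t.
apply: line_lipschitz => [y'|y'].
  by apply: derivableB => //; exact: derivable_shift_rV.
have dF w' : derivable (fun y => f (y + v)) w' (eb i) by exact: derivable_shift_rV.
by rewrite deriveB// derive_shift_rV; exact: H.
Qed.

Lemma norm1_le_norm v : norm1 v <= d%:R * `|v|.
Proof.
rewrite [leRHS]mulr_natl -[X in _ *+ X]card_ord -sumr_const.
by apply: ler_sum => i _; exact: norm_coord_le.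
Qed.

Lemma enorm_le_norm v : enorm v <= d%:R * `|v|.
Proof.
apply: le_trans (norm1_le_norm v); have := dotr_le_enorm v v.
have p : 0 <= dotr v v by apply: sumr_ge0 => i _; rewrite -expr2 sqr_ge0.
rewrite ger0_norm// -{1}(sqr_sqrtr p) -/(enorm v) expr2.
have : 0 <= enorm v by exact: sqrtr_ge0.
rewrite le_eqVlt => /predU1P[<- _|e0]; first exact: norm1_ge0.
by rewrite ler_pM2r.
Qed.

(** Six averages per direction, enough for the five orders of derivatives asked of the smoothed
    weight. *)
Definition spread : seq 'I_d := flatten (nseq 6 (enum 'I_d)).

Lemma count_spread i : count_mem i spread = 6.
Proof.
rewrite /spread count_flatten map_nseq sumn_nseq.
have -> : count_mem i (enum 'I_d) = 1%N by rewrite count_uniq_mem ?enum_uniq// mem_enum.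
by [].
Qed.

Lemma size_spread : size spread = (6 * d)%N.
Proof. by rewrite /spread size_flatten /shape map_nseq sumn_nseq size_enum_ord mulnC. Qed.

Section Potential.
Variables (eta beta K : R) (phi : 'rV[R]_d -> R).
Hypothesis phi_bnd : forall x, `|phi x| <= eta.
Hypothesis phi_diff : forall x, differentiable phi x.
Hypothesis grad_bnd : forall x, enorm (grad phi x) <= beta.
Hypothesis grad_lip : forall y z, enorm (grad phi y - grad phi z) <= K * enorm (y - z).

Let c := expR (- eta).
Let E := c^-1.
(** Constants of [weight] for [exp phi]. The environment enters only through [eta], [beta] and [K],
    which makes all later estimates uniform in it. *)
Definition potL : R := d%:R * ((expR (- eta))^-1 * beta).
Definition potK : R := d%:R * ((expR (- eta))^-1 * (`|K| * d%:R) + beta * potL).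
Let psi x := expR (phi x).

Lemma grad_coord x i : `|partial i phi x| <= beta.
Proof. by apply: le_trans (grad_bnd x); apply: le_trans (coord_le_enorm _ i); rewrite mxE. Qed.

Lemma grad_coord_lip i x v : `|partial i phi (x + v) - partial i phi x| <= `|K| * d%:R * `|v|.
Proof.
apply: (@le_trans _ _ (enorm (grad phi (x + v) - grad phi x))).
  by apply: le_trans (coord_le_enorm _ i); rewrite !mxE.
apply: le_trans (grad_lip _ _) _; rewrite addrAC subrr add0r -mulrA.
apply: (@le_trans _ _ (`|K| * enorm v)); first by rewrite ler_wpM2r ?sqrtr_ge0 ?ler_norm.
by rewrite ler_wpM2l// enorm_le_norm.
Qed.

Let beta0 : 0 <= beta.
Proof. by apply: le_trans (grad_bnd 0); exact: sqrtr_ge0. Qed.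

Let c0 : 0 < c. Proof. exact: expR_gt0. Qed.

Let E0 : 0 <= E. Proof. by rewrite invr_ge0 ltW. Qed.

Lemma potL_ge0 : 0 <= potL.
Proof. by rewrite /potL !mulr_ge0. Qed.

Lemma potK_ge0 : 0 <= potK.
Proof. by rewrite /potK mulr_ge0// addr_ge0// mulr_ge0// ?potL_ge0// mulr_ge0. Qed.

Let psi_bnd x : c <= psi x <= E.
Proof.
have := phi_bnd x; rewrite ler_norml => /andP[h1 h2].
by rewrite /E /c -expRN opprK /psi !ler_expR h1 h2.
Qed.

Let dpsi i x : derivable psi x (eb i).
Proof. by have [] := derive_exp (eb i) (phi_diff x). Qed.

Lemma partial_exp i x : partial i (fun y => expR (phi y)) x = expR (phi x) * partial i phi x.
Proof. by have [] := derive_exp (eb i) (phi_diff x). Qed.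

Let ppsi_bnd i x : `|partial i psi x| <= E * beta.
Proof.
rewrite partial_exp normrM; apply: ler_pM => //; last exact: grad_coord.
by rewrite ger0_norm ?expR_ge0//; case/andP: (psi_bnd x).
Qed.

Let psi_lip : Lip potL psi.
Proof.
move=> x v; apply: coord_lipschitz => i y t; apply: line_lipschitz => y'; first exact: dpsi.
exact: ppsi_bnd.
Qed.

Lemma potential_weight : weight (expR (- eta)) (expR (- eta))^-1 potL potK (fun y => expR (phi y)).
Proof.
split; [by move=> x; case/andP: (psi_bnd x)|by move=> x; case/andP: (psi_bnd x)|exact: psi_lip|].
apply: mixed2_partial; first exact: dpsi.
move=> i x v; rewrite !partial_exp.
have -> : expR (phi (x + v)) * partial i phi (x + v) - expR (phi x) * partial i phi x =
  psi (x + v) * (partial i phi (x + v) - partial i phi x) + partial i phi x * (psi (x + v) - psi x).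
  by rewrite /psi; ring.
apply: le_trans (ler_normD _ _) _; rewrite mulrDl !normrM; apply: lerD.
  rewrite -[leRHS]mulrA; apply: ler_pM => //; last exact: grad_coord_lip.
  by rewrite ger0_norm ?expR_ge0//; case/andP: (psi_bnd (x + v)).
rewrite -[leRHS]mulrA; apply: ler_pM => //; first exact: grad_coord.
Qed.

(** Averaging keeps the constants of [weight]; only [Mb] depends on [e]. The drift being
    [grad psi / psi], its error splits into that of the gradient, by [St_close], and that of the
    value, by [St_near]. *)
Lemma drift_approx (lambda e : R) l : 0 < e -> exists psi_e Mb,
  [/\ weight c E potL potK psi_e, BD 5 Mb psi_e &
   forall y i, `|(drift (lambda *: l) psi_e y - (grad phi y + lambda *: l)) 0 i| <= e].
Proof.
move=> e0; have [W1 W2 W3 W4] := potential_weight; have L0 := potL_ge0; have K0 := potK_ge0.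
pose D : R := E * potK * (6 * d)%:R + E * beta * (E ^+ 2 * (potL * (6 * d)%:R)) + 1.
have D0 : 0 < D by apply: ltr_pwDr => //; nneg.
pose ep := e / D; have ep0 : 0 < ep by rewrite divr_gt0.
pose pe := St ep spread psi.
have Hb : BD 5 ((1 + 2 / ep) ^+ 5 * E) pe.
  apply: (St_BD ep0 _ W3) => [i|x]; first by rewrite count_spread.
  by rewrite ger0_norm ?expR_ge0//; exact: W2.
exists pe, ((1 + 2 / ep) ^+ 5 * E); split => //.
  split; [by move=> x; exact: St_ge W3 W1|by move=> x; exact: St_le W3 W2| |].
    exact: St_lip.
  exact: St_mixed2.
move=> y i.
have -> : (drift (lambda *: l) pe y - (grad phi y + lambda *: l)) 0 i = (pe y)^-1 * partial i pe y - partial i phi y.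
  by rewrite /drift opprD addrACA subrr addr0 !mxE.
have pe0 : c <= pe y by exact: St_ge W3 W1.
have pp : partial i phi y = (psi y)^-1 * partial i psi y.
  by rewrite partial_exp mulrA mulVf ?mul1r// gt_eqF// expR_gt0.
have pN : pe y != 0 by rewrite gt_eqF// (lt_le_trans c0 pe0).
have sN : psi y != 0 by rewrite gt_eqF// expR_gt0.
have -> : (pe y)^-1 * partial i pe y - partial i phi y =
  (pe y)^-1 * (partial i pe y - partial i psi y) + partial i psi y * (((pe y)^-1 * (psi y)^-1) * (psi y - pe y)).
  by rewrite pp; field; rewrite pN sN.
have iE z : c <= z -> `|z^-1| <= E.
  move=> cz; have z0 := lt_le_trans c0 cz.
  by rewrite ger0_norm ?invr_ge0 ?(ltW z0)// lef_pV2 ?posrE.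
have h1 : `|partial i pe y - partial i psi y| <= potK * (ep * (6 * d)%:R).
  have -> : partial i pe y - partial i psi y = 'D_(eb i) (fun z => pe z - psi z) y.
    by rewrite deriveB//; exact: BD_derivable Hb.
  apply: derive_lip_le; first by apply: derivableB => //; exact: BD_derivable Hb.
  move=> t; have := St_close ep0 spread y (t *: eb i) W3 W4; rewrite size_spread -/pe.
  have -> : pe (y + t *: eb i) - psi (y + t *: eb i) - (pe y - psi y) =
    pe (y + t *: eb i) - pe y - (psi (y + t *: eb i) - psi y) by ring.
  move=> /le_trans; apply; apply: ler_wpM2l.
    by apply: mulr_ge0 => //; apply: mulr_ge0 => //; exact: ltW.
  by rewrite normrZ ler_piMr// norm_ebasis_le.
have h2 : `|psi y - pe y| <= potL * (ep * (6 * d)%:R).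
  by rewrite distrC -size_spread; exact: St_near.
apply: le_trans (ler_normD _ _) _; rewrite !normrM.
apply: (@le_trans _ _ (E * (potK * (ep * (6 * d)%:R)) + E * beta * (E * E * (potL * (ep * (6 * d)%:R))))).
  apply: lerD; first by apply: ler_pM => //; exact: iE.
  apply: ler_pM; [by []|by nneg|exact: ppsi_bnd|].
  apply: ler_pM; [by nneg|by []| |exact: h2].
  by apply: ler_pM => //; apply: iE => //; case/andP: (psi_bnd y).
have -> : e = ep * D by rewrite /ep mulfVK// gt_eqF.
rewrite /D -subr_ge0 (_ : _ - _ = ep); first exact: ltW.
by ring.
Qed.

End Potential.
End WeightApproximation.

Section ChainComparison.
Context {R : realType} {d : nat}.
Implicit Types (i : 'I_d) (x y v : 'rV[R]_d) (f g psi : 'rV[R]_d -> R) (b : 'rV[R]_d -> 'rV[R]_d).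

Definition genC (B : R) : R := d%:R * ((d%:R + 1) * (1 + B)).

Lemma genC_ge0 B : 0 <= B -> 0 <= genC B.
Proof. by move=> B0; rewrite /genC; nneg. Qed.

Lemma generatorE b f x :
  generator b f x = \sum_(i < d) (2^-1 * partial i (partial i f) x + b x 0 i * partial i f x).
Proof.
rewrite /generator /laplacian /dotr mulr_sumr -big_split /=; apply: eq_bigr => i _.
by rewrite mxE.
Qed.

Lemma generator_bound b (B N : R) f x : 0 <= B -> (forall x i, `|b x 0 i| <= B) -> BD 3 N f ->
  `|generator b f x| <= genC B * N.
Proof.
move=> B0 bB H; have N0 := BD_ge0 H.
rewrite generatorE /genC -[leRHS]mulrA; apply: sum_norm_le => i.
apply: le_trans (ler_normD _ _) _; rewrite !normrM.
have h1 := BD_le x (BD_partial i (BD_partial i H)).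
have h2 := BD_le x (BD_partial i H).
have h3 : `|b x 0 i| * `|partial i f x| <= B * N by apply: ler_pM.
have -> : `|2^-1 : R| = 2^-1 by rewrite ger0_norm ?invr_ge0.
have h4 : 0 <= d%:R * ((1 + B) * N) by nneg.
have h5 : 0 <= B * N by nneg.
have -> : (d%:R + 1) * (1 + B) * N = d%:R * ((1 + B) * N) + N + B * N by ring.
by lra.
Qed.

Lemma generator_lip b (B N : R) f : 0 <= B -> (forall x i, `|b x 0 i| <= B) ->
  (forall x v i, `|b (x + v) 0 i - b x 0 i| <= B * `|v|) -> BD 3 N f ->
  Lip (genC B * N) (generator b f).
Proof.
move=> B0 bB bL H x v; have N0 := BD_ge0 H.
rewrite !generatorE -sumrB /genC -2![leRHS]mulrA; apply: sum_norm_le => i.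
set p := partial i f; set q := partial i p.
have h1 : `|q (x + v) - q x| <= d%:R * N * `|v| := BD_lipschitz x v (BD_partial i (BD_partial i H)).
have h2 : `|p (x + v) - p x| <= d%:R * N * `|v| := BD_lipschitz x v (BD_leq (leqnSn 1) (BD_partial i H)).
have h3 : `|p x| <= N := BD_le x (BD_partial i H).
have E (q1 q2 b1 b2 p1 p2 : R) : 2^-1 * q1 + b1 * p1 - (2^-1 * q2 + b2 * p2) =
  2^-1 * (q1 - q2) + (b1 * (p1 - p2) + (b1 - b2) * p2) by ring.
rewrite E; apply: le_trans (ler_normD _ _) _; rewrite normrM.
have -> : `|2^-1 : R| = 2^-1 by rewrite ger0_norm ?invr_ge0.
have h4 : `|b (x + v) 0 i * (p (x + v) - p x) + (b (x + v) 0 i - b x 0 i) * p x|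
   <= B * (d%:R * N * `|v|) + B * `|v| * N.
  by apply: le_trans (ler_normD _ _) _; rewrite !normrM; apply: lerD; apply: ler_pM.
have h5 : 0 <= d%:R * N * `|v| by nneg.
have h6 : 0 <= N * `|v| by nneg.
have -> : (d%:R + 1) * (1 + B) * (N * `|v|) = d%:R * N * `|v| + N * `|v| + B * (d%:R * N * `|v|) + B * `|v| * N.
  by ring.
move: h1 h4 h5 h6; set z1 := `|q _ - _|; set z2 := `|_ + _ * p x|; set z3 := d%:R * N * `|v|.
by set z4 := B * z3; set z5 := B * `|v| * N; set z6 := N * _; clear; lra.
Qed.

(** Finite propagation speed: the iterates stay compactly supported, hence admissible in the
    martingale problem. *)
Lemma Qn_support a (dl r : R) psi f n x : 0 < dl -> (forall x, r < `|x| -> f x = 0) ->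
  r + n%:R * dl < `|x| -> iter n (Qop a dl psi) f x = 0.
Proof.
move=> dl0 f0; elim: n x => [|n IH] x /=; first by rewrite mul0r addr0; exact: f0.
move=> Hx; rewrite /Qop [X in X / _]/SS big1 ?mul0r// => s _.
rewrite IH ?mulr0//.
have : `|x| <= `|x + dl *: sg s| + dl.
  rewrite -[X in `|X| <= _](addrK (dl *: sg s)); apply: le_trans (ler_normB _ _) _.
  rewrite lerD2l normrZ (gtr0_norm dl0) ler_piMr// ?(ltW dl0)//.
  apply: norm_le_coord => // i; by rewrite mxE norm_sgn.
by move: Hx; rewrite -natr1; lra.
Qed.

End ChainComparison.

(** * One step of the diffusion against one step of the chain *)

Section Comparison.
Context {R : realType} {d : nat}.
Variables (eta beta K : R) (phi : 'rV[R]_d -> R) (lambda : R) (l : 'rV[R]_d).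
Hypothesis phi_bnd : forall x, `|phi x| <= eta.
Hypothesis phi_diff : forall x, differentiable phi x.
Hypothesis grad_bnd : forall x, enorm (grad phi x) <= beta.
Hypothesis grad_lip : forall y z, enorm (grad phi y - grad phi z) <= K * enorm (y - z).

Let a := lambda *: l.
Let b := fun y => grad phi y + lambda *: l.
Let c := expR (- eta).
Let pL : R := potL (d := d) eta beta.
Let pK : R := potK (d := d) eta beta K.

Definition driftB : R := beta + norm1 (lambda *: l) + `|K| * d%:R.

Lemma driftB_ge0 : 0 <= driftB.
Proof.
have : 0 <= beta by apply: le_trans (grad_bnd 0); exact: sqrtr_ge0.
by rewrite /driftB => ?; nneg.
Qed.

Lemma drift_bound x i : `|(grad phi x + lambda *: l) 0 i| <= driftB.
Proof.
rewrite mxE; apply: le_trans (ler_normD _ _) _; rewrite /driftB -addrA; apply: lerD.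
  by rewrite mxE; exact: (grad_coord grad_bnd).
apply: (@le_trans _ _ (norm1 a)); last by rewrite lerDl; nneg.
by rewrite /norm1 (bigD1 i)//= lerDl sumr_ge0.
Qed.

Lemma drift_lip x v i : `|(grad phi (x + v) + lambda *: l) 0 i - (grad phi x + lambda *: l) 0 i| <= driftB * `|v|.
Proof.
rewrite [in X in `|X - _|]mxE [in X in `|_ - X|]mxE opprD addrACA subrr addr0 !mxE.
apply: le_trans (grad_coord_lip grad_lip i x v) _; rewrite ler_wpM2r//.
have : 0 <= beta by apply: le_trans (grad_bnd 0); exact: sqrtr_ge0.
by move=> ?; rewrite /driftB lerDr; nneg.
Qed.

Variables (P : probability (pathM R d) R).
Hypothesis Pmp : solves_mp b 0 P.

Lemma expect_start f B : continuous f -> (forall x, `|f x| <= B) ->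
  Rintegral P setT (fun w => f (cpath_fun w 0)) = f 0.
Proof.
move=> cf fB; have [P0 _] := Pmp.
have mf : measurable_fun [set: pathM R d] (fun w => f (cpath_fun w 0)).
  by apply: continuous_at_measurable => //; rewrite leey.
have m0 : measurable ([set w | cpath_fun w 0 = 0] : set (pathM R d)).
  rewrite (_ : [set _ | _] = [set w | forall i, cpath_fun w 0 0 i = 0]); last first.
    apply/seteqP; split=> w /= H; first by move=> i; rewrite H mxE.
    by apply/rowP => i; rewrite H mxE.
  apply: measurable_forall => i.
  have := @coord_measurable R d +oo%E 0 i (lexx _) (leey _) measurableT [set 0].
  by rewrite setTI; apply; exact: measurable_set1.
have -> : Rintegral P setT (fun w => f (cpath_fun w 0)) = Rintegral P setT (fun=> f 0).
  rewrite /Rintegral; congr fine; apply: ae_eq_integral => //.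
  - exact/measurable_EFinP.
  - exists (~` [set w | cpath_fun w 0 = 0]); split.
    + exact: measurableC.
    + by rewrite [LHS](probability_setC P) // P0 subee.
    + by move=> w /= H H2; apply: H => _; rewrite H2.
by rewrite Rintegral_cst//= probability_setT mulr1.
Qed.

(** The four errors per unit of time are the Taylor remainder of the chain, the drift error of the
    smoothing, the oscillation of the path during the step, and the contribution of paths outside
    [modset]. [s] is rational because [modset] looks at rational times. *)
Lemma one_step f (N A D dlt pr e1 C4 T h : R) psi (M m : nat) (s : rat) :
  let dl : R := M%:R^-1 in
  BD 3 N f -> BD 3 N (Qop a dl psi f) -> Cc2 f -> Lip D f -> 0 <= D ->
  A = genC (d := d) driftB * N -> 0 <= dlt -> 0 <= C4 -> (0 < M)%N -> h = dl ^+ 2 ->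
  (forall y i, `|(drift a psi y - b y) 0 i| <= e1) ->
  (forall x, `|Qop a dl psi f x - f x - dl ^+ 2 * generator (drift a psi) f x| <= C4 * N * dl ^+ 3) ->
  1 - pr <= fine (P (modset T dlt m)) -> 0 <= (ratr s : R) -> ratr s + h < T -> h < m.+1%:R^-1 ->
  Rintegral P setT (fun w => f (cpath_fun w (ratr s + h))) <=
  Rintegral P setT (fun w => Qop a dl psi f (cpath_fun w (ratr s))) +
    h * (C4 * N * dl + d%:R * (e1 * D) + A * dlt + 2 * A * pr).
Proof.
move=> dl Hf HQf Cf fD D0 AE dl0 C40 M0 hE Hdr HQ Hpr s0 sT hm.
have dlp : 0 < dl by rewrite invr_gt0 ltr0n.
have h0 : 0 <= h by rewrite hE sqr_ge0.
have B0 := driftB_ge0; have N0 := BD_ge0 Hf.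
have A0 : 0 <= A by rewrite AE mulr_ge0// genC_ge0.
have gB x : `|generator b f x| <= A by rewrite AE; apply: generator_bound => // y i; exact: drift_bound.
have gL : Lip A (generator b f).
  by rewrite AE; apply: generator_lip => //; [move=> y i; exact: drift_bound|move=> y v i; exact: drift_lip].
have gc : continuous (generator b f) := Lip_continuous gL.
set O := modset T dlt m in Hpr; have mO : measurable O := modset_measurable T dlt m.
pose J : pathM R d -> R := \1_(~` O).
have mJ : measurable_fun setT J by apply: measurable_indic; exact: measurableC.
have JB w : 0 <= J w <= 1 by rewrite /J /indic; case: (_ \in _); rewrite /= lexx ler01.
pose g (w : pathM R d) : R := generator b f (cpath_fun w (ratr s)).
have mg : measurable_fun [set: pathM R d] g by apply: continuous_at_measurable => //; rewrite leey.
(* The generator frozen at time [s], corrected by its Lipschitz bound on [modset] and by twice its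
   supremum elsewhere. *)
pose G (w : pathM R d) : R := g w + (A * dlt + 2 * A * J w).
have mJ2 : measurable_fun setT (fun w => A * dlt + 2 * A * J w).
  by apply: measurable_funD => //; apply: measurable_funM.
have J2B w : `|A * dlt + 2 * A * J w| <= A * dlt + 2 * A.
  have /andP[j0 j1] := JB w; rewrite ger0_norm; last by nneg.
  by rewrite lerD2l ler_piMr//; nneg.
have mG : measurable_fun setT G by exact: measurable_funD.
have GB w : `|G w| <= A + (A * dlt + 2 * A).
  by apply: le_trans (ler_normD _ _) _; apply: lerD => //; exact: gB.
have fB x : `|f x| <= N := BD_le x Hf.
have FT : <<s cyl_upto (ratr s)%:E >> [set: pathM R d] by exact: (@measurableT _ (g_sigma_algebraType (@cyl_upto R d (ratr s)%:E))).
have sh : ratr s <= ratr s + h by rewrite lerDl.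
have := mp_le Pmp Cf fB gc s0 sh FT mG GB.
have HG w u : setT w -> ratr s <= u <= ratr s + h -> generator b f (cpath_fun w u) <= G w.
  move=> _ Hu; have [Ow|nOw] := pselect (O w).
    rewrite /G /g -lerBlDl; apply: le_trans (ler_norm _) _.
    have := gL (cpath_fun w (ratr s)) (cpath_fun w u - cpath_fun w (ratr s)); rewrite [cpath_fun w (ratr s) + _]addrC subrK.
    move=> /le_trans; apply; apply: (@le_trans _ _ (A * dlt)); last first.
      by rewrite lerDl; have /andP[] := JB w => *; nneg.
    by apply: ler_wpM2l => //; exact: (modset_le Ow dl0 s0 Hu sT hm).
  have -> : G w = g w + (A * dlt + 2 * A) by rewrite /G /J indicE mem_set ?mulr1.
  have := gB (cpath_fun w u); have := gB (cpath_fun w (ratr s)); rewrite -/(g w) !ler_norml.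
  move=> /andP[u1 u2] /andP[u3 u4]; have : 0 <= A * dlt by nneg.
  by lra.
move=> /(_ HG) /le_trans; apply.
have IJ : Rintegral P setT J <= pr.
  rewrite /Rintegral integral_indic// ?setIT; last exact: measurableC.
  rewrite [X in fine X](probability_setC P)// fineB//; last exact: fin_num_measure.
  by rewrite /=; lra.
have iG1 : P.-integrable setT (EFin \o g) := at_integrable P measurableT s0 gc gB.
have iJ : P.-integrable setT (EFin \o J).
  by apply: (@bounded_integrable _ _ _ _ _ 1) => // w; have /andP[j0 j1] := JB w; rewrite ger0_norm.
have iJ2 : P.-integrable setT (EFin \o (fun w => A * dlt + 2 * A * J w)) by exact: bounded_integrable J2B.
have EG : Rintegral P setT G <= Rintegral P setT g + (A * dlt + 2 * A * pr).
  rewrite /G RintegralD//; rewrite lerD2l RintegralD//; last 2 first.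
  - by apply: (@bounded_integrable _ _ _ _ _ `|A * dlt|).
  - apply: (@bounded_integrable _ _ _ _ _ (2 * A)) => //; first exact: measurable_funM.
    by move=> w; have /andP[j0 j1] := JB w; rewrite ger0_norm ?ler_piMr//; nneg.
  rewrite Rintegral_cst// RintegralZl//= probability_setT mulr1 lerD2l ler_wpM2l//; nneg.
have cf : continuous f := Lip_continuous fD.
have iF : P.-integrable setT (EFin \o (fun w => f (cpath_fun w (ratr s)))) := at_integrable P measurableT s0 cf fB.
pose er := C4 * N * dl ^+ 3 + h * (d%:R * (e1 * D)).
have key x : f x + h * generator b f x <= Qop a dl psi f x + er.
  have e2 : generator b f x = generator (drift a psi) f x - dotr (drift a psi x - b x) (grad f x).
    rewrite /generator -addrA; congr (_ + _); rewrite /dotr -sumrB; apply: eq_bigr => i _.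
    have -> : (drift a psi x - b x) 0 i = drift a psi x 0 i - b x 0 i by rewrite mxE [(- b x) 0 i]mxE.
    by ring.
  have e3 : `|dotr (drift a psi x - b x) (grad f x)| <= d%:R * (e1 * D).
    apply: le_trans (ler_norm_sum _ _ _) _.
    rewrite [leRHS]mulr_natl -[X in _ *+ X]card_ord -sumr_const; apply: ler_sum => i _.
    rewrite normrM; apply: ler_pM => //; rewrite mxE; apply: derive_lip_le.
      exact: BD_derivable Hf.
    move=> t; apply: le_trans (fD _ _) _; apply: ler_wpM2l => //.
    by rewrite normrZ ler_piMr// norm_ebasis_le.
  have := HQ x; rewrite e2 -hE ler_norml => /andP[q1 _].
  have : h * - dotr (drift a psi x - b x) (grad f x) <= h * (d%:R * (e1 * D)).
    by rewrite ler_wpM2l//; apply: le_trans (ler_norm _) _; rewrite normrN.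
  by rewrite /er mulrBr mulrN; lra.
have cQ : continuous (Qop a dl psi f) := BD_continuous (BD_leq (isT : (1 <= 3)%N) HQf).
have iQ : P.-integrable setT (EFin \o (fun w => Qop a dl psi f (cpath_fun w (ratr s)))) :=
  at_integrable P measurableT s0 cQ (fun x => BD_le x HQf).
have iC (k : R) : P.-integrable setT (EFin \o (fun=> k)) by apply: (@bounded_integrable _ _ _ _ _ `|k|).
have ihg : P.-integrable setT (EFin \o (fun w => h * g w)).
  apply: (@bounded_integrable _ _ _ _ _ (h * A)) => //; first exact: measurable_funM.
  by move=> w; rewrite normrM (ger0_norm h0) ler_wpM2l// gB.
have : Rintegral P setT (fun w => f (cpath_fun w (ratr s)) + h * g w) <=
   Rintegral P setT (fun w => Qop a dl psi f (cpath_fun w (ratr s)) + er).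
  apply: le_Rintegral => //.
    by rewrite (_ : EFin \o _ = ((EFin \o (fun w => f (cpath_fun w (ratr s)))) \+ (EFin \o (fun w => h * g w)%R))%E)//; exact: integrableD.
  by rewrite (_ : EFin \o _ = ((EFin \o (fun w => Qop a dl psi f (cpath_fun w (ratr s)))) \+ (EFin \o (fun=> er)))%E)//; exact: integrableD.
rewrite RintegralD// RintegralD// RintegralZl// Rintegral_cst//= probability_setT mulr1 => H1.
have H2 : (ratr s + h - ratr s) * Rintegral P setT G <= h * (Rintegral P setT g + (A * dlt + 2 * A * pr)).
  by rewrite addrAC subrr add0r ler_wpM2l.
have -> : h * (C4 * N * dl + d%:R * (e1 * D) + A * dlt + 2 * A * pr) = er + h * (A * dlt + 2 * A * pr).
  by rewrite /er hE; ring.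
by move: H2; rewrite mulrDr; lra.
Qed.

(** The [k]-th iterate is evaluated after [n - k] time steps, and each induction step trades one for
    the other. The order of choices matters: [D] depends on the constants of [weight] alone; it
    fixes the admissible drift error [e1], hence [psi] and [Mb]; these fix the derivative bound
    [N3], then [dlt], [pr] and the modulus [m]; [M] comes last. *)
Lemma chain_comparison (t : nat) f (N r M0 e : R) : (0 < t)%N -> 0 < e -> BD 3 N f ->
  (forall x, r < `|x| -> f x = 0) ->
  (forall M : nat, M0 <= M%:R -> [/\ (0 < M)%N, M%:R^-1 * norm1 a <= 1 &
     M%:R^-1 ^+ 2 * driftC a c c^-1 pL pK <= 1 / 2]) ->
  exists (M : nat) psi, [/\ M0 <= M%:R, weight c c^-1 pL pK psi &
    Rintegral P setT (fun w => f (cpath_fun w t%:R)) <=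
      iter (t * M ^ 2) (Qop a M%:R^-1 psi) f 0 + e].
Proof.
move=> t0 e0 Hf f0 HM; have N0 := BD_ge0 Hf.
have tp : (0 : R) < t%:R by rewrite ltr0n.
have c0 : 0 < c by exact: expR_gt0.
have L0 : 0 <= pL by exact: (potL_ge0 _ grad_bnd).
have K0 : 0 <= pK by exact: (potK_ge0 _ _ grad_bnd).
(* A quarter of [e] for each of the four errors, spread over the total time [t]. *)
pose et := e / 4 / t%:R; have et0 : 0 < et by rewrite !divr_gt0.
pose D := expR (t%:R * lipC c c^-1 pL pK) * (d%:R * N).
have D0 : 0 <= D by rewrite /D; nneg.
have frac (z : R) : 0 <= z -> z * (et / (z + 1)) <= et.
  by move=> z0; rewrite mulrCA ler_piMr// ?(ltW et0)// ler_pdivrMr ?mul1r; lra.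
have dD : 0 <= d%:R * D by nneg.
pose e1 := et / (d%:R * D + 1); have e10 : 0 < e1 by rewrite divr_gt0// ltr_wpDl.
have [psi [Mb [W Hb Hdr]]] := drift_approx phi_bnd phi_diff grad_bnd grad_lip lambda l e10.
have [W1 W2 W3 W4] := W.
have [C3 [C30 HC3]] := Qn_BD a Mb c0.
have [C4 [C40 HC4]] := Q_taylor a Mb c0.
pose N3 := C3 * N * expR (C3 * t%:R); have N30 : 0 <= N3 by rewrite /N3; nneg.
pose A := genC (d := d) driftB * N3.
have A0 : 0 <= A by apply: mulr_ge0 => //; apply: genC_ge0; exact: driftB_ge0.
pose dlt := et / (A + 1); have dlt0 : 0 < dlt by rewrite divr_gt0// ltr_wpDl.
have A20 : 0 <= 2 * A by nneg.
pose pr := et / (2 * A + 1); have pr0 : 0 < pr by rewrite divr_gt0// ltr_wpDl.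
have [m Hm] := modset_prob P (t%:R + 2) dlt0 pr0.
pose X := `|M0| + C4 * N3 / et + m.+1%:R.
have X0 : 0 <= X by rewrite /X; nneg.
pose M := Num.bound X; have MX : X < M%:R by exact: archi_boundP.
have X1 : 0 <= C4 * N3 / et by nneg.
have MM0 : M0 <= M%:R by have := ler_norm M0; move: MX; rewrite /X; have : (0 : R) <= m.+1%:R by []; lra.
have [M1 dla dlc] := HM _ MM0.
exists M, psi; split => //; set dl := M%:R^-1 in dla dlc *.
have Mp : (0 : R) < M%:R by rewrite ltr0n.
have dl0 : 0 < dl by rewrite invr_gt0.
have dl1 : dl <= 1 by rewrite invf_le1// ler1n.
pose h := dl ^+ 2; have h0 : 0 < h by rewrite exprn_gt0.
have hdl : h <= dl by rewrite /h expr2 ler_piMl// ltW.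
have hm : h < m.+1%:R^-1.
  apply: le_lt_trans hdl _; rewrite ltf_pV2 ?posrE//; apply: le_lt_trans MX.
  by rewrite /X lerDr; nneg.
have C4dl : C4 * N3 * dl <= et.
  rewrite ler_pdivrMr// -ler_pdivrMl// [leLHS]mulrC; apply: le_trans (ltW MX).
  by rewrite /X addrAC lerDr; nneg.
set n := (t * M ^ 2)%N.
have nh : n%:R * h = t%:R by rewrite natrM natrX -mulrA -exprMn divff ?expr1n ?mulr1// gt_eqF.
have SS2 := SSpsi_ge2 c0 L0 K0 W dl0 dla dlc.
pose v k := iter k (Qop a dl psi) f.
have kh k : (k <= n)%N -> k%:R * h <= t%:R by move=> kn; rewrite -nh ler_wpM2r ?(ltW h0)// ler_nat.
have vB k : (k <= n)%N -> BD 3 N3 (v k).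
  move=> kn; apply: BD_weaken (HC3 dl psi dl0 dla Hb W1 SS2 k _ _ Hf).
  by rewrite ler_wpM2l ?mulr_ge0// ler_expR ler_wpM2l// kh.
have vL k : (k <= n)%N -> Lip D (v k).
  move=> kn x u.
  have Lf : Lip (d%:R * N) f by move=> y z; exact: (BD_lipschitz y z (BD_leq (isT : (1 <= 3)%N) Hf)).
  have dN : 0 <= d%:R * N by nneg.
  apply: le_trans (Qn_lip c0 L0 K0 W dl0 dla dlc k dN Lf x u) _.
  rewrite ler_wpM2r// ler_wpM2r// ler_expR mulrA ler_wpM2r ?kh//.
  exact: (lipC_ge0 c0 L0 K0 W).
have vC k : (k <= n)%N -> Cc2 (v k).
  by move=> kn; apply: (BD_Cc2 (r := r + k%:R * dl) (vB k kn)) => x; exact: (Qn_support _ _ dl0 f0).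
suff H k : (k <= n)%N -> Rintegral P setT (fun w => f (cpath_fun w t%:R)) <=
    Rintegral P setT (fun w => v k (cpath_fun w ((n - k)%:R * h))) + k%:R * (h * (4 * et)).
  have := H n (leqnn n); rewrite subnn mul0r mulrA nh.
  rewrite (expect_start (BD_continuous (BD_leq (isT : (1 <= 3)%N) (vB n (leqnn n)))) (fun x => BD_le x (vB n (leqnn n)))).
  have -> : t%:R * (4 * et) = e by rewrite /et; field; rewrite gt_eqF.
  by [].
elim: k => [_|k IH kn]; first by rewrite subn0 nh mul0r addr0.
apply: le_trans (IH (ltnW kn)) _.
pose s : rat := (n - k.+1)%:R / (M ^ 2)%:R.
have sE : ratr s = (n - k.+1)%:R * h :> R.
  by rewrite /s fmorph_div /= !ratr_nat natrX /h /dl exprVn.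
have sE2 : (n - k)%:R * h = ratr s + h.
  by rewrite sE -[X in _ + X]mul1r -mulrDl natr1 -subSn.
have s0 : 0 <= (ratr s : R) by rewrite sE mulr_ge0// ltW.
have sT : ratr s + h < t%:R + 2.
  by rewrite -sE2; have := kh (n - k)%N (leq_subr _ _); lra.
have := one_step (vB k (ltnW kn)) (vB k.+1 kn) (vC k (ltnW kn)) (vL k (ltnW kn)) D0 erefl (ltW dlt0) C40 M1 erefl
  Hdr (fun x => HC4 dl psi dl0 dl1 dla (BD_leq (isT : (2 <= 5)%N) Hb) W1 SS2 N3 (v k) x (vB k (ltnW kn))) Hm s0 sT hm.
rewrite -/h -sE2 -sE => H.
apply: le_trans (lerD H (lexx _)) _.
rewrite -addrA; apply: lerD; first exact: lexx.
rewrite -[k.+1%:R]natr1 [leRHS]mulrDl mul1r [leRHS]addrC; apply: lerD; last exact: lexx.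
apply: ler_wpM2l; first exact: ltW.
have F1 : d%:R * (e1 * D) <= et by rewrite [e1 * D]mulrC mulrA; exact: frac.
have F2 : A * dlt <= et by exact: frac.
have F3 : 2 * A * pr <= et by exact: frac.
have -> : 4 * et = et + et + et + et by ring.
by apply: lerD F3; apply: lerD F2; exact: lerD.
Qed.

End Comparison.

(** * Hitting half spaces *)

Section Cutoff.
Context {R : realType} {d : nat}.
Implicit Types (i : 'I_d) (x y v l : 'rV[R]_d) (f g u : 'rV[R]_d -> R) (b : 'rV[R]_d -> 'rV[R]_d).

Lemma Lip_min (L : R) f g : Lip L f -> Lip L g -> Lip L (fun x => Num.min (f x) (g x)).
Proof.
move=> Hf Hg x v; have := Hf x v; have := Hg x v; rewrite !ler_norml.
move: (L * _) (f (x + v)) (g (x + v)) (f x) (g x) => k a1 b1 a2 b2 /andP[h1 h2] /andP[h3 h4].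
by case: (leP a1 b1) => ?; case: (leP a2 b2) => ?; apply/andP; split; lra.
Qed.

Lemma Lip_max (L : R) f g : Lip L f -> Lip L g -> Lip L (fun x => Num.max (f x) (g x)).
Proof.
move=> Hf Hg x v; have := Hf x v; have := Hg x v; rewrite !ler_norml.
move: (L * _) (f (x + v)) (g (x + v)) (f x) (g x) => k a1 b1 a2 b2 /andP[h1 h2] /andP[h3 h4].
by case: (leP a1 b1) => ?; case: (leP a2 b2) => ?; apply/andP; split; lra.
Qed.

Lemma Lip_cst (L c : R) : 0 <= L -> Lip L (fun _ : 'rV[R]_d => c).
Proof. by move=> L0 x v; rewrite subrr normr0 mulr_ge0. Qed.

(** A truncated ramp of width [r], smoothed at scale 1. Its first and second derivatives are at most
    three times the Lipschitz constant of the ramp, so a long ramp has a small generator. The reach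
    [r1] depends neither on the level [al] nor on the radius [Rr]. *)
Lemma cutoff (B : R) : (0 < d)%N -> 0 <= B -> exists r1 : R, 0 <= r1 /\
  forall l (al Rr : R), enorm l = 1 -> exists u (N r : R),
  [/\ BD 3 N u, forall x, r < `|x| -> u x = 0, forall x, 0 <= u x <= 1,
     forall x, dotr x l <= - al -> `|x| <= Rr -> u x = 1 &
     (forall x, u x != 0 -> dotr x l <= r1 - al) /\
     (forall b x, (forall i, `|b x 0 i| <= B) -> `|generator b u x| <= 1 / 2)].
Proof.
move=> d0 B0; have d1 : 1 <= d%:R :> R by rewrite ler1n.
have dp : 0 < d%:R :> R by rewrite ltr0n.
pose sz : R := (6 * d)%:R; have sz0 : 0 <= sz by [].
(* Chosen so that [d * (3 * (d / r) * (1 + B)) = 1 / 2]. *)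
pose r := 6 * d%:R ^+ 2 * (1 + B).
have r0 : 0 < r by rewrite /r !mulr_gt0 ?exprn_gt0//; lra.
pose r1 := r + 2 * (d%:R * sz); have r10 : 0 <= r1 by rewrite /r1; have := ltW r0 => ?; nneg.
exists r1; split=> // l al Rr l1.
have nl : norm1 l <= d%:R by apply: le_trans (norm1_le_enorm l) _; rewrite l1 mulr1.
have dl x y : dotr x l <= dotr y l + d%:R * `|x - y|.
  have -> : x = y + (x - y) by rewrite addrC subrK.
  rewrite dotrC dotrDr -[X in _ <= dotr X l + _]/y [dotr l y]dotrC (addrC y) addrK lerD2l.
  apply: le_trans (ler_norm _) _; apply: le_trans (dotr_norm_le _ _) _.
  by rewrite ler_wpM2r.
pose L := d%:R / r; have L0 : 0 <= L by rewrite /L divr_ge0// ltW.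
(* [sz] is the reach of the averages; the margins [d * sz] and [sz] keep [p] and [q] at least 1 at
   all points seen from the region where [u] must be 1. *)
pose p x := (r + d%:R * sz - al - dotr x l) / r.
pose q x := (Rr + sz + r - `|x|) / r.
have pL : Lip L p.
  move=> x v; rewrite /p -mulrBl normrM normfV (gtr0_norm r0) /L mulrAC ler_wpM2r ?invr_ge0 ?(ltW r0)//.
  have := dl (x + v) x; have := dl x (x + v).
  rewrite opprD addrA subrr add0r normrN [x + v - x]addrAC subrr add0r ler_norml => h1 h2.
  by apply/andP; split; lra.
have qL : Lip L q.
  move=> x v; rewrite /q -mulrBl normrM normfV (gtr0_norm r0) /L mulrAC ler_wpM2r ?invr_ge0 ?(ltW r0)//.
  apply: (@le_trans _ _ `|v|); last by rewrite ler_peMl.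
  have -> : Rr + sz + r - `|x + v| - (Rr + sz + r - `|x|) = `|x| - `|x + v| by ring.
  apply: le_trans (ler_dist_dist _ _) _.
  by rewrite opprD addrA subrr add0r normrN.
pose g x := Num.max 0 (Num.min 1 (Num.min (p x) (q x))).
have gL : Lip L g by apply: Lip_max; [exact: Lip_cst|apply: Lip_min; [exact: Lip_cst|exact: Lip_min]].
have g01 x : 0 <= g x <= 1.
  by rewrite /g le_max lexx /= ge_max ler01 ge_min lexx.
pose u := St 1 (spread (d := d)) g.
have szE : 1 * (size (spread (d := d)))%:R = sz by rewrite mul1r size_spread.
have HB : BD 3 ((1 + 2 / 1) ^+ 3 * 1) u.
  apply: (St_BD ltr01 _ gL) => [i|x]; first by rewrite count_spread.
  by case/andP: (g01 x) => g0 g1; rewrite ger0_norm.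
exists u, ((1 + 2 / 1) ^+ 3 * 1), (Rr + 2 * sz + r); split => //.
- move=> x Hx; apply: (St_local ltr01 gL) => y; rewrite szE => yx.
  apply/eqP; rewrite eq_le; case/andP: (g01 y) => -> _; rewrite andbT /g ge_max lexx /= !ge_min.
  have -> : (q y <= 0) by rewrite /q ler_pdivrMr// mul0r; have := lerB_dist x y; rewrite distrC; lra.
  by rewrite !orbT.
- have g0 y : 0 <= g y by case/andP: (g01 y).
  have g1 y : g y <= 1 by case/andP: (g01 y).
  by move=> x; apply/andP; split; [exact: St_ge gL g0|exact: St_le gL g1].
- move=> x xl xR; apply: (St_local ltr01 gL) => y; rewrite szE => yx.
  have h1 : 1 <= p y.
    rewrite /p ler_pdivlMr// mul1r; have := dl y x; have : d%:R * `|y - x| <= d%:R * sz by rewrite ler_wpM2l.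
    by move: xl; lra.
  have h2 : 1 <= q y.
    rewrite /q ler_pdivlMr// mul1r; have : `|y| <= `|x| + `|y - x|.
      by rewrite -{1}(subrK x y) addrC ler_normD.
    by move: xR yx; lra.
  by rewrite /g (min_idPl _) ?le_min ?h1 ?h2// (max_idPr _).
split=> [x|b x bB].
- apply: contraNP => /negP; rewrite -ltNge => Hx; apply/eqP; apply: (St_local ltr01 gL) => y; rewrite szE => yx.
  apply/eqP; rewrite eq_le; case/andP: (g01 y) => -> _; rewrite andbT /g ge_max lexx /= !ge_min.
  have -> : (p y <= 0).
    rewrite /p ler_pdivrMr// mul0r; have := dl x y.
    have : d%:R * `|x - y| <= d%:R * sz by rewrite ler_wpM2l// distrC.
    by move: Hx; rewrite /r1; lra.
  by rewrite !orbT.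
have HP i : BD 1 ((1 + 2 / 1) ^+ 1 * L) (partial i u).
  by apply: (St_BD_partial ltr01 _ _ gL) => j; rewrite count_spread.
rewrite generatorE.
have E3 : (1 + 2 / 1) ^+ 1 * L = 3 * L by rewrite expr1; congr (_ * _); lra.
apply: (@le_trans _ _ (d%:R * (3 * L * (1 + B)))).
  apply: sum_norm_le => i; apply: le_trans (ler_normD _ _) _; rewrite !normrM.
  have := BD_le x (HP i); have := BD_le x (BD_partial i (HP i)); rewrite E3 => h1 h2.
  have h3 : `|b x 0 i| * `|partial i u x| <= B * (3 * L) by apply: ler_pM.
  have -> : `|2^-1 : R| = 2^-1 by rewrite ger0_norm ?invr_ge0.
  by move: h1 h3 L0; set z1 := `|partial i (partial i u) x|; set z2 := `|_| * `|_|; clearbody z1 z2 L; clear; nra.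
rewrite le_eqVlt; apply/orP; left; apply/eqP; rewrite /L /r; field.
by rewrite !gt_eqF//; lra.
Qed.

Lemma generatorN b f (N : R) x : BD 2 N f -> generator b (fun y => -1 * f y) x = - generator b f x.
Proof.
move=> H; rewrite !generatorE -sumrN; apply: eq_bigr => i _.
have pN g (M : R) : BD 1 M g -> partial i (fun y => -1 * g y) = (fun y => -1 * partial i g y).
  by move=> Hg; apply/funext => y; rewrite [LHS]deriveZ//; exact: BD_derivable Hg.
by rewrite (pN _ _ (BD_pred H)) (pN _ _ (BD_partial i H)); ring.
Qed.

End Cutoff.

(** * From fixed times to grids in a unit time interval *)

Section Hitting.
Context {R : realType} {d : nat}.
Variables (b : 'rV[R]_d -> 'rV[R]_d) (P : probability (pathM R d) R) (x0 : 'rV[R]_d).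
Hypothesis Pmp : solves_mp b x0 P.

Definition hit (V : set 'rV[R]_d) (T dlt : R) (m : nat) : set (pathM R d) :=
  [set w | exists j : nat, (j < m)%N /\ V (cpath_fun w (T + j%:R * dlt))].

Lemma hit_filtration (s : \bar R) V (T dlt : R) m : open V -> 0 <= T -> 0 <= dlt ->
  ((T + m.-1%:R * dlt)%:E <= s)%E -> measurable (hit V T dlt m : set (g_sigma_algebraType (@cyl_upto R d s))).
Proof.
move=> oV T0 dl0 Ts; apply: measurable_exists => j.
have [jm|mj] := ltnP j m; last first.
  by rewrite [X in measurable X](_ : _ = set0)//; apply/seteqP; split=> // w [].
apply: measurable_and; apply: open_at_measurable => //; first by rewrite addr_ge0// mulr_ge0.
apply: le_trans Ts; rewrite lee_fin lerD2l ler_wpM2r// ler_nat.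
by case: m jm.
Qed.

(** From the first grid time in [V], where [u = 1], the expectation of [u] loses at most 1/2 until
    [T + 1], so a hit is still visible at the fixed time [T + 1] with weight at least 1/2. *)
Lemma hit_le (u : 'rV[R]_d -> R) (N r : R) V (T dlt : R) m : BD 3 N u -> (forall x, r < `|x| -> u x = 0) ->
  (forall x, 0 <= u x <= 1) -> continuous (generator b u) -> (forall x, `|generator b u x| <= 1 / 2) ->
  open V -> (forall x, V x -> u x = 1) -> 0 <= T -> 0 <= dlt -> m.-1%:R * dlt <= 1 ->
  fine (P (hit V T dlt m)) <= 2 * Rintegral P setT (fun w => u (cpath_fun w (T + 1))).
Proof.
move=> Hu u0 u01 cg gb oV uV T0 dl0.
have cu : continuous u := BD_continuous (BD_leq (isT : (1 <= 3)%N) Hu).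
have uB x : `|u x| <= 1 by case/andP: (u01 x) => a1 a2; rewrite ger0_norm.
have T10 : 0 <= T + 1 by lra.
have mH k : measurable (hit V T dlt k) by apply: hit_filtration => //; rewrite leey.
pose f x := -1 * u x.
have Hf : BD 3 (`|-1| * N) f by exact: BD_scale.
have Cf : Cc2 f by apply: (BD_Cc2 (r := r) Hf) => x rx; rewrite /f u0// mulr0.
have fB x : `|f x| <= 1 by rewrite /f mulN1r normrN.
have gE : generator b f = (fun x => - generator b u x).
  by apply/funext => x; exact: (generatorN b x (BD_leq (isT : (2 <= 3)%N) Hu)).
have cgf : continuous (generator b f) by rewrite gE => x; apply: (@continuousN _ _ _ (generator b u)); exact: cg.
have iu (A : set (pathM R d)) : measurable A -> P.-integrable A (EFin \o (fun w => u (cpath_fun w (T + 1)))).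
  by move=> mA; exact: (at_integrable P mA T10 cu uB).
(* The integral is restricted to the hitting event so that the disjoint first-hit events add up. *)
suff H : m.-1%:R * dlt <= 1 ->
    fine (P (hit V T dlt m)) <= 2 * Rintegral P (hit V T dlt m) (fun w => u (cpath_fun w (T + 1))).
  move=> /H/le_trans; apply; rewrite ler_pM2l// -[X in _ <= Rintegral P X _](setUv (hit V T dlt m)).
  rewrite Rintegral_setU//; last 3 first.
  - exact: measurableC.
  - by rewrite setUv; exact: iu.
  - by apply/disj_setPS => w /= [].
  by rewrite lerDl; apply: Rintegral_ge0 => w _; case/andP: (u01 (cpath_fun w (T + 1))).
elim: m => [_|m IH mdl].
  have -> : hit V T dlt 0 = set0 by apply/seteqP; split=> // w [j []].
  by rewrite measure0 Rintegral_set0 mulr0.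
have mdl' : m.-1%:R * dlt <= 1.
  by apply: le_trans mdl; rewrite ler_wpM2r// ler_nat leq_pred.
pose t := T + m%:R * dlt; have t0 : 0 <= t by rewrite addr_ge0// mulr_ge0.
(* First hit at the [m]-th grid time; the event belongs to the past of [t], so the martingale
   problem applies on it. *)
pose A : set (pathM R d) := [set w | V (cpath_fun w t)] `\` hit V T dlt m.
have FA : <<s cyl_upto t%:E >> A.
  apply: (@measurableD _ (g_sigma_algebraType (@cyl_upto R d t%:E))); first exact: open_at_measurable.
  by apply: hit_filtration => //; rewrite lee_fin lerD2l ler_wpM2r// ler_nat leq_pred.
have mA := cyl_upto_measurable FA.
have hE : hit V T dlt m.+1 = hit V T dlt m `|` A.
  apply/seteqP; split=> w /=.
    move=> [j [jm Vj]]; have [Hw|nHw] := pselect (hit V T dlt m w); first by left.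
    right; split=> //; have [jm'|jm'] := ltnP j m; first by exfalso; apply: nHw; exists j.
    by rewrite /t (_ : m = j)//; apply/eqP; rewrite eqn_leq jm' -ltnS.
  case=> [[j [jm Vj]]|[Vw _]]; last by exists m.
  by exists j; split=> //; exact: ltnW.
have dis : [disjoint hit V T dlt m & A].
  by apply/disj_setPS => w /= [Hw [_ nHw]].
have tT : t <= T + 1 by rewrite lerD2l.
have := mp_le (G := fun=> 1 / 2) (Bg := 1 / 2) Pmp Cf fB cgf t0 tT FA (measurable_cst _).
have -> : Rintegral P A (fun w => f (cpath_fun w (T + 1))) = - Rintegral P A (fun w => u (cpath_fun w (T + 1))).
  by rewrite RintegralZl ?mulN1r//; exact: iu.
have -> : Rintegral P A (fun w => f (cpath_fun w t)) = - fine (P A).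
  rewrite -mulN1r -Rintegral_cst//; apply: eq_Rintegral => w; rewrite inE => -[Vw _].
  by rewrite /f uV ?mulr1.
rewrite Rintegral_cst// => H.
have {}H : - Rintegral P A (fun w => u (cpath_fun w (T + 1))) <= - fine (P A) + (T + 1 - t) * (1 / 2 * fine (P A)).
  apply: H => [w|w v _ _]; first by rewrite ger0_norm//; lra.
  by rewrite gE; have := gb (cpath_fun w v); rewrite ler_norml => /andP[]; lra.
have pA0 : 0 <= fine (P A) by apply: fine_ge0.
have H2 : (T + 1 - t) * (1 / 2 * fine (P A)) <= 1 / 2 * fine (P A).
  rewrite ler_piMl; [by []|lra|]; rewrite /t; have : 0 <= m%:R * dlt by rewrite mulr_ge0.
  lra.
rewrite hE Rintegral_setU//; last by apply: iu; exact: measurableU.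
rewrite measureU//; last by apply/seteqP; split=> // w /= [Hw [_ nHw]].
rewrite fineD ?fin_num_measure// mulrDr; apply: lerD; first exact: IH.
by lra.
Qed.

End Hitting.

(** * Exit from the slab *)

Section Exit.
Context {R : realType} {d : nat}.
Implicit Types (l : 'rV[R]_d) (w : pathM R d) (b L T : R).

Lemma dotr_continuous l : continuous (fun x : 'rV[R]_d => dotr x l).
Proof.
apply: (@lipschitz_continuous _ _ _ (norm1 l)) => x v.
rewrite ![dotr _ l]dotrC dotrDr [dotr l x + _]addrC addrK; exact: dotr_norm_le.
Qed.

Lemma path_dotr_continuous l w : continuous (fun t => dotr (cpath_fun w t) l).
Proof.
move=> t; apply: (@continuous_comp _ _ _ (cpath_fun w) (fun x => dotr x l)); first exact: cpath_cont.
exact: dotr_continuous.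
Qed.

Lemma exit_time_outside l b L w T : exit_time (slab l b L) w = T%:E -> ~ slab l b L (cpath_fun w T).
Proof.
move=> HT /andP[s1 s2].
have n1 : nbhs T [set t | - (b * L) < dotr (cpath_fun w t) l].
  exact: cvgr_gt (@path_dotr_continuous l w T) _ s1.
have n2 : nbhs T [set t | dotr (cpath_fun w t) l < L].
  exact: cvgr_lt (@path_dotr_continuous l w T) _ s2.
have /nbhs_ballP[e /= e0 He] : nbhs T ([set t | - (b * L) < dotr (cpath_fun w t) l] `&`
    [set t | dotr (cpath_fun w t) l < L]) by exact: filterI.
have : ((T + e)%:E <= exit_time (slab l b L) w)%E.
  apply: le_ereal_inf_tmp => _ [t [t0 tN] <-]; rewrite lee_fin.
  have Tt : T <= t.
    by rewrite -lee_fin -HT; apply: ereal_inf_lbound; exists t.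
  rewrite leNgt; apply/negP => tTe; apply: tN; apply/andP.
  have := He t; rewrite -ball_normE /= => H; apply: H.
  by rewrite ltr_norml; lra.
by rewrite HT lee_fin; lra.
Qed.

(** Removes the infimum: by continuity the path is outside the slab at the exit time, and a negative
    level there means the lower side. *)
Lemma exit_negP l b L w : 0 < b -> 0 < L -> exit_neg l b L w <->
  exists T, [/\ 0 <= T, dotr (cpath_fun w T) l <= - (b * L) &
    forall s, 0 <= s <= T -> dotr (cpath_fun w s) l < L].
Proof.
move=> b0 L0; have bL : 0 < b * L by exact: mulr_gt0.
have out x : ~ slab l b L x -> dotr x l < L -> dotr x l <= - (b * L).
  by move=> ns xL; rewrite leNgt; apply/negP => h; apply: ns; rewrite /slab /= h xL.
have lb0 : (0%:E <= exit_time (slab l b L) w)%E.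
  by apply: le_ereal_inf_tmp => _ [t [t0 _] <-]; rewrite lee_fin.
split=> [[T [HT gT]]|[T [T0 gT HL]]].
  have T0 : 0 <= T by rewrite -lee_fin -HT.
  have gTL : dotr (cpath_fun w T) l < L by exact: lt_trans L0.
  exists T; split=> //; first by apply: out => //; exact: exit_time_outside.
  move=> s /andP[s0]; rewrite le_eqVlt => /predU1P[->//|sT].
  apply: contrapT => sL; have : (exit_time (slab l b L) w <= s%:E)%E.
    by apply: ereal_inf_lbound; exists s => //; split=> //; rewrite /slab /= => /andP[].
  by rewrite HT lee_fin leNgt sT.
have lT : (exit_time (slab l b L) w <= T%:E)%E.
  apply: ereal_inf_lbound; exists T => //; split=> //; rewrite /slab /= => /andP[h _].
  by move: gT; rewrite leNgt h.
have [T' HT'] : exists T', exit_time (slab l b L) w = T'%:E.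
  move: lb0 lT; case: (exit_time _ _) => [r _ _||]; [by exists r|by move=> _; rewrite leye_eq|by rewrite leeNy_eq].
exists T'; split=> //; apply: (@le_lt_trans _ _ (- (b * L))); last by rewrite oppr_lt0.
apply: out; first exact: exit_time_outside.
by apply: HL; rewrite -!lee_fin -HT' lb0.
Qed.

Lemma exit_neg_measurable l b L : 0 < b -> 0 < L -> measurable (exit_neg l b L).
Proof.
move=> b0 L0.
(* [p.1] encodes a margin below the level [L], [p.2] a time horizon, and [k] the precision with
   which [- (b * L)] is approached; only rational times occur. *)
pose G (p : nat * nat) (k : nat) (q : rat) : set (pathM R d) :=
  [set w | 0 <= (ratr q : R) <= p.2%:R /\
     (dotr (cpath_fun w (ratr q)) l < - (b * L) + k.+1%:R^-1 /\
      forall s : rat, 0 <= (ratr s : R) <= ratr q -> dotr (cpath_fun w (ratr s)) l <= L - p.1.+1%:R^-1)].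
rewrite (_ : exit_neg l b L = [set w | exists p, forall k, exists q, G p k q w]).
  apply: measurable_exists => p; apply: measurable_forall => k; apply: measurable_exists => q.
  have [q0|nq] := pselect (0 <= (ratr q : R) <= p.2%:R); last first.
    by rewrite [X in measurable X](_ : _ = set0)//; apply/seteqP; split=> // w [].
  have mg (t : R) : 0 <= t -> measurable_fun [set: pathM R d] (fun w => dotr (cpath_fun w t) l).
    by move=> t0; apply: (@continuous_at_measurable R d +oo%E t (fun x => dotr x l)) => //; [exact: leey|exact: dotr_continuous].
  apply: measurable_and; apply: measurableI.
    have := mg (ratr q); case/andP: (q0) => q1 _ /(_ q1 measurableT [set r | r < - (b * L) + k.+1%:R^-1]).
    rewrite setTI; apply.
    by rewrite (_ : [set _ | _] = `]-oo, (- (b * L) + k.+1%:R^-1)[%classic)//; apply/seteqP; split=> r /=; rewrite in_itv.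
  apply: measurable_forall => s; have [s0|ns] := pselect (0 <= (ratr s : R)); last first.
    by rewrite [X in measurable X](_ : _ = setT)//; apply/seteqP; split=> // w _ /andP[/ns].
  apply: measurable_imp; have := mg (ratr s) s0 measurableT [set r | r <= L - p.1.+1%:R^-1].
  rewrite setTI; apply.
  by rewrite (_ : [set _ | _] = `]-oo, (L - p.1.+1%:R^-1)]%classic)//; apply/seteqP; split=> r /=; rewrite in_itv.
apply/seteqP; split=> w.
  move=> /(exit_negP l w b0 L0)[T [T0 gT HL]].
  have cg := @path_dotr_continuous l w.
  have [s0] := @EVT_max R (fun t => dotr (cpath_fun w t) l) 0 T T0 (continuous_subspaceT cg).
  rewrite in_itv /= => s0T Hs0.
  have gs0 := HL _ s0T.
  (* Up to [T] the margin is [L] minus the maximum; from [T] to the nearby rational [q] the level is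
     negative, so there any margin below [L] will do. *)
  pose mu := Num.min (L - dotr (cpath_fun w s0) l) L.
  have mu0 : 0 < mu by rewrite lt_min subr_gt0 gs0 L0.
  have [m _ /(_ m (leqnn m)) Hm] := near_infty_natSinv_lt (PosNum mu0).
  rewrite /= lt_min in Hm; case/andP: Hm => Hm1 Hm2.
  pose N := Num.bound (T + 1); have NT : T + 1 < N%:R by apply: archi_boundP; lra.
  exists (m, N) => k.
  have gT2 : dotr (cpath_fun w T) l < Num.min (- (b * L) + k.+1%:R^-1) 0.
    rewrite lt_min; apply/andP; split; apply: le_lt_trans gT _; first by rewrite ltrDl invr_gt0.
    by rewrite oppr_lt0 mulr_gt0.
  have /nbhs_ballP[e /= e0 He] : nbhs T [set t | dotr (cpath_fun w t) l < Num.min (- (b * L) + k.+1%:R^-1) 0].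
    exact: cvgr_lt (cg T) _ gT2.
  have lt : T < T + Num.min e 1 by rewrite ltrDl lt_min e0 ltr01.
  have [q] := rat_in_itvoo lt; rewrite in_itv /= -ltrBlDl lt_min => /and3P[Tq qe q1].
  have near u : T <= u <= ratr q -> dotr (cpath_fun w u) l < Num.min (- (b * L) + k.+1%:R^-1) 0.
    move=> /andP[Tu uq]; have := He u; rewrite -ball_normE /=; apply.
    by rewrite ler0_norm; lra.
  exists q; split; first by rewrite /=; apply/andP; split; lra.
  split; first by have := near (ratr q); rewrite lexx (ltW Tq) lt_min => /(_ isT)/andP[].
  move=> s /andP[s0' sq] /=.
  have [sT|Ts] := leP (ratr s : R) T.
    have := Hs0 (ratr s); rewrite in_itv /= s0' sT => /(_ isT) h.
    by move: Hm1 h; set z := m.+1%:R^-1; lra.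
  have := near (ratr s); rewrite (ltW Ts) sq lt_min => /(_ isT)/andP[_ h].
  by move: Hm2 h; set z := m.+1%:R^-1; lra.
move=> [[m N] HG]; apply/(exit_negP l w b0 L0).
have cg := @path_dotr_continuous l w.
pose z : R := m.+1%:R^-1; have z0 : 0 < z by rewrite invr_gt0.
(* Compactness: the witnesses [q] for all [k] lie in the bounded set [S], so the minimum over
   [[0, sup S]] is at most [- (b * L)]. *)
pose S : set R := [set s | [/\ 0 <= s, s <= N%:R & forall u, 0 <= u < s -> dotr (cpath_fun w u) l <= L - z]].
have GS k q : G (m, N) k q w -> S (ratr q).
  move=> [/andP[q0 qN] [_ Hq]]; split=> // u /andP[u0 uq]; rewrite leNgt; apply/negP => h.
  have /nbhs_ballP[e /= e0 He] : nbhs u [set t | L - z < dotr (cpath_fun w t) l].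
    exact: cvgr_gt (cg u) _ h.
  have lt : u < Num.min (ratr q) (u + e) by rewrite lt_min uq ltrDl.
  have [s] := rat_in_itvoo lt; rewrite in_itv /= lt_min => /and3P[us sq se].
  have := He (ratr s); rewrite -ball_normE /= => H.
  have : L - z < dotr (cpath_fun w (ratr s)) l by apply: H; rewrite ltr0_norm; lra.
  by rewrite ltNge Hq//; apply/andP; split; lra.
have hsS : has_sup S.
  by split; [have [q Gq] := HG 0%N; exists (ratr q); exact: GS Gq|exists N%:R => s []].
have S0 : 0 <= sup S.
  have [q Gq] := HG 0%N; have Sq := GS _ _ Gq.
  by apply: le_trans (ub_le_sup hsS.2 Sq); case: Sq.
have [T] := @EVT_min R (fun t => dotr (cpath_fun w t) l) 0 (sup S) S0 (continuous_subspaceT cg).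
rewrite in_itv /= => /andP[T0 TS] HT.
have gT : dotr (cpath_fun w T) l <= - (b * L).
  apply/ler_addgt0Pr => e e0.
  have [k _ /(_ k (leqnn k)) /= Hk] := near_infty_natSinv_lt (PosNum e0).
  have [q Gq] := HG k; have Sq := GS _ _ Gq; have [/andP[q0 _] [gq _]] := Gq.
  have := HT (ratr q); rewrite in_itv /= q0 (ub_le_sup hsS.2 Sq) => /(_ isT) h.
  by move: Hk gq h; rewrite /=; set y := k.+1%:R^-1; lra.
exists T; split=> // s /andP[s0]; rewrite le_eqVlt => /predU1P[->|sT].
  by apply: le_lt_trans gT _; have := mulr_gt0 b0 L0; lra.
have [u [u0 uN Hu] su] := sup_gt hsS.1 (lt_le_trans sT TS).
by have := Hu s; rewrite s0 su => /(_ isT); lra.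
Qed.

(** The bound on the norm lets a compactly supported cutoff equal 1 on this set; it disappears in
    the limit of [k]. *)
Definition deep l (al : R) (k : nat) : set 'rV[R]_d := [set x | dotr x l < - al /\ `|x| < k%:R].

(** Dyadic times of mesh [2^-k], with both ends of each unit interval. On the diagonal [n = k],
    radius, mesh and horizon are refined together and the events increase. *)
Definition grid l (al : R) (k n : nat) : set (pathM R d) :=
  [set w | exists j : nat, (j < n)%N /\ hit (deep l al k) j%:R (2 ^- k) (2 ^ k).+1 w].

Lemma deep_open l al k : open (deep l al k).
Proof.
apply: openI.
  apply: (@open_comp _ _ (fun x => dotr x l) [set r | r < - al]); last exact: open_lt.
  by move=> x _; exact: dotr_continuous.
apply: (@open_comp _ _ (fun x : 'rV[R]_d => `|x|) [set r | r < k%:R]); last exact: open_lt.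
by move=> x _; exact: norm_continuous.
Qed.

Lemma hit_measurable V T (dlt : R) m : open V -> 0 <= T -> 0 <= dlt -> measurable (hit V T dlt m : set (pathM R d)).
Proof. by move=> oV T0 d0; apply: hit_filtration => //; rewrite leey. Qed.

Lemma grid_measurable l al k n : measurable (grid l al k n).
Proof.
apply: measurable_exists => j; apply: measurable_and; apply: hit_measurable => //.
exact: deep_open.
Qed.

Lemma grid_nondecreasing l al : nondecreasing_seq (fun k => grid l al k k).
Proof.
apply/nondecreasing_seqP => k; apply/subsetPset => w [j [jk [i [ik [h1 h2]]]]].
exists j; split; first exact: ltnW.
exists (2 * i)%N; split; first by rewrite expnS ltnS leq_mul2l /= -ltnS.
have -> : (2 * i)%:R * 2 ^- k.+1 = i%:R * 2 ^- k :> R.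
  by rewrite natrM exprS invfM; field; rewrite expf_neq0.
by split=> //; apply: lt_le_trans h2 _; rewrite ler_nat.
Qed.

Lemma exit_neg_grid l b L al : 0 < b -> 0 < L -> al < b * L ->
  exit_neg l b L `<=` \bigcup_k grid l al k k.
Proof.
move=> b0 L0 alb w /(exit_negP l w b0 L0)[T [T0 gT _]].
have gTa : dotr (cpath_fun w T) l < - al by apply: le_lt_trans gT _; rewrite ltrN2.
have n1 : nbhs T [set t | dotr (cpath_fun w t) l < - al].
  exact: cvgr_lt (@path_dotr_continuous l w T) _ gTa.
have cn : continuous (fun t => `|cpath_fun w t|).
  by move=> t; apply: cvg_norm; exact: cpath_cont.
have lt1 : `|cpath_fun w T| < `|cpath_fun w T| + 1 by rewrite ltrDl.
have n2 : nbhs T [set t | `|cpath_fun w t| < `|cpath_fun w T| + 1].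
  exact: cvgr_lt (cn T) _ lt1.
have /nbhs_ballP[e /= e0 He] : nbhs T ([set t | dotr (cpath_fun w t) l < - al] `&`
    [set t | `|cpath_fun w t| < `|cpath_fun w T| + 1]) by exact: filterI.
pose n := Num.truncn T; have /andP[nT Tn] : n%:R <= T < n.+1%:R by exact: truncn_itv.
pose k := (n + Num.bound (`|cpath_fun w T| + 1) + Num.bound e^-1).+1.
have kn : (n < k)%N by rewrite /k ltnS -addnA leq_addr.
have kw : `|cpath_fun w T| + 1 < k%:R.
  apply: lt_le_trans (archi_boundP _) _; first by nneg.
  by rewrite ler_nat /k; lia.
have ke : 2 ^- k < e.
  rewrite invf_plt ?posrE ?exprn_gt0//.
  apply: lt_le_trans (archi_boundP _) _; first by rewrite invr_ge0 ltW.
  rewrite -natrX ler_nat; apply: leq_trans (ltnW (ltn_expl k (leqnn 2))).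
  exact: leqW (leq_addl _ _).
pose z : R := 2 ^+ k; have z0 : 0 < z by rewrite exprn_gt0.
have Tn0 : 0 <= (T - n%:R) * z by rewrite mulr_ge0 ?subr_ge0// ltW.
pose j := Num.truncn ((T - n%:R) * z); have /andP[jl jr] : j%:R <= (T - n%:R) * z < j.+1%:R by exact: truncn_itv.
exists k => //; exists n; split=> //; exists j; split.
  rewrite ltnS -(@ler_nat R) natrX -/z; apply: le_trans jl _; rewrite ler_piMl ?(ltW z0)//.
  by move: Tn; rewrite -natr1; lra.
pose s : R := n%:R + j%:R * 2 ^- k; rewrite -/s.
have zi : 0 < z^-1 by rewrite invr_gt0.
have sT : s <= T by rewrite /s -/z -lerBrDl ler_pdivrMr.
have Ts : T < s + z^-1.
  by rewrite /s -addrA -[X in _ + (_ + X)]mul1r -mulrDl natr1 -ltrBlDl ltr_pdivlMr.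
have : ball T e s.
  by rewrite -ball_normE /= ger0_norm ?subr_ge0//; move: ke Ts; rewrite -/z; lra.
by move=> /He[h1 h2]; split=> //; exact: lt_trans kw.
Qed.

End Exit.

(** * Summation over time and the exit probability *)

Section Decay.
Context {R : realType} {d : nat}.

Lemma geometric_le (q : R) n : 0 <= q -> q < 1 -> \sum_(j < n) q ^+ j.+1 <= (1 - q)^-1.
Proof.
move=> q0 q1; have q1' : 0 < 1 - q by rewrite subr_gt0.
have E : (1 - q) * \sum_(j < n) q ^+ j.+1 = q - q ^+ n.+1.
  elim: n => [|n IH]; first by rewrite big_ord0 mulr0 expr1 subrr.
  by rewrite big_ord_recr /= mulrDr IH [in RHS]exprS; ring.
rewrite -[leRHS]mul1r ler_pdivlMr// mulrC E.
by have := exprn_ge0 n.+1 q0; lra.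
Qed.

(** If [al <= 2 C0 t], half of [k0 t] pays for the decay in [al]. Otherwise [C0 t - al <= - al / 2],
    and [al / 2] pays for both factors, since then [ka t] and [th al] are each at most [al / 4]. *)
Lemma interpolate (C0 k0 t al y CC : R) : 0 < C0 -> 0 < k0 -> 0 < t -> 0 <= al -> 0 <= CC ->
  y <= CC * expR (- (k0 * t)) -> y <= CC * expR (C0 * t - al) ->
  y <= CC * (expR (- (Num.min (k0 / 2) (C0 / 2) * t)) * expR (- (Num.min (k0 / (4 * C0)) 4^-1 * al))).
Proof.
move=> C00 k00 t0 al0 CC0 h1 h2.
set ka := Num.min (k0 / 2) _; set th := Num.min (k0 / (4 * C0)) _.
have ka1 : ka <= k0 / 2 by rewrite ge_min lexx.
have ka2 : ka <= C0 / 2 by rewrite ge_min lexx orbT.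
have th1 : th <= k0 / (4 * C0) by rewrite ge_min lexx.
have th2 : th <= 4^-1 by rewrite ge_min lexx orbT.
have ka1t : ka * t <= k0 / 2 * t by rewrite ler_pM2r.
have ka2t : ka * t <= C0 / 2 * t by rewrite ler_pM2r.
have th2a : th * al <= 4^-1 * al by exact: ler_wpM2r.
rewrite -expRD.
have [alt|alt] := leP al (2 * C0 * t).
  apply: le_trans h1 _; rewrite ler_wpM2l// ler_expR.
  have th1a : th * al <= k0 / (4 * C0) * (2 * C0 * t).
    apply: (@le_trans _ _ (k0 / (4 * C0) * al)); first exact: ler_wpM2r.
    by rewrite ler_wpM2l// divr_ge0// ?mulr_ge0// ltW.
  have E : k0 / (4 * C0) * (2 * C0 * t) = k0 / 2 * t by field; rewrite gt_eqF.
  by move: th1a ka1t; rewrite E; lra.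
apply: le_trans h2 _; rewrite ler_wpM2l// ler_expR; lra.
Qed.

(** The factor decaying in [t] makes the sum over unit time intervals converge uniformly in [k] and
    [n], and the factor decaying in [al] survives. *)
Lemma grid_decay (eta beta K lambda : R) (l : 'rV[R]_d) : (0 < d)%N -> 0 < lambda -> enorm l = 1 ->
  0 <= eta -> 0 <= beta -> exists eps C th : R, [/\ 0 < eps, 0 < C, 0 < th &
  forall l' : 'rV[R]_d, enorm l' = 1 -> enorm (l' - l) < eps ->
  forall phi : 'rV[R]_d -> R, (forall x, `|phi x| <= eta) -> (forall x, differentiable phi x) ->
  (forall x, enorm (grad phi x) <= beta) ->
  (forall y z, enorm (grad phi y - grad phi z) <= K * enorm (y - z)) ->
  forall P : probability (pathM R d) R, solves_mp (fun y => grad phi y + lambda *: l) 0 P ->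
  forall (al : R) k n, 0 <= al -> (P (grid l' al k n) <= (C * expR (- (th * al)))%:E)%E].
Proof.
move=> d0 lam0 l1 eta0 beta0.
set c := expR (- eta); have c0 : 0 < c by exact: expR_gt0.
have c1 : c <= 1 by rewrite /c -expR0 ler_expR oppr_le0.
have ci0 : 0 <= c^-1 by rewrite invr_ge0 ltW.
have L0 : 0 <= potL (d := d) eta beta by rewrite /potL; nneg.
have K0 : 0 <= potK (d := d) eta beta K by rewrite /potK; nneg.
have B0 : 0 <= driftB (d := d) beta K lambda l by rewrite /driftB; nneg.
have [eps [C0 [k0 [M0 [eps0 C00 k00 Hdec]]]]] := chain_decay d0 lam0 l1 c0 c1 L0 K0.
have [r1 [r10 Hcut]] := cutoff d0 B0.
(* The cutoff reaches up to [r1] above the level [- al]; this shift costs at most [exp(C0 r1)] in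
   the first bound and [exp r1] in the second. *)
pose CC := C0 * expR ((C0 + 1) * r1).
have CC0 : 0 < CC by rewrite mulr_gt0// expR_gt0.
pose ka := Num.min (k0 / 2) (C0 / 2); pose th := Num.min (k0 / (4 * C0)) 4^-1.
have ka0 : 0 < ka by rewrite lt_min !divr_gt0.
have th0 : 0 < th by rewrite lt_min; apply/andP; split; [apply: divr_gt0 => //; exact: mulr_gt0|rewrite invr_gt0].
pose q := expR (- ka); have q0 : 0 <= q by exact: expR_ge0.
have q1 : q < 1 by rewrite /q -expR0 ltr_expR oppr_lt0.
pose C := 2 * CC * (1 - q)^-1.
have C0' : 0 < C by apply: mulr_gt0; [exact: mulr_gt0|rewrite invr_gt0 subr_gt0].
exists eps, C, th; split=> // l' l'1 l'eps phi phi_bnd phi_diff grad_bnd grad_lip P Pmp al k n al0.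
set b := fun y => _ in Pmp.
pose bd j := 2 * CC * (q ^+ j.+1 * expR (- (th * al))).
have mg j : measurable (hit (deep l' al k) j%:R (2 ^- k) (2 ^ k).+1).
  by apply: hit_measurable => //; exact: deep_open.
have step j : (P (hit (deep l' al k) j%:R (2 ^- k) (2 ^ k).+1) <= (bd j)%:E)%E.
  rewrite -[X in (X <= _)%E]fineK ?fin_num_measure// lee_fin.
  have [u [N [r [Hu ur u01 u1 [usup ugen]]]]] := Hcut l' al k%:R l'1.
  have bB x i : `|b x 0 i| <= driftB (d := d) beta K lambda l by exact: (drift_bound K lambda l grad_bnd).
  have cg : continuous (generator b u).
    apply: Lip_continuous (generator_lip B0 bB _ Hu) => x v i.
    exact: (drift_lip lambda l grad_bnd grad_lip).
  apply: le_trans (hit_le Pmp Hu ur u01 cg (fun x => ugen b x (bB x)) (@deep_open _ _ l' al k) _ _ _ _) _ => //.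
  - by move=> x [x1 x2]; apply: u1; exact: ltW.
  - by rewrite /= natrX divff// gt_eqF// exprn_gt0.
  rewrite /bd -mulrA ler_pM2l// natr1.
  apply/ler_addgt0Pr => e e0.
  (* These conditions on [M] do not involve the test function, so they are read off with the
     function 0. *)
  have HM (M : nat) : M0 <= M%:R -> [/\ (0 < M)%N, M%:R^-1 * norm1 (lambda *: l) <= 1 &
     M%:R^-1 ^+ 2 * driftC (lambda *: l) c c^-1 (potL (d := d) eta beta) (potK (d := d) eta beta K) <= 1 / 2].
    move=> MM; have [] := Hdec l' l'1 l'eps M 1 (fun x => expR (phi x)) (fun=> 0) MM isT _ _ => //.
      exact: potential_weight.
    by move=> x; rewrite lexx ler01.
  have [M [psi [MM W H]]] := chain_comparison phi_bnd phi_diff grad_bnd grad_lip Pmp (ltn0Sn j) e0 Hu ur HM.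
  apply: le_trans H _; rewrite lerD2r.
  have [_ _ _ H1 H2] := Hdec l' l'1 l'eps M j.+1 psi u MM isT W u01.
  have t0 : (0 : R) < j.+1%:R by rewrite ltr0n.
  have -> : q ^+ j.+1 = expR (- (ka * j.+1%:R)) by rewrite /q -expRM_natl; congr expR; ring.
  apply: (interpolate C00 k00 t0 al0 (ltW CC0)).
    apply: le_trans (H1 r1 r10 _) _; first by move=> x /usup; lra.
    rewrite ler_wpM2r ?expR_ge0// /CC ler_pM2l// ler_expR mulrDl mul1r; lra.
  apply: le_trans (H2 (al - r1) _) _; first by move=> x /usup; lra.
  rewrite /CC -mulrA ler_pM2l// -expRD ler_expR.
  have : 0 <= C0 * r1 by rewrite mulr_ge0// ltW.
  by lra.
have : (P (grid l' al k n) <= (\sum_(j < n) bd j)%:E)%E.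
  elim: n => [|n IH].
    have -> : grid l' al k 0 = set0 by apply/seteqP; split=> // w [j []].
    by rewrite measure0 big_ord0.
  have -> : grid l' al k n.+1 = grid l' al k n `|` hit (deep l' al k) n%:R (2 ^- k) (2 ^ k).+1.
    apply/seteqP; split=> w /=.
      move=> [j [jn Hj]]; move: jn; rewrite ltnS leq_eqVlt => /predU1P[<-|jn]; first by right.
      by left; exists j.
    by case=> [[j [jn Hj]]|Hn]; [exists j; split=> //; exact: ltnW|exists n].
  rewrite big_ord_recr /= EFinD; have gm : measurable (grid l' al k n) by exact: grid_measurable.
  have := measureU2 P gm (mg n) => /le_trans; apply.
  by apply: leeD => //; exact: step.
move=> /le_trans; apply; rewrite lee_fin /bd -mulr_sumr -mulr_suml mulrA /C.
apply: ler_wpM2r; first exact: expR_ge0.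
by apply: ler_wpM2l; [apply: mulr_ge0 => //; exact: ltW|exact: geometric_le].
Qed.

Lemma exit_decay (P : probability (pathM R d) R) (l : 'rV[R]_d) (b L al C : R) : 0 < b -> 0 < L -> al < b * L ->
  (forall k n, P (grid l al k n) <= C%:E)%E -> (P (exit_neg l b L) <= C%:E)%E.
Proof.
move=> b0 L0 alb H.
have mG k : measurable (grid l al k k) by exact: grid_measurable.
have mU := bigcupT_measurable _ mG.
apply: (@le_trans _ _ (P (\bigcup_k grid l al k k))).
  by apply: le_measure; rewrite ?inE//; [exact: exit_neg_measurable|exact: exit_neg_grid].
have := nondecreasing_cvg_mu (mu := P) mG mU (@grid_nondecreasing _ _ l al).
by move=> /cvge_to_le; apply; apply: nearW => k /=; exact: H.
Qed.

End Decay.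

Theorem theorem4p1 (R : realType) (d : nat) (hd : (1 <= d)%N)
  (dO : measure_display) (Omega : measurableType dO) (P : probability Omega R)
  (tr : 'rV[R]_d -> Omega -> Omega)
  (tr0 : forall w, tr 0 w = w)
  (trD : forall x y w, tr (x + y) w = tr x (tr y w))
  (tr_meas : measurable_fun [set: (rVM R d * Omega)%type]
               (fun p : (rVM R d * Omega)%type => tr p.1 p.2))
  (tr_pres : forall x (A : set Omega), measurable A -> P (tr x @^-1` A) = P A)
  (phi : Omega -> R) (phi_meas : measurable_fun [set: Omega] phi)
  (eta beta K : R)
  (phi_bnd : forall x w, `|phi (tr x w)| <= eta)
  (phi_diff : forall w x, differentiable (fun y => phi (tr y w)) x)
  (grad_bnd : forall w x, enorm (grad (fun y => phi (tr y w)) x) <= beta)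
  (grad_lip : forall w y z,
     enorm (grad (fun y => phi (tr y w)) y - grad (fun y => phi (tr y w)) z)
       <= K * enorm (y - z))
  (lambda : R) (lambda_gt0 : 0 < lambda)
  (l : 'rV[R]_d) (l_unit : enorm l = 1)
  (Pxw : 'rV[R]_d -> Omega -> probability (pathM R d) R)
  (Pxw_mp : forall x w,
     solves_mp (fun y => grad (fun z => phi (tr z w)) y + lambda *: l) x (Pxw x w))
  (Pxw_meas : forall x (A : set (pathM R d)), measurable A ->
     measurable_fun [set: Omega] (fun w => (Pxw x w A : \bar R))) :
  let P0 := fun A : set (pathM R d) => (\int[P]_w Pxw (0%R : 'rV[R]_d) w A)%E in
  exists eps : R, 0 < eps /\
    forall l' : 'rV[R]_d, enorm l' = 1 -> enorm (l' - l) < eps ->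
    forall b : R, 0 < b ->
      exists c : R, 0 < c /\ exists L0 : R, forall L : R, L0 <= L ->
        (P0 (exit_neg l' b L) <= (expR (- (c * L)))%:E)%E.
Proof.
have eta0 : 0 <= eta by exact: le_trans (phi_bnd 0 point).
have beta0 : 0 <= beta by apply: le_trans (grad_bnd point 0); exact: sqrtr_ge0.
have [eps [C [th [eps0 C0 th0 H]]]] := grid_decay K hd lambda_gt0 l_unit eta0 beta0.
move=> P0; exists eps; split=> // l' l'1 l'eps b b0.
(* With [al = b L / 2] the exponent [th * al] is [2 c L]: one half is the final rate, the other
   absorbs the prefactor [C <= exp C] once [C <= c L]. *)
pose c := th * b / 4; have c0 : 0 < c by rewrite divr_gt0// mulr_gt0.
exists c; split=> //; exists (C / c + 1) => L LL0.
have L0 : 0 < L by apply: lt_le_trans LL0; have := divr_gt0 C0 c0; lra.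
pose al := b * L / 2; have bL := mulr_gt0 b0 L0.
apply: (@le_trans _ _ (\int[P]_w (expR (- (c * L)))%:E)%E); last first.
  by rewrite integral_cst//= probability_setT mule1.
(* The bound holds in every environment with the same constants, so the annealed law inherits it. *)
apply: integral_mono => w _.
apply: (@le_trans _ _ (C * expR (- (th * al)))%:E).
  apply: (@exit_decay _ _ _ _ _ _ al) => //; first by rewrite /al; lra.
  move=> k n; apply: (H l' l'1 l'eps (fun y => phi (tr y w))) => //.
  by rewrite /al divr_ge0// ltW.
rewrite lee_fin; apply: (@le_trans _ _ (expR C * expR (- (th * al)))).
  by rewrite ler_wpM2r ?expR_ge0//; have := expR_ge1Dx C; lra.
rewrite -expRD ler_expR.
have -> : th * al = 2 * (c * L) by rewrite /al /c; field.
have : C <= c * L.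
  rewrite mulrC -ler_pdivrMr//; apply: le_trans LL0; lra.
by lra.
Qed.
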